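(* Let $\alpha\ge 1$, and suppose that in the mean field traveling salesman problem the intercity distances $L_{ij}$, $1\le i<j\le n$, are i.i.d. with the Weibull distribution with shape parameter $1+\alpha$ and scale parameter $1$, i.e. with density $$f(t)=(1+\alpha)\,t^{\alpha}e^{-t^{1+\alpha}}\mathbf{1}(t>0).$$ Let $T_n^{NN}$ be the length of the nearest neighbor tour on $n$ cities, and set $\sigma^2(\alpha)=\Gamma\!\left(\frac{2}{1+\alpha}+1\right)-\Gamma^2\!\left(1+\frac{1}{1+\alpha}\right)$. Then, as $n\to\infty$: if $\alpha>1$, $$\frac{T_n^{NN}-\mathbb{E}[T_n^{NN}]}{n^{\frac12-\frac{1}{1+\alpha}}}\stackrel{d}{\longrightarrow} N\!\left(0,\ \frac{\alpha+1}{\alpha-1}\,\sigma^2(\alpha)\right),$$ and if $\alpha=1$, $$\frac{T_n^{NN}-\mathbb{E}[T_n^{NN}]}{\sqrt{\log n}}\stackrel{d}{\longrightarrow} N\!\left(0,\ \sigma^2(\alpha)\right).$$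
   Context: Mean field traveling salesman problem: there are $n$ cities $1,2,\dots,n$, and the intercity distances $L_{ij}=L_{ji}$, $1\le i<j\le n$, are i.i.d. random variables (no triangle inequality is required). Nearest neighbor (NN) tour: start at $v_1=1$; given $v_1,\dots,v_i$ with $i<n$, let $v_{i+1}$ be the city $u\notin\{v_1,\dots,v_i\}$ minimizing $L_{v_i u}$ (ties broken arbitrarily; they have probability zero here); after all cities are visited, return to city $1$, i.e. $v_{n+1}=1$. The length of the NN tour is $T_n^{NN}=\sum_{i=1}^{n} L_{v_i v_{i+1}}$. $N(0,s^2)$ denotes the normal distribution with mean $0$ and variance $s^2$; $\Gamma$ is the Gamma function and $\Gamma^2(x)=(\Gamma(x))^2$; $\stackrel{d}{\longrightarrow}$ is convergence in distribution. *)

(* Defs.v *)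
From HB Require Import structures.
From mathcomp Require Import all_boot all_order all_algebra.
From mathcomp Require Import all_classical all_reals all_analysis.
From mathcomp Require Import measurable_realfun.

Set Implicit Arguments.
Unset Strict Implicit.
Unset Printing Implicit Defensive.

Import Order.TTheory GRing.Theory Num.Theory.
Import numFieldNormedType.Exports.

Local Open Scope classical_set_scope.
Local Open Scope ring_scope.

Definition Gamma (R : realType) (x : R) : R :=
  \int[lebesgue_measure]_(t in `]0, +oo[) (t `^ (x - 1) * expR (- t)).

Definition weibull_pdf (R : realType) (alpha t : R) : R :=
  if 0 < t then (1 + alpha) * t `^ alpha * expR (- (t `^ (1 + alpha))) else 0.

Definition sigma2 (R : realType) (alpha : R) : R :=
  Gamma (2 / (1 + alpha) + 1) - Gamma (1 + 1 / (1 + alpha)) ^+ 2.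

Definition has_density (d : measure_display) (T : measurableType d)
    (R : realType) (P : probability T R) (X : {RV P >-> R}) (f : R -> R) : Prop :=
  forall B : set R, measurable B ->
    distribution P X B = (\int[lebesgue_measure]_(x in B) (f x)%:E)%E.

Definition mutually_independent (d : measure_display) (T : measurableType d)
    (R : realType) (P : probability T R) (I : finType) (A : {set I})
    (X : I -> {RV P >-> R}) : Prop :=
  forall (J : {set I}) (B : I -> set R),
    J \subset A -> (forall i, measurable (B i)) ->
    P (\bigcap_(i in [set` J]) (X i @^-1` B i)) =
    (\prod_(i in J) P (X i @^-1` B i))%E.

(* Pointwise convergence of the distribution functions at the continuity
   points of the limit; the X n may live on different probability spaces. *)
Definition cvg_in_distribution (R : realType) (d : nat -> measure_display)
    (T : forall n, measurableType (d n)) (P : forall n, probability (T n) R)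
    (X : forall n, {RV (P n) >-> R}) (mu : probability (measurableTypeR R) R) : Prop :=
  forall x : R, {for x, continuous (fun r : R => mu `]-oo, r]%classic)} ->
    cdf (X n) x @[n --> \oo] --> mu `]-oo, x]%classic.

Definition centered_scaled (d : measure_display) (T : measurableType d)
    (R : realType) (P : probability T R) (X : {RV P >-> R}) (c : R)
    : {RV P >-> R} :=
  scale_mfun c^-1 ((X : {mfun T >-> R}) - cst (fine 'E_P[X])).

(* City k of {1, ..., n} is the ordinal of value k - 1. Only the values
   v 1, ..., v n.+1 matter. Ties are resolved arbitrarily, so this is a
   relation and not a function of l. *)
Definition nn_tour (R : realType) (n : nat) (l : 'I_n -> 'I_n -> R)
    (v : nat -> 'I_n) : Prop :=
  [/\ v 1%N = 0%N :> nat,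
      (forall i, (1 <= i < n)%N ->
        let visited := [seq v j | j <- iota 1 i] in
        v i.+1 \notin visited /\
        (forall u, u \notin visited -> l (v i) (v i.+1) <= l (v i) u))
    & v n.+1 = v 1%N].

Definition tour_length (R : realType) (n : nat) (l : 'I_n -> 'I_n -> R)
    (v : nat -> 'I_n) : R :=
  \sum_(1 <= i < n.+1) l (v i) (v i.+1).

(* Main.v *)
(* For a fixed order of visiting the cities, the event that it is the nearest neighbor tour only involves, for each
   city, the comparison of the edge to the next city with the edges to the later ones. All these edges are distinct,
   so integrating out the losers of the comparisons shows that the n - 1 edges of the tour other than the closing one
   are distributed as independent minima of n - 1, ..., 2, 1 Weibull variables, that is as W_k / k^(1 / (1 + alpha))
   with W_k independent Weibull; the closing edge is bounded in L^1. Lindeberg's replacement, applied to functions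
   smoothed by the heat semigroup, then compares the sum with a Gaussian of variance
   sigma2 * sum_(k < n) k^(- 2 / (1 + alpha)), with an error controlled by third moments. This variance is equivalent
   to (alpha + 1) / (alpha - 1) * sigma2 * n^(1 - 2 / (1 + alpha)) if alpha > 1 and to sigma2 * ln n if alpha = 1, and
   smooth functions sandwiching the indicators of half-lines give the convergence of the distribution functions. *)
Require Import Defs.
From HB Require Import structures.
From mathcomp Require Import all_boot all_order all_algebra fingroup perm.
From mathcomp Require Import all_classical all_reals all_analysis.
From mathcomp Require Import measurable_realfun ring lra zify.
Set Implicit Arguments.
Unset Strict Implicit.
Unset Printing Implicit Defensive.
Import Order.TTheory GRing.Theory Num.Theory.
Import numFieldNormedType.Exports.
Local Open Scope classical_set_scope.
Local Open Scope ring_scope.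

(** * Integrating out independent variables *)

(** The distances live on an arbitrary probability space and independence is only a product formula
    for rectangles, so no product space is given to integrate over. Instead one variable at a time
    is split off from the sigma-algebra generated by the others, and what remains in the end is an
    iterated convolution, the operator [chain]. The replacement then compares operators: convolution
    with the density of an edge against a step of the heat semigroup. The semigroup does two things.
    Gaussian steps just add their times, so that no Gaussian variables have to be constructed; and
    smoothing preserves the cubic Taylor constant [K] of the test function, so that one constant
    serves all replacements. Since [k^(1/(1+alpha)) >= 1], each third moment is at most a constant
    times the variance divided by the normalization. Hence the total error vanishes once the
    normalization tends to infinity and the variances stay bounded, which treats [alpha > 1] and
    [alpha = 1] together. *)

Section peeling.
Local Open Scope ereal_scope.
Context (d : measure_display) (T : measurableType d) (R : realType)
  (P : probability T R) (I : finType) (A : {set I}) (X : I -> {RV P >-> R})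
  (indep : mutually_independent A X).

Definition cylinders (K : {set I}) : set (set T) :=
  [set C | exists2 B : I -> set R, forall i, measurable (B i) &
     C = \bigcap_(i in [set` K]) (X i @^-1` B i)].

Notation sigma K := (g_sigma_algebraType (cylinders K)).

Lemma measurable_preimage_RV (i : I) (B : set R) :
  measurable B -> measurable (X i @^-1` B).
Proof. by move=> mB; rewrite -[X in measurable X]setTI; exact: measurable_funP. Qed.

Lemma cylinders_measurable (K : {set I}) : cylinders K `<=` measurable.
Proof.
move=> _ [B mB ->]; apply: fin_bigcap_measurable; first exact: finite_finset.
by move=> i _; exact: measurable_preimage_RV.
Qed.

Lemma sub_sigma_measurable (K : {set I}) (C : set T) :
  (measurable : set (set (sigma K))) C -> measurable C.
Proof.
apply: smallest_sub; last exact: cylinders_measurable.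
exact: sigma_algebra_measurable.
Qed.

Lemma measurable_id_sigma (K : {set I}) : measurable_fun setT (id : T -> sigma K).
Proof. by move=> _ C mC; rewrite setTI; exact: sub_sigma_measurable mC. Qed.

Lemma cylindersT (K : {set I}) : cylinders K setT.
Proof.
by exists (fun=> setT) => //; rewrite bigcapT.
Qed.

(** Both sides are finite measures in [C]. They agree on the cylinders, a pi-system generating
    [sigma K], because a cylinder over [K] cut by a condition on [X p] is a cylinder over
    [p |: K]. *)
Lemma indep_cylinder (K : {set I}) p (B : set R) (C : set T) :
  K \subset A -> p \in A -> p \notin K -> measurable B ->
  (measurable : set (set (sigma K))) C ->
  P (X p @^-1` B `&` C) = P (X p @^-1` B) * P C.
Proof.
move=> KA pA pK mB mC.
have mXB : measurable (X p @^-1` B) by exact: measurable_preimage_RV.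
pose m1 : {measure set T -> \bar R} := mrestr P mXB.
pose r : {nonneg R} := NngNum (fine_ge0 (measure_ge0 P (X p @^-1` B))).
pose m2 : {measure set T -> \bar R} := mscale r P.
have rE : (r%:num)%:E = P (X p @^-1` B).
  by rewrite /r/= fineK// fin_num_measure.
suff : m1 C = m2 C.
  by rewrite /m1/m2/= /mrestr /mscale/= rE setIC.
apply: (@g_sigma_algebra_measure_unique _ _ _ (cylinders K) _ (fun=> setT)) => //.
- exact: cylinders_measurable.
- by move=> _; exact: cylindersT.
- by rewrite bigcup_const.
- move=> _ _ [B1 mB1 ->] [B2 mB2 ->]; exists (fun i => B1 i `&` B2 i).
    by move=> i; exact: measurableI.
  by rewrite -bigcapI.
- move=> _ [B1 mB1 ->]; rewrite /m1/m2/= /mrestr /mscale/= rE.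
  pose B' i := if i == p then B else B1 i.
  have mB' i : measurable (B' i) by rewrite /B'; case: ifP.
  have KpA : p |: K \subset A by rewrite finset.subUset finset.sub1set pA.
  have eqB i : i \in K -> B' i = B1 i.
    by move=> iK; rewrite /B'; case: eqP => // ip; rewrite -ip iK in pK.
  have eqK : \bigcap_(i in [set` K]) (X i @^-1` B1 i) =
             \bigcap_(i in [set` K]) (X i @^-1` B' i).
    by apply: eq_bigcapr => i /= iK; rewrite eqB.
  have -> : \bigcap_(i in [set` K]) (X i @^-1` B1 i) `&` X p @^-1` B =
            \bigcap_(i in [set` p |: K]%SET) (X i @^-1` B' i).
    rewrite eqK; apply/seteqP; split => [w [wK wp] i /=|w wK].
      rewrite !inE => /orP[/eqP ->|]; last exact: wK.
      by rewrite /B' eqxx.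
    split; first by move=> i /= iK; apply: wK => /=; rewrite !inE iK orbT.
    have := wK p; rewrite /B' eqxx; apply => /=.
    by rewrite !inE eqxx.
  rewrite (indep KpA mB') big_setU1//= /B' eqxx -/B'; congr (_ * _).
  by rewrite eqK (indep KA mB').
- by move=> _; rewrite /m1/= /mrestr (le_lt_trans (probability_le1 _ _)) ?ltry//; exact: measurableI.
Qed.

(** The identity of [T], seen as a map into [sigma K], plays the random variable that carries all
    the [X i] with [i] in [K]. By [indep_cylinder] its joint law with [X p] is a product measure,
    and Tonelli's theorem applies. *)
Lemma peel_integral (K : {set I}) p (F : R * sigma K -> \bar R) :
  K \subset A -> p \in A -> p \notin K ->
  measurable_fun setT F -> (forall z, 0 <= F z) ->
  \int[P]_w F (X p w, w) =
  \int[P]_w \int[distribution P (X p)]_x F (x, w).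
Proof.
move=> KA pA pK mF F0.
pose Y : T -> sigma K := id.
have mY : measurable_fun setT Y by exact: measurable_id_sigma.
pose Yf : {mfun T >-> sigma K} := HB.pack Y (isMeasurableFun.Build _ _ _ _ Y mY).
pose Z : T -> R * sigma K := fun w => (X p w, w).
have mZ : measurable_fun setT Z by apply/measurable_fun_pairP; split => //.
pose Zf : {mfun T >-> (R * sigma K)%type} :=
  HB.pack Z (isMeasurableFun.Build _ _ _ _ Z mZ).
transitivity (\int[distribution P Zf]_z F z).
  by rewrite ge0_integral_distribution.
pose m12 := (distribution P (X p) \x distribution P Yf)%E.
transitivity (\int[m12]_z F z).
  apply: eq_measure_integral => C mC _.
  apply/esym/product_measure_unique => //.
  by move=> B C' mB mC'; exact: (indep_cylinder KA pA pK mB mC').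
rewrite /m12 fubini_tonelli2//.
rewrite ge0_integral_distribution//.
- exact: measurable_fun_fubini_tonelli_G.
- by move=> y; exact: integral_ge0.
Qed.
End peeling.

Section density.
Local Open Scope ereal_scope.
Context (R : realType).
Notation leb := (@lebesgue_measure R).

(** The change of variables holds for the Radon-Nikodym derivative of [nu], and [q] equals it almost
    everywhere because the two have the same integral over every measurable set. *)
Lemma ge0_integral_density (nu : {finite_measure set (measurableTypeR R) -> \bar R}) (q : R -> R)
    (g : R -> \bar R) :
  measurable_fun setT q -> (forall x, 0 <= q x)%R ->
  (forall A, measurable A -> nu A = \int[leb]_(x in A) (q x)%:E) ->
  measurable_fun setT g -> (forall x, 0 <= g x) ->
  \int[nu]_x g x = \int[leb]_x (g x * (q x)%:E).
Proof.
move=> mq q0 nuq mg g0.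
have dom : nu `<< leb.
  apply/null_content_dominatesP => A mA A0; rewrite nuq// null_set_integral//.
  exact/measurable_funTS/measurable_EFinP.
rewrite -(Radon_Nikodym_SigmaFinite.change_of_variables dom)//.
have iq : leb.-integrable setT (EFin \o q).
  apply/integrableP; split; first exact/measurable_EFinP.
  under eq_integral do rewrite /= ger0_norm//.
  by rewrite -nuq// -ge0_fin_numE// fin_num_measure.
have mf := measurable_int _ (Radon_Nikodym_SigmaFinite.f_integrable dom).
apply: ge0_ae_eq_integral => //.
- exact: emeasurable_funM.
- by apply: emeasurable_funM => //; exact/measurable_EFinP.
- by move=> x _; rewrite mule_ge0// Radon_Nikodym_SigmaFinite.f_ge0.
- by move=> x _; rewrite mule_ge0// lee_fin.
have : ae_eq leb setT (Radon_Nikodym_SigmaFinite.f nu leb) (EFin \o q).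
  apply: integral_ae_eq => //.
  - exact: Radon_Nikodym_SigmaFinite.f_integrable.
  - exact/measurable_EFinP.
  - by move=> A _ mA; rewrite -Radon_Nikodym_SigmaFinite.f_integral// nuq.
by apply: filterS => x + _ => /(_ I) ->.
Qed.

Definition convol (q : R -> R) (F : R -> \bar R) (x : R) : \bar R :=
  \int[leb]_y (F (x + y)%R * (q y)%:E).

(* The expectation of [F (x + Y_1 + ... + Y_r)] for independent [Y_k] of density [q k]. *)
Fixpoint chain (q : nat -> R -> R) (r : nat) (F : R -> \bar R) : R -> \bar R :=
  if r is r'.+1 then chain q r' (convol (q r) F) else F.

Lemma convol_ge0 (q : R -> R) (F : R -> \bar R) x : (forall y, 0 <= q y)%R -> (forall y, 0 <= F y) ->
  0 <= convol q F x.
Proof. by move=> q0 F0; apply: integral_ge0 => y _; rewrite mule_ge0// lee_fin. Qed.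

Lemma measurable_convol (q : R -> R) (F : R -> \bar R) : measurable_fun setT q -> (forall y, 0 <= q y)%R ->
  measurable_fun setT F -> (forall y, 0 <= F y) ->
  measurable_fun setT (convol q F).
Proof.
move=> mq q0 mF F0.
pose G (z : R * R) := F (z.1 + z.2)%R * (q z.2)%:E.
apply: (@measurable_fun_fubini_tonelli_F _ _ _ _ _ leb G).
  apply: emeasurable_funM.
    apply: (measurableT_comp mF); apply: measurable_funD => //.
  by apply/measurable_EFinP; apply: (measurableT_comp mq).
by move=> z; rewrite mule_ge0// lee_fin.
Qed.

End density.

Section integrate_out.
Local Open Scope ereal_scope.
Context (d : measure_display) (T : measurableType d) (R : realType)
  (P : probability T R) (I : finType) (A : {set I}) (X : I -> {RV P >-> R})
  (indep : mutually_independent A X) (f : R -> R)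
  (mf : measurable_fun setT f) (f0 : forall x, (0 <= f x)%R)
  (densX : forall p, p \in A -> has_density (X p) f).
Notation leb := (@lebesgue_measure R).
Notation sigma K := (g_sigma_algebraType (cylinders X K)).

Lemma integral_RV_density p (g : R -> \bar R) : p \in A ->
  measurable_fun setT g -> (forall x, 0 <= g x) ->
  \int[distribution P (X p)]_x g x = \int[leb]_x (g x * (f x)%:E).
Proof.
move=> pA mg g0.
pose Y : T -> measurableTypeR R := X p.
have mX : measurable_fun setT (X p) by exact: measurable_funP.
have mY : measurable_fun setT Y := mX.
pose Yf : {mfun T >-> measurableTypeR R} := HB.pack Y (isMeasurableFun.Build _ _ _ _ Y mY).
transitivity (\int[distribution P Yf]_x g x).
  by rewrite !ge0_integral_distribution.
by apply: (@ge0_integral_density R (distribution P Yf) f g) => //; exact: densX.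
Qed.

Lemma measurable_RV_sigma (K : {set I}) i : i \in K ->
  measurable_fun setT (X i : sigma K -> R).
Proof.
move=> iK _ B mB; rewrite setTI; apply: sub_sigma_algebra.
exists (fun j => if j == i then B else setT); first by move=> j; case: ifP.
apply/seteqP; split => [w Bw j /= jK|w]; first by case: eqP => // ->.
by move=> /(_ i iK); rewrite eqxx.
Qed.

Lemma measurable_sigma_subset (K K' : {set I}) d' (E : measurableType d') (g : T -> E) :
  K \subset K' -> measurable_fun setT (g : sigma K -> E) ->
  measurable_fun setT (g : sigma K' -> E).
Proof.
move=> KK' mg _ B mB; rewrite setTI.
have := mg measurableT B mB; rewrite setTI.
apply: sub_smallest2r; first exact: smallest_sigma_algebra.
move=> _ [C mC ->].
exists (fun j => if j \in K then C j else setT).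
  by move=> j; case: ifP.
apply/seteqP; split => [w Cw j /= jK'|w Cw j /= jK].
  by case: ifPn => // jK; exact: Cw.
by have := Cw j (fintype.subsetP KK' j jK); rewrite /= jK.
Qed.

(** Each loser [p] occurs in a single comparison, against a winner [e p] kept in [K]. Given all
    other variables, the probability that [X p] exceeds [X (e p)] is the tail [S] at [X (e p)]. *)
Lemma integrate_out_comparisons (K : {set I}) (s : seq I) (e : I -> I) (h : T -> \bar R) (S : R -> R) :
  measurable_fun setT S -> (forall t, (0 <= S t)%R) ->
  (forall t, \int[leb]_(x in `]t, +oo[) (f x)%:E = (S t)%:E) ->
  K \subset A -> uniq s -> {subset s <= A} ->
  {in s, forall p, p \notin K} -> {in s, forall p, e p \in K} ->
  measurable_fun setT (h : sigma K -> \bar R) -> (forall w, 0 <= h w) ->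
  \int[P]_w (h w * (\prod_(p <- s) (X (e p) w < X p w)%R%:R)%:E) =
  \int[P]_w (h w * (\prod_(p <- s) S (X (e p) w))%:E).
Proof.
move=> mS S0 fS KA; elim: s h => [|p s IH] h.
  by move=> *; under eq_integral do rewrite big_nil; under [RHS]eq_integral do rewrite big_nil.
move=> /= /andP[ps us] sA sK eK mh h0.
have pK : p \notin K by apply: sK; rewrite mem_head.
have epK : e p \in K by apply: eK; rewrite mem_head.
have pA : p \in A by apply: sA; rewrite mem_head.
(* [K'] also contains the losers that are still to be integrated out, since the remaining
   comparisons depend on them. *)
pose K' := K :|: [set q in s]%SET.
have KK' : K \subset K' by apply: finset.subsetUl.
have K'A : K' \subset A.
  rewrite finset.subUset KA; apply/fintype.subsetP => q; rewrite inE => qs.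
  by apply: sA; rewrite inE qs orbT.
have pK' : p \notin K' by rewrite !inE (negbTE pK).
have eK' q : q \in s -> e q \in K'.
  by move=> qs; apply: (fintype.subsetP KK'); apply: eK; rewrite inE qs orbT.
have sK' q : q \in s -> q \in K' by move=> qs; rewrite !inE qs orbT.
pose F (z : R * sigma K') : \bar R := h z.2 * ((X (e p) z.2 < z.1)%R%:R)%:E *
   (\prod_(q <- s) (X (e q) z.2 < X q z.2)%R%:R)%:E.
have F0 z : 0 <= F z.
  by rewrite /F !mule_ge0// lee_fin// prodr_ge0.
have mcmp (d' : measure_display) (E : measurableType d') (u v : E -> R) :
    measurable_fun setT u -> measurable_fun setT v ->
    measurable_fun setT (fun w => ((u w < v w)%R%:R : R)).
  move=> mu mv; have mlt : measurable_fun setT (fun w => (u w < v w)%R) by exact: measurable_fun_ltr.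
  by apply: (measurableT_comp (f := fun b : bool => b%:R : R)).
have mF : measurable_fun setT F.
  apply: emeasurable_funM; first apply: emeasurable_funM.
  - apply: (@measurableT_comp _ _ _ _ _ _ (h : sigma K' -> \bar R) _ snd) => //.
    exact: measurable_sigma_subset mh.
  - apply/measurable_EFinP; apply: mcmp => //.
    apply: (@measurableT_comp _ _ _ _ _ _ (X (e p) : sigma K' -> R) _ snd) => //.
    by apply: measurable_RV_sigma; exact: (fintype.subsetP KK').
  - apply/measurable_EFinP.
    apply: (@measurableT_comp _ _ _ _ _ _ ((fun w => \prod_(q <- s) (X (e q) w < X q w)%R%:R)%R : sigma K' -> R) _ snd) => //.
    apply: measurable_prod => q qs; apply: mcmp; apply: measurable_RV_sigma.
      exact: eK'.
    exact: sK'.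
transitivity (\int[P]_w F (X p w, w)).
  by apply: eq_integral => w _; rewrite /F big_cons EFinM muleA.
rewrite (peel_integral indep K'A pA pK' mF F0).
transitivity (\int[P]_w (h w * (S (X (e p) w))%:E * (\prod_(q <- s) (X (e q) w < X q w)%R%:R)%:E)).
  apply: eq_integral => w _; rewrite /F/=.
  have -> : h w * (S (X (e p) w))%:E * (\prod_(q <- s) (X (e q) w < X q w)%R%:R)%:E =
     (h w * (\prod_(q <- s) (X (e q) w < X q w)%R%:R)%:E) * (S (X (e p) w))%:E.
    by rewrite muleAC.
  rewrite -fS.
  under eq_integral do rewrite muleAC.
  rewrite ge0_integralZl//; last 2 first.
  - by apply/measurable_EFinP; apply: mcmp.
  - by rewrite mule_ge0// lee_fin prodr_ge0.
  congr (_ * _).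
  rewrite (@integral_RV_density p (fun x => (X (e p) w < x)%R%:R%:E))//; last first.
    by apply/measurable_EFinP; apply: mcmp.
  rewrite [RHS]integral_mkcond; apply: eq_integral => x _; rewrite patchE/=.
  have [xw|xw] := ltP (X (e p) w) x.
    by rewrite mul1e mem_set//= in_itv/= xw.
  by rewrite mul0e memNset//= in_itv/= andbT ltNge xw.
transitivity (\int[P]_w ((h w * (S (X (e p) w))%:E) * (\prod_(q <- s) S (X (e q) w))%:E)).
  apply: IH => //.
  - by move=> q qs; apply: sA; rewrite inE qs orbT.
  - by move=> q qs; apply: sK; rewrite inE qs orbT.
  - by move=> q qs; apply: eK; rewrite inE qs orbT.
  - apply: emeasurable_funM => //; apply/measurable_EFinP.
    by apply: measurableT_comp => //; exact: measurable_RV_sigma.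
  - by move=> w; rewrite mule_ge0// lee_fin.
by apply: eq_integral => w _; rewrite big_cons EFinM muleA.
Qed.

(** Integrating the last variable, with its density tilted by the weight [g r], turns [F] into a
    convolution evaluated at the sum of the others. This is the recursion of [chain]. *)
Lemma integrate_out_sum (x : nat -> I) (g : nat -> R -> R) r (F : R -> \bar R) :
  (forall k, (0 < k <= r)%N -> x k \in A) ->
  (forall k l, (0 < k <= r)%N -> (0 < l <= r)%N -> x k = x l -> k = l) ->
  (forall k, measurable_fun setT (g k)) -> (forall k y, (0 <= g k y)%R) ->
  measurable_fun setT F -> (forall y, 0 <= F y) ->
  \int[P]_w (F (\sum_(1 <= k < r.+1) X (x k) w)%R *
              (\prod_(1 <= k < r.+1) g k (X (x k) w))%:E) =
  chain (fun k y => g k y * f y)%R r F 0%R.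
Proof.
move=> + + mg g0; elim: r F => [|r IH] F xA xinj mF F0.
  rewrite /=; under eq_integral do rewrite !big_geq//= mule1.
  by rewrite integral_cst//= probability_setT mule1.
have ler k : (0 < k <= r)%N -> (0 < k <= r.+1)%N by move=> /andP[-> /=] /leqW.
pose K := [set x (val k).+1 | k in 'I_r]%SET.
have KA : K \subset A.
  by apply/fintype.subsetP => _ /finset.imsetP[k _ ->]; apply: xA; rewrite /= ltnS ltnW.
have xK k : (0 < k <= r)%N -> x k \in K.
  case: k => // k /andP[_ kr]; apply/finset.imsetP; exists (Ordinal kr) => //.
have pA : x r.+1 \in A by apply: xA; rewrite /= leqnn.
have pK : x r.+1 \notin K.
  apply/negP => /finset.imsetP[k _] /xinj; rewrite /= leqnn => /(_ isT).
  by rewrite ltnS ltnW// => /(_ isT) [] rk; have := ltn_ord k; rewrite -rk ltnn.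
pose G (z : R * sigma K) := F (\sum_(1 <= k < r.+1) X (x k) z.2 + z.1)%R *
   (\prod_(1 <= k < r.+1) g k (X (x k) z.2))%:E * (g r.+1 z.1)%:E.
have mX k : (0 < k <= r)%N -> measurable_fun setT (fun z : R * sigma K => X (x k) z.2).
  move=> kr; apply: (@measurableT_comp _ _ _ _ _ _ (X (x k) : sigma K -> R) _ snd) => //.
  by apply: measurable_RV_sigma; exact: xK.
have G0 z : 0 <= G z by rewrite !mule_ge0// lee_fin// prodr_ge0.
have mG : measurable_fun setT G.
  apply: emeasurable_funM; first apply: emeasurable_funM.
  - apply: (measurableT_comp mF); apply: measurable_funD => //.
    under eq_fun do rewrite big_nat_cond.
    under eq_fun do rewrite -big_nat_cond big_add1/= big_mkord.
    by apply: measurable_sum => i; apply: mX; rewrite /= ltn_ord.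
  - apply/measurable_EFinP.
    under eq_fun do rewrite big_add1/= big_mkord.
    apply: measurable_prod => i _; apply: measurableT_comp => //.
    by apply: mX; rewrite /= ltn_ord.
  - by apply/measurable_EFinP; exact: measurableT_comp.
transitivity (\int[P]_w G (X (x r.+1) w, w)).
  by apply: eq_integral => w _; rewrite /G/= !(big_nat_recr r.+1)//= EFinM muleA.
rewrite (peel_integral indep KA pA pK mG G0) /=.
rewrite -IH; first last.
- by move=> y; apply: convol_ge0 => // z; rewrite mulr_ge0.
- by apply: measurable_convol => //; [exact: measurable_funM|move=> y; rewrite mulr_ge0].
- by move=> k l kr lr; apply: xinj; exact: ler.
- by move=> k kr; apply/xA/ler.
apply: eq_integral => w _; rewrite /G/=.
under eq_integral do rewrite muleAC.
set c := (\prod_(_ <= _ < _) _)%R; set s := (\sum_(_ <= _ < _) _)%R.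
have c0 : (0 <= c)%R by exact: prodr_ge0.
have mFs : measurable_fun setT (fun y => F (s + y)%R * (g r.+1 y)%:E).
  apply: emeasurable_funM; last exact/measurable_EFinP.
  by apply: (measurableT_comp mF); exact: measurable_funD.
have Fs0 y : 0 <= F (s + y)%R * (g r.+1 y)%:E by rewrite mule_ge0// lee_fin.
rewrite ge0_integralZr//.
congr (_ * _); rewrite /convol; apply: eq_trans (integral_RV_density pA mFs Fs0) _.
by apply: eq_integral => y _; rewrite EFinM muleA.
Qed.

End integrate_out.

(** * Minima of Weibull variables *)

Lemma ge0_integral_affine (R : realType) (G : R -> R) (c b : R) : 0 < c ->
  continuous G -> (forall x, 0 <= G x) ->
  (\int[lebesgue_measure]_x (G x)%:E =
   \int[lebesgue_measure]_x (G (c * x + b) * c)%:E)%E.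
Proof.
move=> c0 cG G0; pose F (x : R) := c * x + b.
have dF x : is_derive (x : R^o) 1 F c.
  have -> : c = c *: (1:R) + 0 by rewrite addr0 /GRing.scale/= mulr1.
  by apply: is_deriveD; apply: is_deriveZ.
have F'E : F^`()%classic = cst c by apply/funext => x; rewrite derive1E derive_val.
rewrite (@increasing_ge0_integration_by_substitutionT R F G)//.
- by apply: eq_integral => x _; rewrite F'E.
- by move=> x y xy; rewrite /F ltrD2r ltr_pM2l.
- by rewrite F'E => ?; exact: cvg_cst.
- by rewrite F'E; exact: is_cvg_cst.
- by rewrite F'E; exact: is_cvg_cst.
- apply/cvgrNyPle => A.
  apply: filterS (nbhs_ninfty_le (num_real ((A - b) / c))) => x.
  by rewrite ler_pdivlMr// /F mulrC lerBrDr.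
- apply/cvgryPge => A.
  apply: filterS (nbhs_pinfty_ge (num_real ((A - b) / c))) => x.
  by rewrite ler_pdivrMr// /F mulrC lerBlDr.
Qed.

Lemma near_eq_continuous_at (R : realType) (f g : R -> R) (y : R) :
  (\near y, f y = g y) -> {for y, continuous f} -> {for y, continuous g}.
Proof.
rewrite /prop_for /continuous_at => fg fy; rewrite -(nbhs_singleton fg).
by apply: cvg_trans fy; apply: near_eq_cvg.
Qed.

Section positive_part_power.
Context (R : realType).
Implicit Types a y : R.

(** Truncating the base at [0] gives, for [a > 0], a function continuous on the whole line.
    Densities built from it vanish on the negative half-line without a case distinction. *)
Definition ppow a y : R := (Num.max 0 y) `^ a.

Lemma ppow_ge0 a y : 0 <= ppow a y. Proof. exact: powR_ge0. Qed.

Lemma ge0_ppow a y : 0 <= y -> ppow a y = y `^ a.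
Proof. by move=> y0; rewrite /ppow max_r. Qed.

Lemma le0_ppow a y : 0 < a -> y <= 0 -> ppow a y = 0.
Proof. by move=> a0 y0; rewrite /ppow max_l// powR0 ?gt_eqF. Qed.

Lemma continuous_ppow a : 0 < a -> continuous (ppow a).
Proof.
move=> a0 y; have [y0|y0|->] := ltgtP y 0.
- apply: (@near_eq_continuous_at _ (cst 0)); last exact: cst_continuous.
  by apply: filterS (lt_nbhsl y0) => z /ltW z0; rewrite le0_ppow.
- apply: (@near_eq_continuous_at _ (fun z => z `^ a)).
    by apply: filterS (lt_nbhsr y0) => z /ltW z0; rewrite ge0_ppow.
  apply: differentiable_continuous; apply/derivable1_diffP.
  by apply: derivable_powR; rewrite in_itv/= andbT.
- rewrite /continuous_at le0_ppow//; apply/cvgrPdist_le => e e0.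
  apply: filterS (nbhsx_ballx (0:R) _ (powR_gt0 a^-1 e0)) => z.
  rewrite /ball/= sub0r normrN => /ltW ze; rewrite sub0r normrN ger0_norm ?ppow_ge0//.
  have -> : e = (e `^ a^-1) `^ a by rewrite -powRrM mulVf ?gt_eqF// powRr1// ltW.
  apply: ge0_ler_powR; rewrite ?nnegrE ?powR_ge0 ?le_max ?lexx ?(ltW a0)//.
  by rewrite ge_max powR_ge0/= (le_trans (ler_norm _)).
Qed.

Lemma is_derive_ppow a y : 0 < y ->
  is_derive (y : R^o) 1 (ppow (1 + a) : R^o -> R^o) ((1 + a) * ppow a y).
Proof.
move=> y0; apply: (@near_eq_is_derive _ _ _ (fun z : R^o => z `^ (1 + a) : R^o)).
  by near=> z; rewrite ge0_ppow// ltW//; near: z; exact: lt_nbhsr.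
have := is_derive1_powR (1 + a) y0.
by rewrite (ge0_ppow _ (ltW y0)) addrAC subrr add0r.
Unshelve. all: by end_near. Qed.

End positive_part_power.

Section weibull.
Context (R : realType) (alpha : R).
Hypothesis alpha_ge1 : 1 <= alpha.
Notation leb := (@lebesgue_measure R).
Let alpha_gt0 : 0 < alpha. Proof. exact: lt_le_trans alpha_ge1. Qed.
Let alpha1_gt0 : 0 < 1 + alpha. Proof. by rewrite addr_gt0. Qed.

Definition survival (y : R) : R := expR (- ppow (1 + alpha) y).

(* The density of the minimum of [k] independent Weibull variables. *)
Definition min_pdf (k : nat) (y : R) : R :=
  k%:R * (1 + alpha) * ppow alpha y * expR (- (k%:R * ppow (1 + alpha) y)).

Lemma survival_ge0 y : 0 <= survival y. Proof. exact: expR_ge0. Qed.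

Lemma min_pdf_ge0 k y : 0 <= min_pdf k y.
Proof. by rewrite /min_pdf !mulr_ge0 ?expR_ge0 ?ppow_ge0 ?ler0n ?(ltW alpha1_gt0). Qed.

Lemma min_pdf_le0 k y : y <= 0 -> min_pdf k y = 0.
Proof. by move=> y0; rewrite /min_pdf (le0_ppow alpha_gt0 y0) mulr0 mul0r. Qed.

(** This is the form in which the minimum appears: integrating out [k - 1] losers leaves
    [survival ^+ k.-1] on the winner, and the factors [k] will be supplied by the number of visiting
    orders. *)
Lemma min_pdfE k y : min_pdf k y = k%:R * survival y ^+ k.-1 * min_pdf 1 y.
Proof.
case: k => [|k]; first by rewrite /min_pdf !mul0r.
rewrite /min_pdf /survival /= -expRM_natl mul1r.
set p := ppow _ _ in |- *; set q := ppow _ _.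
have -> : expR (- (k.+1%:R * q)) = expR (k%:R * - q) * expR (- (1 * q)).
  by rewrite -expRD; congr expR; rewrite -natr1; ring.
ring.
Qed.

Lemma weibull_pdfE : weibull_pdf alpha = min_pdf 1.
Proof.
apply/funext => t; rewrite /weibull_pdf; case: ltP => [t0|t0]; last by rewrite min_pdf_le0.
by rewrite /min_pdf !mul1r !ge0_ppow// ltW.
Qed.

Lemma continuous_survival : continuous survival.
Proof.
move=> y; apply: continuous_comp; last exact: continuous_expR.
by apply: (@continuousN _ R^o); exact: continuous_ppow.
Qed.

Lemma continuous_min_pdf k : continuous (min_pdf k).
Proof.
move=> y; apply: cvgM.
  by apply: cvgM; [exact: cvg_cst|exact: continuous_ppow].
apply: (cvg_comp _ expR); last exact: continuous_expR.
apply: (@cvgN _ R^o); apply: cvgM; first exact: cvg_cst.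
exact: continuous_ppow.
Qed.

Lemma measurable_min_pdf k : measurable_fun setT (min_pdf k).
Proof. by apply: continuous_measurable_fun; exact: continuous_min_pdf. Qed.

Lemma measurable_survival : measurable_fun setT survival.
Proof. by apply: continuous_measurable_fun; exact: continuous_survival. Qed.

Lemma min_pdf_tail k t : (0 < k)%N ->
  (\int[leb]_(x in `]t, +oo[) (min_pdf k x)%:E = (survival t ^+ k)%:E)%E.
Proof.
move=> k0.
(* For negative [t] both sides have their value at [0]. The primitive is differentiated only at
   positive points, where [is_derive_ppow] applies. *)
wlog t0 : t / 0 <= t => [H|].
  have [t0|/ltW t0] := leP 0 t; first exact: H.
  rewrite [RHS](_ : _ = (survival 0 ^+ k)%:E); last first.
    by rewrite /survival !le0_ppow.
  rewrite -H// integral_mkcond [RHS]integral_mkcond; apply: eq_integral => x _.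
  rewrite !patchE; have [x0|x0] := leP x 0.
    by rewrite min_pdf_le0//; do 2 case: ifP.
  by rewrite !mem_set//= in_itv/= andbT// (le_lt_trans t0).
have sE x : survival x ^+ k = expR (- (k%:R * ppow (1 + alpha) x)).
  by rewrite /survival -expRM_natl mulrN.
pose F (x : R) : R := - expR (- (k%:R * ppow (1 + alpha) x)).
have cF : continuous F.
  move=> x; apply: (@cvgN _ R^o); apply: (cvg_comp _ expR); last exact: continuous_expR.
  apply: (@cvgN _ R^o); apply: cvgM; first exact: cvg_cst.
  exact: continuous_ppow.
have dF x : 0 < x -> is_derive (x : R^o) 1 F (min_pdf k x).
  move=> x0; have dp := is_derive_ppow alpha x0.
  apply: is_derive_eq; rewrite /min_pdf /GRing.scale/= ; ring.
rewrite integral_itv_obnd_cbnd; last first.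
  by apply: measurable_funTS; apply/measurable_EFinP; exact: measurable_min_pdf.
rewrite (@ge0_continuous_FTC2y R (min_pdf k) F t 0).
- by rewrite sE /F add0e -EFinN opprK.
- by move=> x _; exact: min_pdf_ge0.
- by apply: continuous_subspaceT; exact: continuous_min_pdf.
- rewrite /F -oppr0; apply: cvgN.
  apply: (@cvg_comp _ _ _ (fun x => k%:R * ppow (1 + alpha) x) (fun x => expR (- x)) _ +oo); last exact: cvgr_expR.
  apply/cvgryPge => A.
  apply: filterS (nbhs_pinfty_ge (num_real (Num.max 1 A))) => x.
  rewrite ge_max => /andP[x1 Ax]; apply: (le_trans Ax).
  rewrite -[leLHS]mul1r ler_pM ?ler1n ?ler01 ?(le_trans ler01)//.
  rewrite ge0_ppow ?(le_trans ler01)//.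
  by rewrite -[leLHS]powRr1 ?(le_trans ler01)// ler_powR// lerDl ltW.
- by move=> x /(le_lt_trans t0) /dF[].
- by apply/cvg_at_right_filter; exact: cF.
- move=> x; rewrite in_itv/= andbT => /(le_lt_trans t0) /dF[_ <-].
  by rewrite derive1E.
Qed.

Lemma integral_min_pdf k : (0 < k)%N -> (\int[leb]_x (min_pdf k x)%:E = 1)%E.
Proof.
move=> k0; have := min_pdf_tail 0 k0.
rewrite /survival le0_ppow// oppr0 expR0 expr1n => <-.
rewrite [RHS]integral_mkcond; apply: eq_integral => x _.
rewrite patchE; have [x0|x0] := leP x 0; first by rewrite min_pdf_le0//; case: ifP.
by rewrite mem_set//= in_itv/= x0.
Qed.

(** [min_pdf k] is the density of a Weibull variable divided by [c = k^(1/(1+alpha))]: as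
    [c^(1+alpha) = k], the substitution [x -> c x] produces the factor [k] in the exponential. *)
Lemma min_pdf_moment_scaling k p : (0 < k)%N ->
  (\int[leb]_x (x ^+ p * min_pdf 1 x)%:E =
   ((k%:R `^ (1 / (1 + alpha))) ^+ p)%:E * \int[leb]_x (x ^+ p * min_pdf k x)%:E)%E.
Proof.
move=> k0; set c := _ `^ _.
have c0 : 0 < c by rewrite powR_gt0// ltr0n.
have cc : c `^ (1 + alpha) = k%:R.
  by rewrite /c -powRrM div1r mulVf ?gt_eqF// powRr1.
have cca : c * c `^ alpha = k%:R.
  by rewrite -cc powRD ?gt_eqF ?implybT// powRr1// ltW.
have mulp a x : ppow a (c * x) = c `^ a * ppow a x.
  rewrite /ppow -powRM; [|exact: ltW|by rewrite le_max lexx].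
  by rewrite maxr_pMr ?mulr0// ltW.
rewrite (@ge0_integral_affine _ (fun x => x ^+ p * min_pdf 1 x) c 0)//; last 2 first.
- move=> x; apply: cvgM; first exact: exprn_continuous.
  exact: continuous_min_pdf.
- move=> x; have [x0|/ltW x0] := leP x 0; first by rewrite min_pdf_le0 ?mulr0.
  by rewrite mulr_ge0 ?exprn_ge0 ?min_pdf_ge0.
rewrite -ge0_integralZl//; last 3 first.
- apply/measurable_EFinP; apply: measurable_funM; first exact: measurable_funX.
  exact: measurable_min_pdf.
- move=> x _; rewrite lee_fin; have [x0|/ltW x0] := leP x 0; first by rewrite min_pdf_le0 ?mulr0.
  by rewrite mulr_ge0 ?exprn_ge0 ?min_pdf_ge0.
- by rewrite lee_fin exprn_ge0// ltW.
apply: eq_integral => x _; rewrite -EFinM; congr EFin.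
rewrite addr0 /min_pdf !mulp cc mul1r exprMn mul1r -[in X in _ = _ * (_ * (X * _ * _ * _))]cca; ring.
Qed.

End weibull.

Section weibull_moments.
Context (R : realType) (alpha : R).
Hypothesis alpha_ge1 : 1 <= alpha.
Notation leb := (@lebesgue_measure R).
Let alpha_gt0 : 0 < alpha. Proof. exact: lt_le_trans alpha_ge1. Qed.
Let alpha1_gt0 : 0 < 1 + alpha. Proof. by rewrite addr_gt0. Qed.

(** The substitution is [t = x^(1+alpha)]. Since [ppow] is constant on the negative half-line, it is
    made on [[0, n]], and monotone convergence extends it to [[0, +oo[]. *)
Lemma weibull_moment_substitution p : (0 < p)%N ->
  (\int[leb]_x (x ^+ p * min_pdf alpha 1 x)%:E =
   \int[leb]_(t in `[0%R, +oo[) (ppow (p%:R / (1 + alpha)) t * expR (- t))%:E)%E.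
Proof.
move=> p0; set b := _ / _.
have b0 : 0 < b by rewrite divr_gt0// ltr0n.
pose G t : R := ppow b t * expR (- t).
pose F : R -> R := ppow (1 + alpha).
pose H x : R := x ^+ p * min_pdf alpha 1 x.
have cG : continuous G.
  move=> t; apply: cvgM; first exact: continuous_ppow.
  by apply: (cvg_comp _ expR); [apply: (@cvgN _ R^o); exact: cvg_id|exact: continuous_expR].
have cF : continuous F by exact: continuous_ppow.
have cH : continuous H.
  move=> t; apply: cvgM; first exact: exprn_continuous.
  exact: continuous_min_pdf.
have G0 t : 0 <= G t by rewrite mulr_ge0 ?ppow_ge0 ?expR_ge0.
have H0 x : 0 <= H x.
  have [x0|/ltW x0] := leP x 0; first by rewrite /H min_pdf_le0 ?mulr0.
  by rewrite mulr_ge0 ?exprn_ge0 ?min_pdf_ge0.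
have mG : measurable_fun setT G by exact: continuous_measurable_fun.
have mH : measurable_fun setT H by exact: continuous_measurable_fun.
pose F' x : R := (1 + alpha) * ppow alpha x.
have cF' : continuous F'.
  by move=> x; apply: cvgM; [exact: cvg_cst|exact: continuous_ppow].
have dF (x : R) : 0 < x -> is_derive (x : R^o) 1 (F : R^o -> R^o) (F' x).
  exact: is_derive_ppow.
have F'E (x : R) : 0 < x -> F^`()%classic x = F' x.
  by move=> /dF[_ <-]; rewrite derive1E.
have nF' (x : R) : 0 < x -> \near x, F' x = F^`()%classic x.
  by move=> x0; apply: filterS (lt_nbhsr x0) => z z0; rewrite F'E.
have GFH x : 0 < x -> G (F x) * F' x = H x.
  move=> x0; rewrite /G /F' /H /min_pdf !mul1r.
  have -> : ppow b (F x) = x ^+ p.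
    rewrite /F !ge0_ppow ?powR_ge0 ?ltW// -powRrM /b mulrCA divff ?gt_eqF// mulr1.
    by rewrite powR_mulrn// ltW.
  by rewrite /F; ring.
have finite_sub n : (\int[leb]_(t in `[(F 0)%R, (F n%:R)%R]) (G t)%:E =
    \int[leb]_(x in `[0%R, n%:R%R]) (H x)%:E)%E.
  have [->|n0] := eqVneq n 0%N; first by rewrite !set_itv1 !integral_set1.
  have n0' : 0 < n%:R :> R by rewrite ltr0n lt0n.
  rewrite (@integration_by_substitution_increasing R F G 0 n%:R)//; first last.
  - exact: continuous_subspaceT.
  - split; first by move=> x; rewrite in_itv/= => /andP[/dF[]].
      by apply/cvg_at_right_filter; exact: cF.
    by apply/cvg_at_left_filter; exact: cF.
  - apply/cvg_ex; exists (F' n%:R).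
    apply: (@cvg_trans _ (F' x @[x --> n%:R^'-])).
      apply: near_eq_cvg; apply: cvg_within; exact: nF'.
    by apply/cvg_at_left_filter; exact: cF'.
  - apply/cvg_ex; exists (F' 0).
    apply: (@cvg_trans _ (F' x @[x --> 0^'+])).
      by apply: near_eq_cvg; near=> x; rewrite F'E.
    by apply/cvg_at_right_filter; exact: cF'.
  - move=> x; rewrite in_itv/= => /andP[x0 _].
    exact: (near_eq_continuous_at (nF' _ x0) (cF' x)).
  - move=> x y; rewrite !in_itv/= => /andP[x0 _] /andP[y0 _] xy.
    by rewrite /F !ge0_ppow// gt0_ltr_powR// nnegrE.
  rewrite integral_itv_bndoo; last first.
    apply/measurable_EFinP.
    apply: (eq_measurable_fun H); last exact: measurable_funTS.
    move=> x; rewrite inE/= in_itv/= => /andP[x0 _].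
    by rewrite -[RHS]/(G (F x) * F^`()%classic x) F'E// GFH.
  rewrite [RHS]integral_itv_bndoo; last exact/measurable_EFinP/measurable_funTS.
  apply: eq_integral => x; rewrite inE/= in_itv/= => /andP[x0 _].
  by congr EFin; rewrite -[LHS]/(G (F x) * F^`()%classic x) F'E// GFH.
have F0E : F 0 = 0 by rewrite /F le0_ppow.
transitivity (\int[leb]_(x in `[0%R, +oo[) (H x)%:E)%E.
  rewrite [RHS]integral_mkcond; apply: eq_integral => x _.
  rewrite patchE; have [x0|x0] := leP 0 x; first by rewrite mem_set//= in_itv/= x0.
  rewrite memNset; last by rewrite /= in_itv/= andbT leNgt x0.
  by rewrite (min_pdf_le0 alpha_ge1 _ (ltW x0)) mulr0.
have cvgH := @ge0_cvgn_integral R leb H H0 mH.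
(* The intervals [[0, F n]] exhaust the half-line because [n <= n^(1+alpha) = F n] for [n >= 1]. *)
have cvgG : (\int[leb]_(t in `[0%R, (F n%:R)%R]) (G t)%:E @[n --> \oo] -->
    \int[leb]_(t in `[0%R, +oo[) (G t)%:E)%E.
  have -> : `[0, +oo[%classic = \bigcup_(n : nat) `[0, F n%:R]%classic :> set R.
    apply/seteqP; split => [t/=|t [n _] /=]; rewrite !in_itv/= ?andbT; last by case/andP.
    move=> t0; pose n := (Num.truncn t).+1.
    exists n => //=; rewrite in_itv/= t0/=.
    have tn : t <= n%:R by rewrite ltW// truncnS_gt.
    apply: (le_trans tn); rewrite /F ge0_ppow// -[leLHS]powRr1// ler_powR ?ler1n//.
    by rewrite lerDl ltW.
  apply: ge0_nondecreasing_set_cvg_integral => //.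
  - move=> m n mn; rewrite subsetEset; apply: subset_itvl; rewrite bnd_simp /F !ge0_ppow//.
    by rewrite ge0_ler_powR ?nnegrE ?ler_nat// ltW.
  - by move=> i; apply/measurable_EFinP/measurable_funTS.
  - by move=> i x _; rewrite lee_fin.
rewrite -[LHS](cvg_lim _ cvgH)// -[RHS](cvg_lim _ cvgG)//.
by under [in LHS]eq_fun do rewrite -finite_sub F0E.
Unshelve. all: by end_near. Qed.

(** [Gamma] is a real-valued integral, which would be a default value if it diverged, so finiteness
    must be proved. From [t^(x-1) <= 1 + t^2 <= 8 e^(t/2)] the integrand is at most 16 times the
    exponential density of rate 1/2. The arguments needed later are at most 5/2. *)
Lemma gammaE (x : R) : 1 < x -> x <= 3 ->
  ((Gamma x)%:E = \int[leb]_(t in `[0%R, +oo[) (ppow (x - 1) t * expR (- t))%:E)%E.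
Proof.
move=> x1 x3.
have x10 : 0 < x - 1 by rewrite subr_gt0.
have mG : measurable_fun setT (fun t : R => ppow (x - 1) t * expR (- t)).
  apply: measurable_funM; first by apply: continuous_measurable_fun; exact: continuous_ppow.
  by apply: measurableT_comp => //; exact: measurable_funN.
rewrite -integral_itv_obnd_cbnd; last first.
  by apply: measurable_funTS; apply/measurable_EFinP.
rewrite /Gamma /Rintegral fineK.
  apply: eq_integral => t; rewrite inE/= in_itv/= andbT => t0.
  by rewrite ge0_ppow// ltW.
rewrite ge0_fin_numE; last first.
  by apply: integral_ge0 => t _; rewrite lee_fin mulr_ge0 ?powR_ge0 ?expR_ge0.
apply: (@le_lt_trans _ _ (\int[leb]_t (16 * exponential_pdf 2^-1 t)%:E)%E); last first.
  under eq_integral do rewrite EFinM.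
  rewrite ge0_integralZl//=.
  - by rewrite integral_exponential_pdf// mule1 ltry.
  - by apply/measurable_EFinP; exact: measurable_exponential_pdf.
  - by move=> t _; rewrite lee_fin exponential_pdf_ge0.
have mE : measurable_fun setT (fun t : R => (16 * exponential_pdf 2^-1 t)%:E).
  by apply/measurable_EFinP; apply: measurable_funM => //; exact: measurable_exponential_pdf.
have E0 t : (0 <= (16 * exponential_pdf 2^-1 t)%:E :> \bar R)%E.
  by rewrite lee_fin mulr_ge0// exponential_pdf_ge0.
apply: (@le_trans _ _ (\int[leb]_(t in `]0%R, +oo[) (16 * exponential_pdf 2^-1 t)%:E)%E); last first.
  by apply: ge0_subset_integral => //.
apply: ge0_le_integral => //.
- by move=> t _; rewrite lee_fin mulr_ge0 ?powR_ge0 ?expR_ge0.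
- apply/measurable_EFinP.
  apply: (eq_measurable_fun (fun t : R => ppow (x - 1) t * expR (- t))); last exact: measurable_funTS.
  by move=> t; rewrite inE/= in_itv/= andbT => t0; rewrite ge0_ppow// ltW.
- exact: measurable_funTS.
move=> t.
rewrite /= in_itv/= andbT => t0; rewrite lee_fin exponential_pdfE ?(ltW t0)//.
have tp : t `^ (x - 1) <= 1 + t ^+ 2.
  have [t1|/ltW t1] := leP t 1.
    rewrite (@le_trans _ _ 1) ?lerDl ?sqr_ge0//.
    by have := @ge0_ler_powR _ _ (ltW x10) t 1; rewrite !nnegrE powR1 => ->//; exact: ltW.
  rewrite (@le_trans _ _ (t ^+ 2)) ?lerDr// -powR_mulrn ?(le_trans ler01)//.
  by rewrite ler_powR// lerBlDr natr1.
have e8 : 1 + t ^+ 2 <= 8 * expR (t / 2).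
  have := @expR_ge1Dxn _ (t / 2) 1; rewrite -[2`!]/2%N => /(_ (divr_ge0 (ltW t0) (ler0n _ _))).
  by rewrite expr_div_n; nra.
have -> : expR (- t) = expR (- (t / 2)) * expR (- (t / 2)).
  by rewrite -expRD; congr expR; field.
have -> : 16 * (2^-1 * expR (- 2^-1 * t)) = 8 * expR (t / 2) * (expR (- (t / 2)) * expR (- (t / 2))).
  rewrite mulrA [8 * _]mulrC -!mulrA [expR (t / 2) * _]mulrCA [expR (t/2) * _]mulrA expRxMexpNx_1.
  rewrite mul1r !mulrA; congr (_ * _); first by field.
  by congr expR; field.
by rewrite ler_wpM2r ?mulr_ge0 ?expR_ge0// (le_trans tp).
Qed.

Lemma weibull_moment p : (0 < p <= 3)%N ->
  (\int[leb]_x (x ^+ p * min_pdf alpha 1 x)%:E = (Gamma (1 + p%:R / (1 + alpha)))%:E)%E.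
Proof.
move=> /andP[p0 p3].
have b0 : 0 < p%:R / (1 + alpha) by rewrite divr_gt0// ltr0n.
have b2 : p%:R / (1 + alpha) <= 2.
  have p3R : p%:R <= 3 :> R by rewrite (ler_nat _ p 3).
  by rewrite ler_pdivrMr//; move: alpha_ge1; lra.
rewrite (weibull_moment_substitution p0) (@gammaE (1 + p%:R / (1 + alpha))).
- by rewrite addrAC subrr add0r.
- by rewrite ltrDl.
- by lra.
Qed.

End weibull_moments.

(** * Second order expansion under a centered density *)

Section taylor_step.
Context (R : realType).
Notation leb := (@lebesgue_measure R).
Implicit Types (q h u : R -> R).

(* [h] is a centered variable of variance [delta] and third absolute moment at most [rho] under the density [q]. *)
Definition centered_variable q h (delta rho : R) : Prop :=
  [/\ measurable_fun setT q, measurable_fun setT h, (forall y, 0 <= q y),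
      (forall p, (p <= 3)%N -> leb.-integrable setT (EFin \o (fun y => h y ^+ p * q y))) &
   [/\ \int[leb]_y q y = 1, \int[leb]_y (h y * q y) = 0,
       \int[leb]_y (h y ^+ 2 * q y) = delta & \int[leb]_y (`|h y| ^+ 3 * q y) <= rho]].

(** The slope [A] is hidden because it cancels against a centered variable. The coefficient [B] is
    exposed: multiplied by the variance, it is what two exchanged variables have in common. *)
Definition taylor3 (K : R) u (x B : R) : Prop :=
  exists A, forall t, `|u (x + t) - u x - A * t - B * t ^+ 2| <= K * `|t| ^+ 3.

Lemma integrable_unit_density q u : measurable_fun setT q -> (forall y, 0 <= q y) ->
  leb.-integrable setT (EFin \o q) ->
  measurable_fun setT u -> (forall y, 0 <= u y <= 1) ->
  leb.-integrable setT (EFin \o (fun y => u y * q y)).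
Proof.
move=> mq q0 iq mu u01; apply: (le_integrable _ _ _ iq) => //.
  by apply/measurable_EFinP; exact: measurable_funM.
move=> y _ /=; have /andP[u0 u1] := u01 y.
by rewrite lee_fin !ger0_norm ?mulr_ge0// ler_piMl.
Qed.

Lemma taylor_step q h delta rho K u x B : centered_variable q h delta rho ->
  0 <= K -> measurable_fun setT u -> (forall y, 0 <= u y <= 1) -> taylor3 K u x B ->
  `|\int[leb]_y (u (x + h y) * q y) - (u x + B * delta)| <= K * rho.
Proof.
move=> [mq mh q0 iq [q1 hq hdelta hrho]] K0 mu u01 [A HA].
have iq0 : leb.-integrable setT (EFin \o q).
  have := iq 0%N isT; congr (_.-integrable _ _).
  by apply/funext => y /=; rewrite expr0 mul1r.
have iq1 : leb.-integrable setT (EFin \o (fun y => h y * q y)).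
  have := iq 1%N isT; congr (_.-integrable _ _).
have iq2 := iq 2%N isT.
have iq3 : leb.-integrable setT (EFin \o (fun y => `|h y| ^+ 3 * q y)).
  have /integrable_norm := iq 3%N isT; congr (_.-integrable _ _).
  by apply/funext => y /=; rewrite normrM normrX [`|q y|]ger0_norm.
have iu : leb.-integrable setT (EFin \o (fun y => u (x + h y) * q y)).
  apply: integrable_unit_density => //.
  by apply: measurableT_comp => //; exact: measurable_funD.
have iZ (c : R) (g : R -> R) : leb.-integrable setT (EFin \o g) ->
    leb.-integrable setT (EFin \o (fun y => c * g y)).
  by move=> ig; have := integrableZl measurableT c ig.
have iB (f g : R -> R) : leb.-integrable setT (EFin \o f) -> leb.-integrable setT (EFin \o g) ->
    leb.-integrable setT (EFin \o (fun y => f y - g y)).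
  by move=> f_ g_; have := integrableB measurableT f_ g_.
pose rem y := u (x + h y) * q y - u x * q y - A * (h y * q y) - B * (h y ^+ 2 * q y).
have irem1 := iB _ _ iu (iZ (u x) _ iq0).
have irem2 := iB _ _ irem1 (iZ A _ iq1).
have irem := iB _ _ irem2 (iZ B _ iq2).
have -> : \int[leb]_y (u (x + h y) * q y) - (u x + B * delta) = \int[leb]_y rem y.
  rewrite /rem RintegralB//; last exact: iZ.
  rewrite RintegralB//; last exact: iZ.
  rewrite RintegralB//; last exact: iZ.
  rewrite !RintegralZl// q1 hq hdelta mulr1 mulr0 subr0; ring.
apply: (le_trans (le_normr_Rintegral measurableT irem)).
apply: (@le_trans _ _ (\int[leb]_y (K * (`|h y| ^+ 3 * q y)))); last first.
  by rewrite RintegralZl// ler_wpM2l.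
apply: le_Rintegral => //.
- exact: integrable_norm irem.
- exact: iZ.
move=> y _; rewrite /rem.
have -> : u (x + h y) * q y - u x * q y - A * (h y * q y) - B * (h y ^+ 2 * q y) =
  (u (x + h y) - u x - A * h y - B * h y ^+ 2) * q y by ring.
by rewrite normrM [`|q y|]ger0_norm// [leRHS]mulrA ler_wpM2r.
Qed.

End taylor_step.

Section min_moments.
Context (R : realType) (alpha : R).
Hypothesis alpha_ge1 : 1 <= alpha.
Notation leb := (@lebesgue_measure R).
Notation q := (min_pdf alpha).
Let alpha_gt0 : 0 < alpha. Proof. exact: lt_le_trans alpha_ge1. Qed.
Let alpha1_gt0 : 0 < 1 + alpha. Proof. by rewrite addr_gt0. Qed.

Notation root k := (k%:R `^ (1 / (1 + alpha)) : R).
Notation mu p := (Gamma (1 + p%:R / (1 + alpha)) : R).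

Lemma min_pdf_momentE k p : (0 < k)%N -> (0 < p <= 3)%N ->
  (\int[leb]_x (x ^+ p * q k x)%:E = (mu p / root k ^+ p)%:E)%E.
Proof.
move=> k0 p13; have c0 : 0 < root k by rewrite powR_gt0// ltr0n.
have := min_pdf_moment_scaling alpha_ge1 p k0; rewrite weibull_moment//.
have : (0 <= \int[leb]_x (x ^+ p * q k x)%:E)%E.
  apply: integral_ge0 => x _; rewrite lee_fin.
  have [x0|/ltW x0] := leP x 0; first by rewrite min_pdf_le0 ?mulr0.
  by rewrite mulr_ge0 ?exprn_ge0 ?min_pdf_ge0.
(* An infinite moment would remain infinite after multiplication by the positive scale, against the
   finite left-hand side. *)
case: (\int[leb]_x _)%E => [r r0|_|//].
  rewrite -EFinM => -[->]; congr EFin.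
  have cn : root k ^+ p != 0 by apply: expf_neq0; rewrite gt_eqF.
  by rewrite mulrAC divff// mul1r.
by rewrite gt0_muley// lte_fin exprn_gt0.
Qed.

Lemma integrable_min_pdf_moment k p : (0 < k)%N -> (p <= 3)%N ->
  leb.-integrable setT (EFin \o (fun x => x ^+ p * q k x)).
Proof.
move=> k0 p3; apply/integrableP; split.
  apply/measurable_EFinP; apply: measurable_funM; first exact: measurable_funX.
  exact: measurable_min_pdf.
rewrite (_ : (\int[leb]_x _)%E = (\int[leb]_x (x ^+ p * q k x)%:E)%E); last first.
  apply: eq_integral => x _ /=; rewrite ger0_norm//.
  have [x0|/ltW x0] := leP x 0; first by rewrite min_pdf_le0 ?mulr0.
  by rewrite mulr_ge0 ?exprn_ge0 ?min_pdf_ge0.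
case: p p3 => [_|p p3]; last by rewrite min_pdf_momentE// ltry.
by under eq_integral do rewrite expr0 mul1r; rewrite integral_min_pdf// ltry.
Qed.

Lemma Rintegral_min_pdf k : (0 < k)%N -> \int[leb]_x q k x = 1.
Proof. by move=> k0; rewrite /Rintegral integral_min_pdf. Qed.

Lemma Rintegral_min_pdf_moment k p : (0 < k)%N -> (0 < p <= 3)%N ->
  \int[leb]_x (x ^+ p * q k x) = mu p / root k ^+ p.
Proof. by move=> k0 p13; rewrite /Rintegral min_pdf_momentE. Qed.

Lemma sigma2E : sigma2 alpha = mu 2 - mu 1 ^+ 2.
Proof. by rewrite /sigma2 [2 / _ + 1]addrC. Qed.

Lemma mu_ge0 p : 0 <= mu p.
Proof.
by apply: Rintegral_ge0 => t _; rewrite mulr_ge0 ?powR_ge0 ?expR_ge0.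
Qed.

(** The density lives on [y >= 0] and the mean [m] is nonnegative, so that [|y - m| <= max(y, m)]
    and the third absolute moment is at most that of [y] plus [m ^+ 3]. *)
Lemma min_pdf_centered k (c : R) : (0 < k)%N -> 0 < c ->
  centered_variable (q k) (fun y => (y - mu 1 / root k) / c)
    (sigma2 alpha / (c * root k) ^+ 2) ((mu 3 + mu 1 ^+ 3) / (c * root k) ^+ 3).
Proof.
move=> k0 c0; have r0 : 0 < root k by rewrite powR_gt0// ltr0n.
set m := mu 1 / root k.
have m0 : 0 <= m by rewrite divr_ge0 ?mu_ge0// ltW.
have ip p : (p <= 3)%N -> leb.-integrable setT (EFin \o (fun x => x ^+ p * q k x)).
  exact: integrable_min_pdf_moment.
have iZ (a : R) (g : R -> R) : leb.-integrable setT (EFin \o g) ->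
    leb.-integrable setT (EFin \o (fun y => a * g y)).
  by move=> ig; have := integrableZl measurableT a ig.
have iD (f g : R -> R) : leb.-integrable setT (EFin \o f) -> leb.-integrable setT (EFin \o g) ->
    leb.-integrable setT (EFin \o (fun y => f y + g y)).
  by move=> f_ g_; have := integrableD measurableT f_ g_.
have i0 : leb.-integrable setT (EFin \o q k).
  have := ip 0%N isT; congr (_.-integrable _ _).
  by apply/funext => y /=; rewrite expr0 mul1r.
have mq : measurable_fun setT (q k) by exact: measurable_min_pdf.
have mh : measurable_fun setT (fun y : R => (y - m) / c).
  by apply: measurable_funM => //; exact: measurable_funB.
have i3 : leb.-integrable setT (EFin \o (fun y => c^-1 ^+ 3 * (y ^+ 3 * q k y + m ^+ 3 * q k y))).
  by apply: (iZ); apply: (iD); [exact: ip|exact: iZ].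
have b3 y : `|(y - m) / c| ^+ 3 * q k y <= c^-1 ^+ 3 * (y ^+ 3 * q k y + m ^+ 3 * q k y).
  have [y0|/ltW y0] := leP y 0.
    by rewrite (min_pdf_le0 alpha_ge1 k y0) !mulr0 addr0 mulr0.
  rewrite -mulrDl [leRHS]mulrA.
  rewrite ler_wpM2r ?min_pdf_ge0//.
  rewrite normrM [`|c^-1|]gtr0_norm ?invr_gt0// exprMn mulrC ler_wpM2l//.
    by rewrite exprn_ge0// invr_ge0 ltW.
  have [ym|/ltW ym] := leP y m.
    rewrite ler0_norm ?subr_le0// opprB; apply: (@le_trans _ _ (m ^+ 3)).
      by rewrite lerXn2r ?nnegrE ?subr_ge0// lerBlDr lerDl.
    by rewrite lerDr exprn_ge0.
  rewrite ger0_norm ?subr_ge0//; apply: (@le_trans _ _ (y ^+ 3)).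
    by rewrite lerXn2r ?nnegrE ?subr_ge0// lerBlDr lerDl.
  by rewrite lerDl exprn_ge0.
have i3' : leb.-integrable setT (EFin \o (fun y => `|(y - m) / c| ^+ 3 * q k y)).
  apply: (le_integrable _ _ _ i3) => //.
    apply/measurable_EFinP; apply: measurable_funM => //; apply: measurable_funX.
    exact: measurableT_comp.
  move=> y _ /=; rewrite lee_fin ger0_norm; last by rewrite mulr_ge0 ?exprn_ge0 ?min_pdf_ge0.
  by rewrite (le_trans (b3 y))// ler_norm.
have E1 : (fun y => (y - m) / c * q k y) = (fun y => c^-1 * (y ^+ 1 * q k y + (- m) * q k y)).
  by apply/funext => y; rewrite expr1; ring.
have E2 : (fun y => ((y - m) / c) ^+ 2 * q k y) =
    (fun y => c^-1 ^+ 2 * (y ^+ 2 * q k y + ((- 2 * m) * (y ^+ 1 * q k y) + m ^+ 2 * q k y))).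
  by apply/funext => y; rewrite expr1; ring.
have i1 : leb.-integrable setT (EFin \o (fun y => y ^+ 1 * q k y + (- m) * q k y)).
  by apply: (iD); [exact: ip|exact: iZ].
have i2' : leb.-integrable setT (EFin \o (fun y => (- 2 * m) * (y ^+ 1 * q k y) + m ^+ 2 * q k y)).
  by apply: (iD); apply: (iZ) => //; exact: ip.
have i2 : leb.-integrable setT (EFin \o (fun y => y ^+ 2 * q k y + ((- 2 * m) * (y ^+ 1 * q k y) + m ^+ 2 * q k y))).
  by apply: (iD) => //; exact: ip.
split => //.
- by move=> y; exact: min_pdf_ge0.
- case=> [_|[_|[_|[_|//]]]].
  + by move: i0; congr (_.-integrable _ _); apply/funext => y /=; rewrite expr0 mul1r.
  + by rewrite [X in EFin \o X](_ : _ = fun y => (y - m) / c * q k y) ?E1//; exact: iZ.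
  + by rewrite E2; exact: iZ.
  + apply: (le_integrable _ _ _ i3') => //.
      by apply/measurable_EFinP; apply: measurable_funM => //; exact: measurable_funX.
    by move=> y _ /=; rewrite lee_fin normrM normrX [leRHS]normrM normrX normr_id.
split.
- exact: Rintegral_min_pdf.
- rewrite E1 RintegralZl// RintegralD//; [|exact: ip|exact: iZ].
  rewrite RintegralZl// Rintegral_min_pdf// Rintegral_min_pdf_moment// expr1 -/m; ring.
- rewrite E2 RintegralZl// RintegralD//; [|exact: ip].
  rewrite RintegralD//; [|apply: (iZ); exact: ip|exact: iZ].
  rewrite !RintegralZl//; [|exact: ip].
  rewrite Rintegral_min_pdf// !Rintegral_min_pdf_moment// expr1 sigma2E /m.
  by move: (mu 1) (mu 2) => g1 g2; field; rewrite !gt_eqF.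
- apply: (@le_trans _ _ (\int[leb]_y (c^-1 ^+ 3 * (y ^+ 3 * q k y + m ^+ 3 * q k y)))).
    by apply: le_Rintegral.
  rewrite RintegralZl//; last by apply: (iD); [exact: ip|exact: iZ].
  rewrite RintegralD//; [|exact: ip|exact: iZ].
  rewrite RintegralZl// Rintegral_min_pdf// Rintegral_min_pdf_moment// /m le_eqVlt; apply/orP; left.
  by move: (mu 1) (mu 3) => g1 g3; apply/eqP; field; rewrite !gt_eqF.
Qed.

(** On [x > m + 1] the square [(x - m)^2] is at least 1, so the variance is at least the tail at
    [m + 1], an exponential. *)
Lemma sigma2_gt0 : 0 < sigma2 alpha.
Proof.
have [mq mh q0 iq [q1 hq hdelta _]] := min_pdf_centered (isT : (0 < 1)%N) (ltr01 : 0 < 1 :> R).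
have dE : sigma2 alpha / (1 * root 1) ^+ 2 = sigma2 alpha.
  by rewrite powR1 mulr1 expr1n divr1.
move: hdelta iq; rewrite dE => <-.
set m := (Gamma _ / _ `^ _) => iq.
apply: (@lt_le_trans _ _ (survival alpha (m + 1))); first exact: expR_gt0.
rewrite -[survival _ _]expr1.
have := min_pdf_tail alpha_ge1 (m + 1) (isT : (0 < 1)%N) => tail.
rewrite -lee_fin -tail /Rintegral fineK; last exact: (integrable_fin_num measurableT (iq 2%N isT)).
have mV : measurable_fun setT (fun x : R => (((x - m) / 1) ^+ 2 * q 1 x)%:E).
  by apply/measurable_EFinP; apply: measurable_funM => //; exact: measurable_funX.
have V0 (x : R) : (0 <= (((x - m) / 1) ^+ 2 * q 1 x)%:E :> \bar R)%E.
  by rewrite lee_fin mulr_ge0// sqr_ge0.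
apply: (@le_trans _ _ (\int[leb]_(x in `](m + 1)%R, +oo[) (((x - m) / 1) ^+ 2 * q 1 x)%:E)%E); last first.
  exact: ge0_subset_integral.
apply: ge0_le_integral => //.
- by move=> x _; rewrite lee_fin.
- by apply: measurable_funTS; apply/measurable_EFinP.
- exact: measurable_funTS.
move=> x; rewrite /= in_itv/= andbT => xm; rewrite lee_fin ler_peMl// divr1.
by rewrite exprn_ege1//; lra.
Qed.

End min_moments.

(** * Gaussian smoothing *)

Section gaussian_moments.
Context (R : realType).
Notation leb := (@lebesgue_measure R).
Implicit Types z : R.

Definition bell z : R := expR (- (z ^+ 2 / 2)).

Lemma is_derive_bell z : is_derive (z : R^o) 1 (bell : R^o -> R^o) (- z * bell z).
Proof.
have h : is_derive (z : R^o) 1 (fun z : R^o => - (z ^+ 2 / 2) : R^o) (- z).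
  by apply: is_derive_eq; rewrite /GRing.scale/=; field.
by rewrite /bell; apply: is_derive_eq; rewrite /GRing.scale/= mulrC.
Qed.

Lemma continuous_bell : continuous bell.
Proof.
move=> z; apply: differentiable_continuous; apply/derivable1_diffP.
by have [] := is_derive_bell z.
Qed.

Lemma bell_ge0 z : 0 <= bell z. Proof. exact: expR_ge0. Qed.

Lemma normal_pdf01E z : normal_pdf 0 1 z = normal_peak 1 * bell z.
Proof.
rewrite normal_pdfE ?oner_eq0// /normal_fun subr0 expr1n /bell; congr (_ * expR _).
by field.
Qed.

(** It gives the limits at infinity of the primitives used below. The constant comes from
    [24 e^(z^2/2) >= 24 + 3 z^4], which exceeds [z^3 + 2 z] for [z >= 1]. *)
Lemma bell_decay z : 1 <= z -> (z ^+ 2 + 2) * bell z <= 24 / z.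
Proof.
move=> z1; have z0 : 0 < z by exact: lt_le_trans z1.
have := @expR_ge1Dxn _ (z ^+ 2 / 2) 1; rewrite -[2`!]/2%N => /(_ (divr_ge0 (sqr_ge0 _) (ler0n _ _))) H.
rewrite /bell expRN ler_pdivrMr ?expR_gt0// mulrAC ler_pdivlMr//.
have : 24 * (1 + (z ^+ 2 / 2) ^+ 2 / 2) <= 24 * expR (z ^+ 2 / 2) by rewrite ler_wpM2l.
apply: le_trans.
have -> : 24 * (1 + (z ^+ 2 / 2) ^+ 2 / 2) = 24 + 3 * (z ^+ 4) by field.
rewrite mulrDl -exprSr; nra.
Qed.

Lemma cvg0_le_inv (F : R -> R) : (forall z, 1 <= z -> `|F z| <= 24 / z) ->
  F z @[z --> +oo] --> 0.
Proof.
move=> HF; apply/cvgrPdist_le => e e0.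
apply: filterS (nbhs_pinfty_ge (num_real (Num.max 1 (24 / e)))) => z.
rewrite ge_max => /andP[z1 ze]; rewrite sub0r normrN (le_trans (HF _ z1))//.
rewrite ler_pdivrMr ?(lt_le_trans _ z1)// mulrC -ler_pdivrMr//.
Qed.

Lemma half_bell_third_moment : (\int[leb]_(z in `[0%R, +oo[) (z ^+ 3 * bell z)%:E = 2%R%:E)%E.
Proof.
pose F z := - ((z ^+ 2 + 2) * bell z).
have dF z : is_derive (z : R^o) 1 (F : R^o -> R^o) (z ^+ 3 * bell z).
  have h := is_derive_bell z.
  by apply: is_derive_eq; rewrite /GRing.scale/=; ring.
have cf : continuous (fun z => z ^+ 3 * bell z).
  by move=> z; apply: cvgM; [exact: exprn_continuous|exact: continuous_bell].
rewrite (@ge0_continuous_FTC2y _ _ F _ 0)//.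
- by rewrite add0e -EFinN; congr EFin; rewrite /F /bell expr0n/= mul0r oppr0 expR0; ring.
- by move=> z z0; rewrite mulr_ge0 ?exprn_ge0 ?bell_ge0.
- exact: continuous_subspaceT.
- apply: cvg0_le_inv => z z1; rewrite /F normrN ger0_norm ?bell_decay//.
  by rewrite mulr_ge0 ?bell_ge0// addr_ge0// sqr_ge0.
- apply/cvg_at_right_filter; apply: differentiable_continuous; apply/derivable1_diffP.
  by have [] := dF 0.
- by move=> z _; have [_ <-] := dF z; rewrite derive1E.
Qed.

(* [(z^2 - 1) bell z] is the derivative of [- z bell z] but changes sign;
   adding [2 exp (- z)], of known integral, makes it nonnegative on [0, +oo[. *)
Lemma half_bell_second_moment :
  (\int[leb]_(z in `[0%R, +oo[) (z ^+ 2 * bell z)%:E = \int[leb]_(z in `[0%R, +oo[) (bell z)%:E)%E.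
Proof.
pose e z : R := 2 * expR (- z).
pose E z : R := - (2 * expR (- z)).
have dE z : is_derive (z : R^o) 1 (E : R^o -> R^o) (e z).
  by rewrite /E; apply: is_derive_eq; rewrite /GRing.scale/= /e; ring.
have cE : continuous E.
  by move=> z; apply: differentiable_continuous; apply/derivable1_diffP; have [] := dE z.
have ce : continuous e.
  by move=> z; have := continuousN (cE z); congr (continuous_at _ _); apply/funext => y; rewrite /E opprK.
have e0 z : 0 <= e z by rewrite mulr_ge0 ?expR_ge0.
have E_cvg : E z @[z --> +oo] --> 0.
  rewrite -oppr0 -[X in - X](mulr0 2); apply: (@cvgN _ R^o).
  by apply: cvgM; [exact: cvg_cst|exact: cvgr_expR].
have cb2 : continuous (fun z => z ^+ 2 * bell z).
  by move=> z; apply: cvgM; [exact: exprn_continuous|exact: continuous_bell].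
have mb : measurable_fun setT bell by apply: continuous_measurable_fun; exact: continuous_bell.
have mb2 : measurable_fun setT (fun z => z ^+ 2 * bell z) by exact: continuous_measurable_fun.
have me : measurable_fun setT e by exact: continuous_measurable_fun.
have Ie : (\int[leb]_(z in `[0%R, +oo[) (e z)%:E = 2%R%:E)%E.
  rewrite (@ge0_continuous_FTC2y _ _ E _ 0)//.
  - by rewrite add0e -EFinN; congr EFin; rewrite /E oppr0 expR0; ring.
  - exact: continuous_subspaceT.
  - exact/cvg_at_right_filter/cE.
  - by move=> z _; have [_ <-] := dE z; rewrite derive1E.
pose f z := z ^+ 2 * bell z + (e z - bell z).
have f0 z : 0 <= z -> 0 <= f z.
  move=> z0; rewrite /f.
  (* Beyond 1 the term [z^2 bell z] already dominates [bell z]; below 1 the exponential does, as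
     [e z >= 2 (1 - z) >= 1 - z^2]. *)
  have [z1|/ltW z1] := leP z 1; last first.
    have : bell z <= z ^+ 2 * bell z by rewrite ler_peMl ?bell_ge0// exprn_ege1.
    by have := e0 z; lra.
  have b1 : bell z <= 1 by rewrite expR_le1 oppr_le0 divr_ge0 ?sqr_ge0.
  have b0 := bell_ge0 z.
  have ez : 2 * (1 - z) <= e z by rewrite ler_wpM2l// expR_ge1Dx.
  have hb : (1 - z ^+ 2) * bell z <= 1 - z ^+ 2.
    by rewrite ler_piMr// subr_ge0 expr_le1.
  have h2 : 1 - z ^+ 2 <= 2 * (1 - z) by have := sqr_ge0 (1 - z); nra.
  by move: hb h2 ez; rewrite mulrBl mul1r; lra.
have If : (\int[leb]_(z in `[0%R, +oo[) (f z)%:E = 2%R%:E)%E.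
  pose F z := - (z * bell z) + E z.
  have dF z : is_derive (z : R^o) 1 (F : R^o -> R^o) (f z).
    have h := is_derive_bell z; have h' := dE z.
    by rewrite /F; apply: is_derive_eq; rewrite /GRing.scale/= /f /e; ring.
  rewrite (@ge0_continuous_FTC2y _ _ F _ 0)//.
  - by rewrite add0e -EFinN; congr EFin; rewrite /F /E mul0r oppr0 expR0; ring.
  - apply: continuous_subspaceT => z; apply: (@cvgD _ R^o); first exact: cb2.
    by apply: (@cvgB _ R^o); [exact: ce|exact: continuous_bell].
  - rewrite -[X in _ --> X]addr0; apply: (@cvgD _ R^o) => //.
    apply: cvg0_le_inv => z z1; rewrite normrN ger0_norm ?mulr_ge0 ?bell_ge0 ?(le_trans ler01)//.
    by rewrite (le_trans _ (bell_decay z1))// ler_wpM2r ?bell_ge0//; nra.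
    - apply/cvg_at_right_filter; apply: differentiable_continuous; apply/derivable1_diffP.
    by have [] := dF 0.
  - by move=> z _; have [_ <-] := dF z; rewrite derive1E.
have mEb : measurable_fun (`[0%R, +oo[%classic : set R) (EFin \o bell) by apply: measurable_funTS; exact/measurable_EFinP.
have mEe : measurable_fun (`[0%R, +oo[%classic : set R) (EFin \o e) by apply: measurable_funTS; exact/measurable_EFinP.
have mEb2 : measurable_fun (`[0%R, +oo[%classic : set R) (EFin \o (fun z => z ^+ 2 * bell z)).
  by apply: measurable_funTS; exact/measurable_EFinP.
have mEf : measurable_fun (`[0%R, +oo[%classic : set R) (EFin \o f).
  apply: measurable_funTS; apply/measurable_EFinP; apply: measurable_funD => //.
  exact: measurable_funB.
have : (\int[leb]_(z in `[0%R, +oo[) (z ^+ 2 * bell z)%:E + \int[leb]_(z in `[0%R, +oo[) (e z)%:E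
  = \int[leb]_(z in `[0%R, +oo[) (f z)%:E + \int[leb]_(z in `[0%R, +oo[) (bell z)%:E)%E.
  rewrite -ge0_integralD//; last 2 first.
  - by move=> z _; rewrite lee_fin mulr_ge0 ?sqr_ge0 ?bell_ge0.
  - by move=> z _; rewrite lee_fin.
  rewrite -ge0_integralD//; last 2 first.
  - by move=> z; rewrite /= in_itv/= andbT => z0; rewrite lee_fin f0.
  - by move=> z _; rewrite lee_fin bell_ge0.
  by apply: eq_integral => z _; rewrite -!EFinD; congr EFin; rewrite /f; ring.
by rewrite If Ie [RHS]addeC => /(congr1 (fun x => x - 2%R%:E)%E); rewrite !addeK.
Qed.

End gaussian_moments.

Section standard_normal.
Context (R : realType).
Notation leb := (@lebesgue_measure R).
Notation phi := (normal_pdf (0 : R) 1).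
Implicit Types z : R.

Let cphi : continuous phi. Proof. exact: continuous_normal_pdf. Qed.
Let mphi : measurable_fun setT phi. Proof. exact: measurable_normal_pdf. Qed.
Let phi0 z : 0 <= phi z. Proof. exact: normal_pdf_ge0. Qed.
Let mbell : measurable_fun setT (@bell R).
Proof. by apply: continuous_measurable_fun; exact: continuous_bell. Qed.

Lemma even_bell_moment p : (\int[leb]_z (`|z| ^+ p * phi z)%:E =
  2%R%:E * ((normal_peak 1)%:E * \int[leb]_(z in `[0%R, +oo[) (z ^+ p * bell z)%:E))%E.
Proof.
rewrite ge0_symfun_integralT; first last.
- by move=> z; rewrite /= normrN !normal_pdf01E /bell sqrrN.
- move=> z; apply: cvgM; last exact: cphi.
  apply: (cvg_comp (fun x : R => `|x|) (fun x : R => x ^+ p)); last exact: exprn_continuous.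
  by apply: cvg_norm; exact: cvg_id.
- by move=> z; rewrite mulr_ge0 ?exprn_ge0.
congr (_ * _)%E.
rewrite -ge0_integralZl//; last 3 first.
- by apply: measurable_funTS; apply/measurable_EFinP; apply: measurable_funM.
- by move=> z; rewrite /= in_itv/= andbT => z0; rewrite lee_fin mulr_ge0 ?exprn_ge0 ?bell_ge0.
- by rewrite lee_fin normal_peak_ge0.
rewrite set_itvcy; apply: eq_integral => z; rewrite inE/= => z0.
by rewrite -EFinM ger0_norm// normal_pdf01E; congr EFin; ring.
Qed.

(** The case [p = 0] of [even_bell_moment]: the total mass of [phi] normalizes the integral of
    [bell], and [half_bell_second_moment] then transfers the value 1 to the second moment. *)
Let half_mass : (2%R%:E * ((normal_peak 1)%:E * \int[leb]_(z in `[0%R, +oo[) (bell z)%:E) = 1)%E.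
Proof.
have := even_bell_moment 0; under eq_integral do rewrite expr0 mul1r.
rewrite integral_normal_pdf => ->; congr (_ * (_ * _))%E.
by apply: eq_integral => z _; rewrite expr0 mul1r.
Qed.

Lemma normal_second_moment : (\int[leb]_z (z ^+ 2 * phi z)%:E = 1)%E.
Proof.
rewrite -half_mass -half_bell_second_moment -even_bell_moment.
by apply: eq_integral => z _; rewrite real_normK// num_real.
Qed.

Definition normal_abs3 : R := 4 * normal_peak 1.

Lemma normal_third_moment : (\int[leb]_z (`|z| ^+ 3 * phi z)%:E = normal_abs3%:E)%E.
Proof.
rewrite even_bell_moment half_bell_third_moment -!EFinM /normal_abs3; congr EFin; ring.
Qed.

Lemma integrable_normal_abs_moment p : (p <= 3)%N ->
  leb.-integrable setT (EFin \o (fun z => `|z| ^+ p * phi z)).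
Proof.
move=> p3.
have mabs k : measurable_fun setT (fun z => `|z| ^+ k * phi z).
  by apply: measurable_funM => //; apply: measurable_funX; exact: normr_measurable.
have i3 : leb.-integrable setT (EFin \o (fun z => `|z| ^+ 3 * phi z)).
  apply/integrableP; split; first by apply/measurable_EFinP; exact: mabs.
  under eq_integral do rewrite /= ger0_norm ?mulr_ge0 ?exprn_ge0//.
  by rewrite normal_third_moment ltry.
have i0 : leb.-integrable setT (EFin \o phi) by exact: integrable_normal_pdf.
apply: (le_integrable _ _ _ (integrableD measurableT i0 i3)) => //.
  by apply/measurable_EFinP; exact: mabs.
move=> z _ /=; rewrite lee_fin [leLHS]ger0_norm ?mulr_ge0 ?exprn_ge0//.
rewrite [leRHS]ger0_norm ?addr_ge0 ?mulr_ge0 ?exprn_ge0//.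
rewrite -{2}[phi z]mul1r -mulrDl ler_wpM2r//.
have [z1|/ltW z1] := leP 1 `|z|; first by rewrite (le_trans (ler_weXn2l z1 p3))// lerDr.
by rewrite (@le_trans _ _ 1) ?exprn_ile1// lerDl exprn_ge0.
Qed.

(** The symmetry argument is available for even functions only. Writing [z = 2 max(0, z) - |z|]
    reduces the odd integrand to [|z|], whose integral is twice that of its positive half. *)
Lemma normal_mean0 : \int[leb]_z (z * phi z) = 0.
Proof.
have iabs := integrable_normal_abs_moment (isT : (1 <= 3)%N).
have mpos : measurable_fun setT (fun z : R => Num.max 0 z) by exact: measurable_maxr.
have ipos : leb.-integrable setT (EFin \o (fun z => Num.max 0 z * phi z)).
  apply: (le_integrable _ _ _ iabs) => //.
    by apply/measurable_EFinP; exact: measurable_funM.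
  move=> z _ /=; rewrite lee_fin [leLHS]ger0_norm ?mulr_ge0 ?le_max ?lexx//.
  by rewrite [leRHS]ger0_norm ?mulr_ge0// ler_wpM2r// ge_max normr_ge0 ler_norm.
have pos_half : (\int[leb]_z (`|z| ^+ 1 * phi z)%:E = 2%R%:E * \int[leb]_z (Num.max 0 z * phi z)%:E)%E.
  rewrite even_bell_moment; congr (_ * _)%E.
  rewrite -ge0_integralZl//; last 3 first.
  - by apply: measurable_funTS; apply/measurable_EFinP; apply: measurable_funM.
  - by move=> z; rewrite /= in_itv/= andbT => z0; rewrite lee_fin mulr_ge0 ?exprn_ge0 ?bell_ge0.
  - by rewrite lee_fin normal_peak_ge0.
  rewrite integral_mkcond; apply: eq_integral => z _; rewrite patchE.
  case: ifPn; rewrite ?notin_setE ?inE/= in_itv/= andbT => z0.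
    by rewrite -EFinM max_r// normal_pdf01E expr1; congr EFin; ring.
  by rewrite max_l ?mul0r// ltW// ltNge; exact/negP.
have -> : \int[leb]_z (z * phi z) = \int[leb]_z (2 * (Num.max 0 z * phi z) - `|z| ^+ 1 * phi z).
  apply: eq_Rintegral => z _; rewrite expr1 mulrA -mulrBl; congr (_ * _).
  have [z0|z0] := leP 0 z; first by rewrite ger0_norm//; ring.
  by rewrite ltr0_norm//; ring.
rewrite RintegralB//; last by have := integrableZl measurableT 2 ipos.
rewrite RintegralZl// /Rintegral pos_half fineM ?subrr//.
exact: (integrable_fin_num measurableT ipos).
Qed.

Lemma normal_centered (delta : R) : 0 <= delta ->
  centered_variable phi (fun z => Num.sqrt delta * z) delta (normal_abs3 * Num.sqrt delta ^+ 3).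
Proof.
move=> d0; set s := Num.sqrt delta.
have s0 : 0 <= s by exact: sqrtr_ge0.
have iabs p : (p <= 3)%N -> leb.-integrable setT (EFin \o (fun z => `|s| ^+ p * (`|z| ^+ p * phi z))).
  by move=> p3; have := integrableZl measurableT (`|s| ^+ p) (integrable_normal_abs_moment p3).
have ip p : (p <= 3)%N -> leb.-integrable setT (EFin \o (fun z => (s * z) ^+ p * phi z)).
  move=> p3; apply: (le_integrable _ _ _ (iabs p p3)) => //.
    apply/measurable_EFinP; apply: measurable_funM => //; apply: measurable_funX.
    exact: measurable_funM.
  by move=> z _ /=; rewrite lee_fin exprMn !normrM !normrX !normr_id mulrA.
have iz p : (p <= 3)%N -> leb.-integrable setT (EFin \o (fun z => z ^+ p * phi z)).
  move=> p3; apply: (le_integrable _ _ _ (integrable_normal_abs_moment p3)) => //.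
    by apply/measurable_EFinP; apply: measurable_funM => //; exact: measurable_funX.
  by move=> z _ /=; rewrite lee_fin !normrM !normrX !normr_id.
split => //; first exact: measurable_funM.
split.
- by rewrite /Rintegral integral_normal_pdf.
- under eq_Rintegral do rewrite -mulrA.
  by rewrite RintegralZl ?normal_mean0 ?mulr0//; have := iz 1%N isT.
- under eq_Rintegral do rewrite exprMn -mulrA.
  by rewrite RintegralZl ?sqr_sqrtr//; [rewrite /Rintegral normal_second_moment mulr1|exact: iz].
- under eq_Rintegral do rewrite normrM exprMn -mulrA.
  rewrite RintegralZl//; last exact: integrable_normal_abs_moment.
  by rewrite /Rintegral normal_third_moment/= mulrC ger0_norm.
Qed.

End standard_normal.

Section gaussian_smoothing.
Context (R : realType).
Notation leb := (@lebesgue_measure R).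
Notation phi := (normal_pdf (0 : R) 1).
Implicit Types (f u : R -> R) (x t : R).

Lemma integrable_bounded_density (q : R -> R) (M : R) u : (forall y, 0 <= q y) ->
  leb.-integrable setT (EFin \o q) -> measurable_fun setT u -> (forall y, `|u y| <= M) ->
  leb.-integrable setT (EFin \o (fun y => u y * q y)).
Proof.
move=> q0 iq mu uM.
have M0 : 0 <= M by rewrite (le_trans _ (uM 0)).
have mq : measurable_fun setT q by apply/measurable_EFinP; exact: (measurable_int leb).
apply: (le_integrable _ _ _ (integrableZl measurableT M iq)) => //.
  by apply/measurable_EFinP; exact: measurable_funM.
move=> y _ /=; rewrite lee_fin normrM [leRHS]ger0_norm ?mulr_ge0//.
by rewrite [`|q y|]ger0_norm// ler_wpM2r.
Qed.

Let iphi : leb.-integrable setT (EFin \o phi). Proof. exact: integrable_normal_pdf. Qed.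
Let mphi : measurable_fun setT phi. Proof. exact: measurable_normal_pdf. Qed.
Let phi0 z : 0 <= phi z. Proof. exact: normal_pdf_ge0. Qed.
Let phi1 : \int[leb]_z phi z = 1. Proof. by rewrite /Rintegral integral_normal_pdf. Qed.

(* The heat semigroup: the expectation of [f (x + sqrt t * Z)] for a standard normal [Z]. *)
Definition gsmooth t f x : R := \int[leb]_z (f (x + Num.sqrt t * z) * phi z).

Definition unit_valued f := forall y, 0 <= f y <= 1.

Let measurable_shift f x (s : R) : measurable_fun setT f ->
  measurable_fun setT (fun z => f (x + s * z)).
Proof.
by move=> mf; apply: measurableT_comp => //; apply: measurable_funD => //; exact: measurable_funM.
Qed.

Lemma integrable_gsmooth t f x M : measurable_fun setT f -> (forall y, `|f y| <= M) ->
  leb.-integrable setT (EFin \o (fun z => f (x + Num.sqrt t * z) * phi z)).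
Proof.
by move=> mf fM; apply: (@integrable_bounded_density _ M) => //; exact: measurable_shift.
Qed.

Let unit_valued_norm f y : unit_valued f -> `|f y| <= 1.
Proof. by move=> /(_ y) /andP[f0 f1]; rewrite ger0_norm. Qed.

Lemma EFin_gsmooth t f x : measurable_fun setT f -> unit_valued f ->
  ((gsmooth t f x)%:E = \int[leb]_z (f (x + Num.sqrt t * z)%R * phi z)%:E)%E.
Proof.
move=> mf f01; rewrite /gsmooth /Rintegral fineK//.
have := @integrable_gsmooth t f x 1 mf (fun y => unit_valued_norm y f01).
by move=> /(integrable_fin_num measurableT).
Qed.

Lemma gsmooth_unit_valued t f : measurable_fun setT f -> unit_valued f ->
  unit_valued (gsmooth t f).
Proof.
move=> mf f01 x; apply/andP; split.
  by apply: Rintegral_ge0 => z _; rewrite mulr_ge0//; case/andP: (f01 (x + Num.sqrt t * z)).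
rewrite -[leRHS]phi1; apply: le_Rintegral => //.
  exact: (@integrable_gsmooth t f x 1 mf (fun y => unit_valued_norm y f01)).
by move=> z _; rewrite ler_piMl//; case/andP: (f01 (x + Num.sqrt t * z)).
Qed.

Lemma gsmooth0 f x : gsmooth 0 f x = f x.
Proof.
rewrite /gsmooth sqrtr0; under eq_Rintegral do rewrite mul0r addr0.
by rewrite RintegralZl// phi1 mulr1.
Qed.

Lemma gsmooth_lipschitz t f (C : R) x y : measurable_fun setT f -> unit_valued f ->
  (forall a b, `|f a - f b| <= C * `|a - b|) ->
  `|gsmooth t f x - gsmooth t f y| <= C * `|x - y|.
Proof.
move=> mf f01 fC.
have ix z := @integrable_gsmooth t f z 1 mf (fun y => unit_valued_norm y f01).
rewrite /gsmooth -RintegralB//.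
have iB : leb.-integrable setT (EFin \o (fun z => f (x + Num.sqrt t * z) * phi z - f (y + Num.sqrt t * z) * phi z)).
  by have := integrableB measurableT (ix x) (ix y).
apply: (le_trans (le_normr_Rintegral measurableT iB)).
apply: (@le_trans _ _ (\int[leb]_z ((C * `|x - y|) * phi z))); last first.
  by rewrite RintegralZl// phi1 mulr1.
apply: le_Rintegral => //.
- exact: integrable_norm iB.
- by have := integrableZl measurableT (C * `|x - y|) iphi.
move=> z _; rewrite -mulrBl normrM [`|phi z|]ger0_norm// ler_wpM2r//.
rewrite (le_trans (fC _ _))//; suff -> : x + Num.sqrt t * z - (y + Num.sqrt t * z) = x - y by [].
by ring.
Qed.

Definition normal_abs1 : R := \int[leb]_z (`|z| * phi z).

(** Both times use the same normal variable. This will replace the variance at finite [n] by its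
    limit. *)
Lemma gsmooth_lipschitz_time t t' f (C : R) x : measurable_fun setT f -> unit_valued f ->
  (forall a b, `|f a - f b| <= C * `|a - b|) ->
  `|gsmooth t f x - gsmooth t' f x| <= C * `|Num.sqrt t - Num.sqrt t'| * normal_abs1.
Proof.
move=> mf f01 fC.
have ix s := @integrable_gsmooth s f x 1 mf (fun y => unit_valued_norm y f01).
rewrite /gsmooth -RintegralB//.
have iB : leb.-integrable setT (EFin \o (fun z => f (x + Num.sqrt t * z) * phi z - f (x + Num.sqrt t' * z) * phi z)).
  by have := integrableB measurableT (ix t) (ix t').
have iabs : leb.-integrable setT (EFin \o (fun z => `|z| * phi z)).
  by have := @integrable_normal_abs_moment R 1 isT.
apply: (le_trans (le_normr_Rintegral measurableT iB)).
apply: (@le_trans _ _ (\int[leb]_z ((C * `|Num.sqrt t - Num.sqrt t'|) * (`|z| * phi z)))); last first.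
  by rewrite RintegralZl.
apply: le_Rintegral => //.
- exact: integrable_norm iB.
- by have := integrableZl measurableT (C * `|Num.sqrt t - Num.sqrt t'|) iabs.
move=> z _; rewrite -mulrBl normrM [`|phi z|]ger0_norm// mulrA ler_wpM2r//.
rewrite (le_trans (fC _ _))// -mulrA -normrM.
suff -> : x + Num.sqrt t * z - (x + Num.sqrt t' * z) = (Num.sqrt t - Num.sqrt t') * z by [].
by ring.
Qed.

(* Completing the square in the product of two Gaussian densities. *)
Lemma normal_pdf_mul (a b v y : R) : 0 < a -> 0 < b ->
  normal_pdf 0 a y * normal_pdf 0 b (v - y) =
  normal_pdf 0 (Num.sqrt (a ^+ 2 + b ^+ 2)) v *
  normal_pdf (v * a ^+ 2 / (a ^+ 2 + b ^+ 2)) (a * b / Num.sqrt (a ^+ 2 + b ^+ 2)) y.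
Proof.
move=> a0 b0; set c := Num.sqrt _.
have ab0 : 0 < a ^+ 2 + b ^+ 2 by rewrite addr_gt0// exprn_gt0.
have c0 : 0 < c by rewrite sqrtr_gt0.
have cc : c ^+ 2 = a ^+ 2 + b ^+ 2 by rewrite sqr_sqrtr// ltW.
have peakE (s : R) : 0 < s -> normal_peak s = (s * Num.sqrt (pi *+ 2))^-1.
  by move=> s0; rewrite /normal_peak -mulrnAr sqrtrM ?sqr_ge0// sqrtr_sqr gtr0_norm.
have p0 : 0 < Num.sqrt (pi *+ 2) :> R by rewrite sqrtr_gt0 pmulrn_lgt0// pi_gt0.
rewrite !normal_pdfE ?gt_eqF ?divr_gt0 ?mulr_gt0// !peakE ?divr_gt0 ?mulr_gt0//.
rewrite /normal_fun !subr0.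
rewrite mulrACA -expRD [RHS]mulrACA -expRD; congr (_ * expR _).
  by field; rewrite !gt_eqF.
rewrite exprMn exprVn exprMn cc.
by field; rewrite !gt_eqF.
Qed.

Lemma ge0_integral_normal_scale (g : R -> R) (s : R) : 0 < s -> continuous g ->
  (forall y, 0 <= g y) ->
  (\int[leb]_y (g y * normal_pdf 0 s y)%:E = \int[leb]_z (g (s * z)%R * phi z)%:E)%E.
Proof.
move=> s0 cg g0.
rewrite (@ge0_integral_affine _ (fun y => g y * normal_pdf 0 s y) s 0)//; last 2 first.
- by move=> y; apply: cvgM; [exact: cg|apply: continuous_normal_pdf; rewrite gt_eqF].
- by move=> y; rewrite mulr_ge0// normal_pdf_ge0.
apply: eq_integral => z _; rewrite addr0 -mulrA; congr (EFin (_ * _)).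
rewrite !normal_pdfE ?oner_eq0 ?gt_eqF// /normal_fun !subr0 expr1n.
rewrite mulrAC; congr (_ * expR _); last by field; rewrite gt_eqF.
rewrite /normal_peak expr1n mul1r -mulrnAr sqrtrM ?sqr_ge0// sqrtr_sqr gtr0_norm//.
by field; rewrite !gt_eqF// sqrtr_gt0 pmulrn_lgt0// pi_gt0.
Qed.

(** For positive times both sides become integrals of [f] against Gaussian densities. After Tonelli,
    [normal_pdf_mul] splits the product into the density of variance [t + s] and one that integrates
    to 1. Time 0 is treated apart because the rescaling needs a positive deviation. *)
Lemma gsmooth_semigroup s t f x : 0 <= s -> 0 <= t -> continuous f -> unit_valued f ->
  continuous (gsmooth t f) ->
  gsmooth s (gsmooth t f) x = gsmooth (t + s) f x.
Proof.
move=> + + cf f01 cG.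
have mG : measurable_fun setT (gsmooth t f) by exact: continuous_measurable_fun.
have mf : measurable_fun setT f by exact: continuous_measurable_fun.
rewrite le_eqVlt => /predU1P[<- _|s0]; first by rewrite gsmooth0 addr0.
rewrite le_eqVlt => /predU1P[<-|t0].
  by rewrite add0r; congr gsmooth; apply/funext => y; rewrite gsmooth0.
have f0 y : 0 <= f y by case/andP: (f01 y).
apply: EFin_inj; rewrite EFin_gsmooth//; last exact: gsmooth_unit_valued.
rewrite EFin_gsmooth//.
set a := Num.sqrt s; set b := Num.sqrt t.
have a0 : 0 < a by rewrite sqrtr_gt0.
have b0 : 0 < b by rewrite sqrtr_gt0.
have cE : Num.sqrt (t + s) = Num.sqrt (a ^+ 2 + b ^+ 2).
  by rewrite !sqr_sqrtr ?ltW// addrC.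
have c0 : 0 < Num.sqrt (t + s) by rewrite sqrtr_gt0 addr_gt0.
have cfx (y : R) : continuous (fun z => f (y + z)).
  move=> z; apply: (cvg_comp (fun z => y + z) f); last exact: cf.
  by apply: (@cvgD _ R^o); [exact: cvg_cst|exact: cvg_id].
rewrite -[RHS](@ge0_integral_normal_scale (fun z => f (x + z)) _ c0 (cfx x) (fun=> f0 _)).
have G0 y : 0 <= gsmooth t f y by case/andP: (gsmooth_unit_valued t mf f01 y).
have na0 y : 0 <= normal_pdf 0 a y by exact: normal_pdf_ge0.
have nb0 y : 0 <= normal_pdf 0 b y by exact: normal_pdf_ge0.
have cn (r : R) : 0 < r -> continuous (normal_pdf 0 r).
  by move=> r0; apply: continuous_normal_pdf; rewrite gt_eqF.
have inner (y : R) : ((gsmooth t f (x + y))%:E = \int[leb]_v (f (x + v)%R * normal_pdf 0 b (v - y))%:E)%E.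
  rewrite (EFin_gsmooth _ _ mf f01) -(@ge0_integral_normal_scale (fun z => f (x + y + z)) b b0 (cfx (x + y)) (fun=> f0 _)).
  rewrite [RHS](@ge0_integral_affine _ (fun v => f (x + v) * normal_pdf 0 b (v - y)) 1 y)//; last 2 first.
  - move=> v; apply: cvgM; first exact: cfx.
    apply: (cvg_comp (fun v => v - y) (normal_pdf 0 b)); last exact: cn.
    by apply: (@cvgB _ R^o); [exact: cvg_id|exact: cvg_cst].
  - by move=> v; rewrite mulr_ge0.
  apply: eq_integral => v _; rewrite mul1r mulr1 addrK; congr (EFin (f _ * _)); ring.
pose F (z : R * R) := (f (x + z.2) * (normal_pdf 0 a z.1 * normal_pdf 0 b (z.2 - z.1)))%:E.
have mf2 (y : R) : measurable_fun setT (fun v => f (y + v)).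
  by apply: measurableT_comp => //; exact: measurable_funD.
have mF : measurable_fun setT F.
  apply/measurable_EFinP; apply: measurable_funM.
    apply: measurableT_comp => //; exact: measurable_funD.
  apply: measurable_funM.
    by apply: measurableT_comp => //; exact: measurable_normal_pdf.
  by apply: measurableT_comp; [exact: measurable_normal_pdf|exact: measurable_funB].
have F0 z : (0 <= F z)%E by rewrite lee_fin !mulr_ge0.
transitivity (\int[leb]_y (gsmooth t f (x + y) * normal_pdf 0 a y)%:E)%E.
  rewrite [RHS](@ge0_integral_normal_scale (fun y => gsmooth t f (x + y)))//.
  move=> z; apply: (cvg_comp (fun z => x + z) (gsmooth t f)); last exact: cG.
  by apply: (@cvgD _ R^o); [exact: cvg_cst|exact: cvg_id].
transitivity (\int[leb]_y \int[leb]_v F (y, v))%E.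
  apply: eq_integral => y _; rewrite EFinM inner -ge0_integralZr//; last 3 first.
  - apply/measurable_EFinP; apply: measurable_funM; first exact: mf2.
    by apply: measurableT_comp; [exact: measurable_normal_pdf|exact: measurable_funB].
  - by move=> v _; rewrite lee_fin mulr_ge0.
  - by rewrite lee_fin.
  by apply: eq_integral => v _; rewrite -EFinM /F/=; congr EFin; ring.
transitivity (\int[leb]_v \int[leb]_y F (y, v))%E.
  exact: (@fubini_tonelli _ _ _ _ R leb leb F mF F0).
apply: eq_integral => v _; rewrite cE /F/=.
under eq_integral do rewrite normal_pdf_mul// mulrA EFinM.
rewrite ge0_integralZl//.
- by rewrite integral_normal_pdf mule1.
- by apply/measurable_EFinP; exact: measurable_normal_pdf.
- by move=> y _; rewrite lee_fin normal_pdf_ge0.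
- by rewrite lee_fin mulr_ge0 ?normal_pdf_ge0.
Qed.

End gaussian_smoothing.

(** * Smooth approximations of half-line indicators *)

Section test_functions.
Context (R : realType).
Notation leb := (@lebesgue_measure R).
Notation phi := (normal_pdf (0 : R) 1).

(** A cubic bound on the Taylor remainder stands in for a bounded third derivative: it can be
    integrated against a Gaussian as it is, and it holds for cubic splines, which have no third
    derivative at their knots. Measurability of [A] and [B] is what integrating them requires. *)
Definition smooth_test (K : R) (f : R -> R) : Prop :=
  unit_valued f /\ exists A B : R -> R,
    [/\ measurable_fun setT A, measurable_fun setT B &
      forall x t, `|f (x + t) - f x - A x * t - B x * t ^+ 2| <= K * `|t| ^+ 3].

(** The expansions at [t = 1] and [t = -1], subtracted and added, isolate [A] and [B], while the
    values of [f] stay in [[0, 1]]. *)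
Lemma smooth_test_bounds K f (A B : R -> R) : 0 <= K -> unit_valued f ->
  (forall x t, `|f (x + t) - f x - A x * t - B x * t ^+ 2| <= K * `|t| ^+ 3) ->
  forall x, `|A x| <= K + 1 /\ `|B x| <= K + 1.
Proof.
move=> K0 f01 H x.
have := H x 1; have := H x (-1); have := f01 x; have := f01 (x + 1); have := f01 (x + -1).
rewrite normrN normr1 !expr1n sqrrN expr1n !mulr1 mulrN1 !ler_norml.
move=> /andP[? ?] /andP[? ?] /andP[? ?] /andP[? ?] /andP[? ?].
by split; apply/andP; split; lra.
Qed.

Lemma smooth_test_lipschitz K f : 0 <= K -> smooth_test K f ->
  forall a b, `|f a - f b| <= (3 * K + 3) * `|a - b|.
Proof.
move=> K0 [f01 [A [B [_ _ H]]]] a b.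
have [Ab Bb] := smooth_test_bounds K0 f01 H b.
have := H b (a - b); rewrite [b + _]addrC subrK; set t := a - b => Hb.
have [t1|/ltW t1] := leP 1 `|t|.
  have f1 : `|f a - f b| <= 1.
    have := f01 a; have := f01 b; rewrite ler_norml => /andP[? ?] /andP[? ?].
    by apply/andP; split; lra.
  nra.
have -> : f a - f b = (f a - f b - A b * t - B b * t ^+ 2) + A b * t + B b * t ^+ 2 by ring.
rewrite (le_trans (ler_normD _ _))//.
apply: (@le_trans _ _ (K * `|t| ^+ 3 + (K + 1) * `|t| + (K + 1) * `|t| ^+ 2)).
  apply: lerD; last by rewrite normrM normrX ler_wpM2r ?exprn_ge0.
  rewrite (le_trans (ler_normD _ _))//; apply: lerD => //.
  by rewrite normrM ler_wpM2r.
have t0 := normr_ge0 t.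
have t2 : `|t| ^+ 2 <= `|t| by rewrite expr2 ler_piMl.
have t3 : `|t| ^+ 3 <= `|t| by rewrite exprS (le_trans _ t2)// expr2 ler_wpM2l// expr2 ler_piMl.
nra.
Qed.

Lemma lipschitz_continuous (C : R) (f : R -> R) :
  (forall a b, `|f a - f b| <= C * `|a - b|) -> continuous f.
Proof.
move=> fC x; apply/cvgrPdist_le => e e0.
have C0 : 0 < `|C| + 1 by rewrite ltr_wpDl.
have d0 : 0 < e / (`|C| + 1) by rewrite divr_gt0.
apply: filterS (nbhsx_ballx x _ d0) => y; rewrite /ball/= => /ltW xy.
rewrite (le_trans (fC _ _))// (@le_trans _ _ ((`|C| + 1) * `|x - y|))//.
  by rewrite ler_wpM2r// (le_trans (ler_norm C))// lerDl.
by rewrite mulrC -ler_pdivlMr.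
Qed.

Lemma smooth_test_continuous K f : 0 <= K -> smooth_test K f -> continuous f.
Proof. by move=> K0 /(smooth_test_lipschitz K0); exact: lipschitz_continuous. Qed.

Lemma continuous_gsmooth K f t : 0 <= K -> smooth_test K f -> continuous (gsmooth t f).
Proof.
move=> K0 fK; apply: (@lipschitz_continuous (3 * K + 3)) => a b.
apply: gsmooth_lipschitz; [|by case: fK|exact: smooth_test_lipschitz].
by apply: continuous_measurable_fun; exact: smooth_test_continuous fK.
Qed.

(** The expansions of [f] at the points [x + sqrt t * z] are averaged over [z]. The constant [K]
    does not depend on [t], hence does not deteriorate along the replacements. *)
Lemma gsmooth_taylor3 K f x : 0 <= K -> smooth_test K f ->
  forall t, exists B, taylor3 K (gsmooth t f) x B.
Proof.
move=> K0 fK t; have cf := smooth_test_continuous K0 fK.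
have mf : measurable_fun setT f by exact: continuous_measurable_fun.
case: fK => f01 [A [B [mA mB H]]].
have AB y := smooth_test_bounds K0 f01 H y.
have iphi : leb.-integrable setT (EFin \o phi) by exact: integrable_normal_pdf.
have phi0 z : 0 <= phi z by exact: normal_pdf_ge0.
have f1 y : `|f y| <= 1 by have /andP[? ?] := f01 y; rewrite ger0_norm.
pose s := Num.sqrt t.
have iG := @integrable_gsmooth R t f _ 1 mf f1.
have iA : leb.-integrable setT (EFin \o (fun z => A (x + s * z) * phi z)).
  by apply: (@integrable_gsmooth R t A x (K + 1)) => // y; case: (AB y).
have iB : leb.-integrable setT (EFin \o (fun z => B (x + s * z) * phi z)).
  by apply: (@integrable_gsmooth R t B x (K + 1)) => // y; case: (AB y).
have iZ (c : R) (g : R -> R) : leb.-integrable setT (EFin \o g) ->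
    leb.-integrable setT (EFin \o (fun y => c * g y)).
  by move=> ig; have := integrableZl measurableT c ig.
have iS (g h : R -> R) : leb.-integrable setT (EFin \o g) -> leb.-integrable setT (EFin \o h) ->
    leb.-integrable setT (EFin \o (fun y => g y - h y)).
  by move=> g_ h_; have := integrableB measurableT g_ h_.
exists (\int[leb]_z (B (x + s * z) * phi z)), (\int[leb]_z (A (x + s * z) * phi z)) => h.
rewrite /gsmooth -/s.
have i1 := iS _ _ (iG (x + h)) (iG x).
have i2 := iS _ _ i1 (iZ h _ iA).
have i3 := iS _ _ i2 (iZ (h ^+ 2) _ iB).
rewrite -RintegralB//.
rewrite [_ * h]mulrC -RintegralZl// -RintegralB//; last exact: (iZ h _ iA).
rewrite [_ * h ^+ 2]mulrC -RintegralZl// -RintegralB//; last exact: (iZ _ _ iB).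
apply: (le_trans (le_normr_Rintegral measurableT i3)).
apply: (@le_trans _ _ (\int[leb]_z ((K * `|h| ^+ 3) * phi z))); last first.
  by rewrite RintegralZl// /Rintegral integral_normal_pdf mulr1.
apply: le_Rintegral => //.
- exact: integrable_norm i3.
- exact: iZ.
move=> z _.
have -> : f (x + h + Num.sqrt t * z) * phi z - f (x + Num.sqrt t * z) * phi z - h * (A (x + s * z) * phi z) - h ^+ 2 * (B (x + s * z) * phi z)
  = (f ((x + s * z) + h) - f (x + s * z) - A (x + s * z) * h - B (x + s * z) * h ^+ 2) * phi z.
  by rewrite -/s [x + h + _]addrAC; ring.
by rewrite normrM [`|phi z|]ger0_norm// ler_wpM2r.
Qed.

Definition cube_pos (x : R) : R := (Num.max 0 x) ^+ 3.

(** The third derivative of [cube_pos] is 0 or 6 off the origin, so the remainder is at most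
    [6 / 3!] times [|t|^3]. The proof compares the polynomials according to the signs of [x] and
    [x + t]. *)
Lemma cube_pos_taylor x t :
  `|cube_pos (x + t) - cube_pos x - 3 * (Num.max 0 x) ^+ 2 * t - 3 * Num.max 0 x * t ^+ 2| <= `|t| ^+ 3.
Proof.
rewrite -normrX /cube_pos.
have [x0|/ltW x0] := leP x 0; have [xt|/ltW xt] := leP (x + t) 0.
- by rewrite !expr0n/= !(mulr0, mul0r) !subr0 normr0.
- have t0 : 0 <= t by lra.
  rewrite !expr0n/= !(mulr0, mul0r) !subr0 !ger0_norm ?exprn_ge0//.
  by rewrite lerXn2r ?nnegrE//; lra.
- have t0 : t <= 0 by lra.
  have -> : 0 ^+ 3 - x ^+ 3 - 3 * x ^+ 2 * t - 3 * x * t ^+ 2 = t ^+ 3 + (- (x + t)) ^+ 3 by ring.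
  have e1 : (- (x + t)) ^+ 3 <= (- t) ^+ 3 by rewrite lerXn2r ?nnegrE//; lra.
  have e0 : 0 <= (- (x + t)) ^+ 3 by rewrite exprn_ge0//; lra.
  have e2 : (- t) ^+ 3 = - t ^+ 3 by ring.
  have t3 : 0 <= (- t) ^+ 3 by rewrite exprn_ge0//; lra.
  rewrite [leRHS]ler0_norm; last by lra.
  by rewrite ler_norml; apply/andP; split; lra.
- by rewrite [X in `|X|](_ : _ = t ^+ 3) //; ring.
Qed.

(* One minus the primitive of the quadratic B-spline supported on [0, 3]. *)
Definition soft_step (x : R) : R :=
  1 - (cube_pos x - 3 * cube_pos (x - 1) + 3 * cube_pos (x - 2) - cube_pos (x - 3)) / 6.

Lemma soft_step_le0 x : x <= 0 -> soft_step x = 1.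
Proof.
move=> x0; rewrite /soft_step /cube_pos !max_l; [|lra|lra|lra|lra].
by rewrite !expr0n/=; lra.
Qed.

Lemma soft_step_ge3 x : 3 <= x -> soft_step x = 0.
Proof.
move=> x0; rewrite /soft_step /cube_pos !max_r; [|lra|lra|lra|lra].
by field.
Qed.

Lemma soft_step_unit_valued : unit_valued soft_step.
Proof.
move=> x; have [x0|/ltW x0] := leP x 0; first by rewrite soft_step_le0// lexx ler01.
have [x3|/ltW x3] := leP 3 x; first by rewrite soft_step_ge3// lexx ler01.
rewrite /soft_step /cube_pos (max_r x0) (@max_l _ _ 0 (x - 3)); last lra.
have [x1|/ltW x1] := leP (x - 1) 0.
  rewrite (@max_l _ _ 0 (x - 2)); last lra.
  rewrite !expr0n/=.
  have h : x ^+ 3 <= 1 by rewrite exprn_ile1//; lra.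
  have h0 : 0 <= x ^+ 3 by rewrite exprn_ge0.
  by apply/andP; split; lra.
have [x2|/ltW x2] := leP (x - 2) 0.
  rewrite !expr0n/=; have -> : x ^+ 3 - 3 * (x - 1) ^+ 3 = 1 + 3 * (x - 1) + 3 * (x - 1) ^+ 2 - 2 * (x - 1) ^+ 3 by ring.
  set y := x - 1; have y0 : 0 <= y by []; have y1 : y <= 1 by rewrite /y; lra.
  have y2 : y ^+ 2 <= y by rewrite expr2 ler_piMl.
  have y3 : y ^+ 3 <= y ^+ 2 by rewrite exprS ler_piMl// exprn_ge0.
  have y30 : 0 <= y ^+ 3 by rewrite exprn_ge0.
  have y23 : y ^+ 2 - y ^+ 3 <= 1 - y.
    have -> : y ^+ 2 - y ^+ 3 = y ^+ 2 * (1 - y) by ring.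
    by rewrite ler_piMl ?subr_ge0// (le_trans y2).
  by apply/andP; split; lra.
have -> : 1 - (x ^+ 3 - 3 * (x - 1) ^+ 3 + 3 * (x - 2) ^+ 3 - 0 ^+ 3) / 6 = (3 - x) ^+ 3 / 6 by field.
have h : (3 - x) ^+ 3 <= 1 by rewrite exprn_ile1//; lra.
have h0 : 0 <= (3 - x) ^+ 3 by rewrite exprn_ge0//; lra.
by apply/andP; split; lra.
Qed.

(** The four cubes enter with weights 1, 3, 3, 1 over 6, giving the constant 8/6, rounded up to 2.
    Rescaling by [e] divides it by [e ^+ 3]. *)
Lemma smooth_test_soft_step (a e : R) : 0 < e ->
  smooth_test (2 / e ^+ 3) (fun x => soft_step ((x - a) / e)).
Proof.
move=> e0; split; first by move=> x; exact: soft_step_unit_valued.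
pose m (j x : R) : R := Num.max 0 (x - j).
pose A0 x := - (3 * m 0 x ^+ 2 - 3 * (3 * m 1 x ^+ 2) + 3 * (3 * m 2 x ^+ 2) - 3 * m 3 x ^+ 2) / 6.
pose B0 x := - (3 * m 0 x - 3 * (3 * m 1 x) + 3 * (3 * m 2 x) - 3 * m 3 x) / 6.
have mm j : measurable_fun setT (m j).
  by apply: measurable_maxr => //; exact: measurable_funB.
have mA0 : measurable_fun setT A0.
  apply: measurable_funM => //; apply: measurableT_comp => //.
  by repeat first [exact: mm | apply: measurable_funB | apply: measurable_funD | apply: measurable_funM | apply: measurable_funX | exact: measurable_cst].
have mB0 : measurable_fun setT B0.
  apply: measurable_funM => //; apply: measurableT_comp => //.
  by repeat first [exact: mm | apply: measurable_funB | apply: measurable_funD | apply: measurable_funM | apply: measurable_funX | exact: measurable_cst].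
have maff : measurable_fun setT (fun x : R => (x - a) / e).
  by apply: measurable_funM => //; exact: measurable_funB.
have T0 x t : `|soft_step (x + t) - soft_step x - A0 x * t - B0 x * t ^+ 2| <= 2 * `|t| ^+ 3.
  pose r j := cube_pos (x - j + t) - cube_pos (x - j) - 3 * (m j x) ^+ 2 * t - 3 * m j x * t ^+ 2.
  have rb j : `|r j| <= `|t| ^+ 3 by exact: cube_pos_taylor.
  have -> : soft_step (x + t) - soft_step x - A0 x * t - B0 x * t ^+ 2 =
      - (r 0 - 3 * r 1 + 3 * r 2 - r 3) / 6.
    by rewrite /soft_step /r /A0 /B0 subr0 ![x + t - _]addrAC; field.
  have := rb 0; have := rb 1; have := rb 2; have := rb 3; rewrite !ler_norml.
  move=> /andP[? ?] /andP[? ?] /andP[? ?] /andP[? ?]; have := exprn_ge0 3 (normr_ge0 t) => ?.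
  by apply/andP; split; lra.
exists (fun x => A0 ((x - a) / e) / e), (fun x => B0 ((x - a) / e) / e ^+ 2).
split.
- by apply: measurable_funM => //; exact: measurableT_comp.
- by apply: measurable_funM => //; exact: measurableT_comp.
move=> x t; have := T0 ((x - a) / e) (t / e).
have -> : (x - a) / e + t / e = (x + t - a) / e by ring.
have -> : 2 * `|t / e| ^+ 3 = 2 / e ^+ 3 * `|t| ^+ 3.
  by rewrite normrM [`|e^-1|]gtr0_norm ?invr_gt0// exprMn exprVn; ring.
have -> : A0 ((x - a) / e) * (t / e) = A0 ((x - a) / e) / e * t by ring.
suff -> : B0 ((x - a) / e) * (t / e) ^+ 2 = B0 ((x - a) / e) / e ^+ 2 * t ^+ 2 by [].
by rewrite exprMn exprVn; ring.
Qed.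

End test_functions.

(** * Lindeberg replacement *)

Section chain_estimates.
Context (R : realType) (alpha : R).
Hypothesis alpha_ge1 : 1 <= alpha.
Notation leb := (@lebesgue_measure R).
Notation q := (min_pdf alpha).
Notation root k := (k%:R `^ (1 / (1 + alpha)) : R).
Notation mu p := (Gamma (1 + p%:R / (1 + alpha)) : R).

Let q0 k y : 0 <= q k y. Proof. exact: min_pdf_ge0. Qed.
Let mq k : measurable_fun setT (q k). Proof. exact: measurable_min_pdf. Qed.
Let mEq k : measurable_fun setT (EFin \o q k). Proof. by apply/measurable_EFinP. Qed.

Let mshift (F : R -> \bar R) (x : R) : measurable_fun setT F ->
  measurable_fun setT (fun y => F (x + y)).
Proof. by move=> mF; apply: measurableT_comp => //; exact: measurable_funD. Qed.

Lemma le_chain r (F G : R -> \bar R) : measurable_fun setT F -> measurable_fun setT G ->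
  (forall x, 0 <= F x)%E -> (forall x, F x <= G x)%E -> forall x, (chain q r F x <= chain q r G x)%E.
Proof.
elim: r F G => [//|r IH] F G mF mG F0 FG /=.
have G0 x : (0 <= G x)%E by exact: le_trans (F0 x) (FG x).
apply: IH; [exact: measurable_convol|exact: measurable_convol| |] => x.
  exact: convol_ge0.
apply: ge0_le_integral => //.
- by move=> y _; rewrite mule_ge0// lee_fin.
- by apply: emeasurable_funM; [exact: mshift|exact: mEq].
- by apply: emeasurable_funM; [exact: mshift|exact: mEq].
- by move=> y _; rewrite lee_wpmul2r ?lee_fin.
Qed.

(** Constants pass through because each density has mass 1. With [le_chain], this carries the error
    of one replacement unchanged through the remaining convolutions. *)
Lemma chain_addc r (F : R -> \bar R) (e : R) : measurable_fun setT F -> (forall x, 0 <= F x)%E ->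
  0 <= e -> forall x, (chain q r (fun x => F x + e%:E) x = chain q r F x + e%:E)%E.
Proof.
move=> + + e0; elim: r F => [//|r IH] F mF F0 x /=.
rewrite -IH; last 2 first.
- exact: measurable_convol.
- by move=> y; exact: convol_ge0.
congr (chain q r _ x); apply/funext => y; rewrite /convol.
under eq_integral do rewrite ge0_muleDl//.
rewrite ge0_integralD//; last 4 first.
- by move=> z _; rewrite mule_ge0// lee_fin.
- by apply: emeasurable_funM; [exact: mshift|exact: mEq].
- by move=> z _; rewrite mule_ge0// lee_fin.
- by apply: emeasurable_funM => //; exact: mEq.
congr (_ + _)%E; rewrite ge0_integralZl//.
- by rewrite integral_min_pdf// mule1.
- exact: mEq.
- by move=> z _; rewrite lee_fin.
Qed.

(** Edges are nonnegative, so a chain started at a nonnegative point only sees [F] on the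
    nonnegative half-line. This lets absolute values and positive or negative parts be computed as
    linear or zero functions. *)
Lemma eq_convol_ge0 k (F G : R -> \bar R) x : 0 <= x -> (forall y, 0 <= y -> F y = G y) ->
  convol (q k) F x = convol (q k) G x.
Proof.
move=> x0 FG; apply: eq_integral => y _; have [y0|/ltW y0] := leP y 0.
  by rewrite min_pdf_le0// !mule0.
by rewrite FG// addr_ge0.
Qed.

Definition mean_edges r : R := \sum_(1 <= k < r.+1) mu 1 / root k.

Lemma mu1_root_ge0 k : 0 <= mu 1 / root k :> R.
Proof. by rewrite divr_ge0 ?mu_ge0 ?powR_ge0. Qed.

Lemma mean_edgesS r : mean_edges r.+1 = mean_edges r + mu 1 / root r.+1.
Proof. by rewrite /mean_edges big_nat_recr. Qed.

Lemma chain_translation r (a : R) (F : R -> \bar R) : 0 <= a ->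
  (forall x, 0 <= x -> F x = (x + a)%:E) ->
  forall x, 0 <= x -> chain q r F x = (x + a + mean_edges r)%:E.
Proof.
elim: r a F => [|r IH] a F a0 Fa x x0 /=.
  by rewrite Fa// /mean_edges big_geq// addr0.
rewrite (IH (a + mu 1 / root r.+1)) ?addr_ge0 ?mu1_root_ge0//.
  by rewrite mean_edgesS; congr EFin; ring.
move=> y y0; rewrite (eq_convol_ge0 _ y0 Fa) /convol.
transitivity (\int[leb]_z ((y + a)%:E * (q r.+1 z)%:E + (z ^+ 1 * q r.+1 z)%:E))%E.
  by apply: eq_integral => z _; rewrite -EFinM -EFinD expr1; congr EFin; ring.
have zq0 z : 0 <= z ^+ 1 * q r.+1 z.
  have [z0|/ltW z0] := leP z 0; first by rewrite min_pdf_le0// mulr0.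
  by rewrite mulr_ge0.
rewrite ge0_integralD//; last 4 first.
- by move=> z _; rewrite -EFinM lee_fin mulr_ge0// addr_ge0.
- by apply: emeasurable_funM => //; exact: mEq.
- by move=> z _; rewrite lee_fin.
- by apply/measurable_EFinP; apply: measurable_funM => //; exact: mq.
rewrite ge0_integralZl//; last 3 first.
- exact: mEq.
- by move=> z _; rewrite lee_fin.
- by rewrite lee_fin addr_ge0.
by rewrite integral_min_pdf// min_pdf_momentE// mule1 -EFinD expr1 addrA.
Qed.

Lemma chain_zero r (F : R -> \bar R) : (forall x, 0 <= x -> F x = 0%E) ->
  forall x, 0 <= x -> chain q r F x = 0%E.
Proof.
elim: r F => [|r IH] F F0 x x0 /=; first exact: F0.
apply: IH => // y y0; rewrite (eq_convol_ge0 _ y0 F0) /convol.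
by rewrite integral0_eq// => z _; rewrite mul0e.
Qed.

Section trotter.
Variables (K c : R) (f : R -> R).
Hypotheses (K0 : 0 <= K) (c0 : 0 < c) (fK : smooth_test K f).

Let cf : continuous f. Proof. exact: smooth_test_continuous fK. Qed.
Let mf : measurable_fun setT f. Proof. exact: continuous_measurable_fun. Qed.
Let f01 : unit_valued f. Proof. by case: fK. Qed.
Let cG t : continuous (gsmooth t f). Proof. exact: continuous_gsmooth fK. Qed.
Let mG t : measurable_fun setT (gsmooth t f). Proof. exact: continuous_measurable_fun. Qed.
Let G01 t : unit_valued (gsmooth t f). Proof. exact: gsmooth_unit_valued. Qed.

(** [K] times the third moment bounds of the edge and of the Gaussian replacing it, with the common
    factor [(c * root k) ^- 3] taken out. *)
Definition trotter_error : R := K * (mu 3 + mu 1 ^+ 3 + normal_abs3 R * Num.sqrt (sigma2 alpha) ^+ 3).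

Let s2 : 0 < sigma2 alpha. Proof. exact: sigma2_gt0. Qed.

Lemma trotter_error_ge0 : 0 <= trotter_error.
Proof.
rewrite mulr_ge0// !addr_ge0 ?mu_ge0 ?exprn_ge0 ?mu_ge0// mulr_ge0 ?exprn_ge0//.
by rewrite /normal_abs3 mulr_ge0// normal_peak_ge0.
Qed.

(* Lindeberg's replacement: a centered edge and the Gaussian of the same variance give the same second order
   Taylor expansion, so exchanging them costs only third moments. *)
Lemma trotter_step k t x : (0 < k)%N -> 0 <= t ->
  `|\int[leb]_y (gsmooth t f (x + (y - mu 1 / root k) / c) * q k y)
    - gsmooth (t + sigma2 alpha / (c * root k) ^+ 2) f x| <= trotter_error / (c * root k) ^+ 3.
Proof.
move=> k0 t0; have [B GB] := gsmooth_taylor3 x K0 fK t.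
have r0 : 0 < c * root k by rewrite mulr_gt0// powR_gt0// ltr0n.
have d0 : 0 <= sigma2 alpha / (c * root k) ^+ 2 by rewrite divr_ge0 ?exprn_ge0 ?ltW.
have := taylor_step (min_pdf_centered alpha_ge1 k0 c0) K0 (mG t) (G01 t) GB.
have := taylor_step (normal_centered d0) K0 (mG t) (G01 t) GB.
rewrite -[X in `|X - _|]/(gsmooth (sigma2 alpha / (c * root k) ^+ 2) (gsmooth t f) x) gsmooth_semigroup//.
set d := sigma2 alpha / _; set u := gsmooth t f x + _.
have -> : Num.sqrt d = Num.sqrt (sigma2 alpha) / (c * root k).
  by rewrite /d sqrtrM ?ltW// sqrtrV ?exprn_ge0 ?ltW// sqrtr_sqr gtr0_norm.
set I := \int[leb]_y _; move=> h1 h2.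
have -> : I - gsmooth (t + d) f x = (I - u) - (gsmooth (t + d) f x - u) by ring.
rewrite (le_trans (ler_normB _ _))// (le_trans (lerD h2 h1))//.
rewrite le_eqVlt; apply/orP; left; apply/eqP; rewrite /trotter_error.
move: (mu 1) (mu 3) (normal_abs3 R) (Num.sqrt _) => g1 g3 z3 s; field.
by rewrite !gt_eqF// powR_gt0// ltr0n.
Qed.

Definition edge_variance r : R := \sum_(1 <= k < r.+1) sigma2 alpha / (c * root k) ^+ 2.
Definition chain_error r : R := \sum_(1 <= k < r.+1) trotter_error / (c * root k) ^+ 3.

(** The innermost convolution is replaced first. [t] accumulates the Gaussian variance already put
    in and [M] is the centering still to be used up, so both vary in the induction. The estimate is
    split into two inequalities since [chain] takes extended real values. *)
Lemma chain_trotter r t (M x : R) : 0 <= t ->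
  (chain q r (fun x => (gsmooth t f ((x - M) / c))%:E) x <=
     (gsmooth (t + edge_variance r) f ((x - M + mean_edges r) / c) + chain_error r)%:E)%E /\
  ((gsmooth (t + edge_variance r) f ((x - M + mean_edges r) / c))%:E <=
     chain q r (fun x => (gsmooth t f ((x - M) / c))%:E) x + (chain_error r)%:E)%E.
Proof.
elim: r t M x => [|r IH] t M x t0.
  by split; rewrite /edge_variance /chain_error /mean_edges !big_geq//= !addr0 ?adde0.
set m := mu 1 / root r.+1; set d := sigma2 alpha / (c * root r.+1) ^+ 2.
set e := trotter_error / (c * root r.+1) ^+ 3.
have r0 : 0 < c * root r.+1 by rewrite mulr_gt0// powR_gt0// ltr0n.
have e0 : 0 <= e by rewrite divr_ge0 ?trotter_error_ge0// exprn_ge0// ltW.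
have td0 : 0 <= t + d by rewrite addr_ge0// divr_ge0 ?exprn_ge0 ?ltW.
have mGM s (M' : R) : measurable_fun setT (fun x : R => (gsmooth s f ((x - M') / c))%:E).
  apply/measurable_EFinP; apply: (measurableT_comp (mG s)).
  by apply: measurable_funM => //; exact: measurable_funB.
have G0 s y : (0 <= (gsmooth s f y)%:E)%E by rewrite lee_fin; case/andP: (G01 s y).
pose F x := (gsmooth t f ((x - M) / c))%:E.
pose F' x := (gsmooth (t + d) f ((x - (M - m)) / c))%:E.
(* The argument [(y + z - M) / c] is regrouped as [(y - (M - m)) / c + (z - m) / c], which centers
   the edge [z] and leaves [M - m] to the others. *)
have stepF y : exists2 v, convol (q r.+1) F y = v%:E & `|v - gsmooth (t + d) f ((y - (M - m)) / c)| <= e.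
  exists (\int[leb]_z (gsmooth t f ((y - (M - m)) / c + (z - m) / c) * q r.+1 z)); last exact: trotter_step.
  rewrite /Rintegral fineK.
    apply: eq_integral => z _; rewrite /F -EFinM; congr (EFin (gsmooth t f _ * _)).
    by rewrite -mulrDl; congr (_ / _); ring.
  apply: (integrable_fin_num measurableT).
  apply: (integrable_unit_density (u := fun z => gsmooth t f ((y - (M - m)) / c + (z - m) / c)) (@mq r.+1) (@q0 r.+1)).
  - have [_ _ _ iq _] := min_pdf_centered alpha_ge1 (isT : (0 < r.+1)%N) c0.
    by have := iq 0%N isT; congr (_.-integrable _ _); apply/funext => z /=; rewrite expr0 mul1r.
  - apply: (measurableT_comp (mG t)); apply: measurable_funD => //.
    by apply: measurable_funM => //; exact: measurable_funB.
  - by move=> z; exact: G01.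
have leF y : (convol (q r.+1) F y <= F' y + e%:E)%E.
  have [v -> h] := stepF y; rewrite /F' -EFinD lee_fin.
  by move: h; rewrite ler_norml => /andP[_]; rewrite lerBlDl.
have geF y : (F' y <= convol (q r.+1) F y + e%:E)%E.
  have [v -> h] := stepF y; rewrite /F' -EFinD lee_fin.
  by move: h; rewrite ler_norml => /andP[+ _]; rewrite lerBrDl lerBlDr.
have mF' : measurable_fun setT F' by exact: mGM.
have F'0 y : (0 <= F' y)%E by exact: G0.
have mC : measurable_fun setT (convol (q r.+1) F).
  by apply: measurable_convol; [exact: mq|exact: q0|exact: mGM|move=> y; exact: G0].
have C0 y : (0 <= convol (q r.+1) F y)%E by apply: convol_ge0 => // z; exact: G0.
have addm (H : R -> \bar R) : measurable_fun setT H -> measurable_fun setT (fun x => H x + e%:E)%E.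
  by move=> mH; exact: emeasurable_funD.
have [IH1 IH2] := IH (t + d) (M - m) x td0.
have EV : edge_variance r.+1 = edge_variance r + d by rewrite /edge_variance big_nat_recr.
have EE : chain_error r.+1 = chain_error r + e by rewrite /chain_error big_nat_recr.
have argE : (x - (M - m) + mean_edges r) / c = (x - M + mean_edges r.+1) / c.
  by rewrite mean_edgesS -/m; congr (_ / _); ring.
rewrite argE in IH1 IH2; have -> : t + edge_variance r.+1 = t + d + edge_variance r by rewrite EV; ring.
rewrite EE addrA; split.
  apply: (@le_trans _ _ (chain q r F' x + e%:E)%E).
    by rewrite -chain_addc//; apply: le_chain => //; exact: addm.
  by rewrite EFinD; exact: leeD2r.
have h : (chain q r F' x <= chain q r (convol (q r.+1) F) x + e%:E)%E.
  by rewrite -chain_addc//; apply: le_chain => //; exact: addm.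
apply: (le_trans IH2); rewrite EFinD [((chain_error r)%:E + _)%E]addeC addeA.
exact: leeD2r.
Qed.

End trotter.
End chain_estimates.

(** * Nearest neighbor tours *)

(** It transports independence from the given table of distances to the table written in visiting
    order. [tau] is injective, so each event on the new indices is an event on their images, with no
    condition elsewhere. *)
Lemma mutually_independent_reindex (d : measure_display) (T : measurableType d)
    (R : realType) (P : probability T R) (I I' : finType) (A : {set I}) (A' : {set I'})
    (X : I -> {RV P >-> R}) (Y : I' -> {RV P >-> R}) (tau : I' -> I) :
  {in A', forall p, tau p \in A} -> {in A' &, injective tau} ->
  {in A', forall p, Y p = X (tau p) :> (T -> R)} ->
  mutually_independent A X -> mutually_independent A' Y.
Proof.
move=> tauA tau_inj YX indep J B JA' mB.
pose B2 q := if [pick p in J | tau p == q] is Some p then B p else setT.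
have mB2 q : measurable (B2 q) by rewrite /B2; case: pickP.
have JA := fintype.subsetP JA'.
have B2E p : p \in J -> B2 (tau p) = B p.
  move=> pJ; rewrite /B2; case: pickP => [p' /andP[p'J /eqP tt]|/(_ p)].
    by congr B; apply: tau_inj => //; exact: JA.
  by rewrite pJ eqxx.
have tJA : (tau @: J)%SET \subset A.
  by apply/fintype.subsetP => _ /finset.imsetP[p pJ ->]; apply/tauA/JA.
have -> : \bigcap_(p in [set` J]) (Y p @^-1` B p) =
    \bigcap_(q in [set` (tau @: J)%SET]) (X q @^-1` B2 q).
  apply/seteqP; split => w Hw.
    move=> _ /= /finset.imsetP[p pJ ->]; rewrite B2E//.
    by have := Hw p pJ; rewrite (YX _ (JA _ pJ)).
  move=> p /= pJ; have := Hw (tau p) (finset.imset_f _ pJ).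
  by rewrite /= B2E// (YX _ (JA _ pJ)).
rewrite indep// big_imset/=; last first.
  by move=> p p' pJ p'J; apply: tau_inj; exact: JA.
by apply: eq_bigr => p pJ; rewrite B2E// (YX _ (JA _ pJ)).
Qed.

Section chain_constants.
Local Open Scope ereal_scope.
Context (R : realType).
Notation leb := (@lebesgue_measure R).

Lemma chain_cst (Q : nat -> R -> R) (cst_ : nat -> R) r (a : R) :
  (forall k, measurable_fun setT (Q k)) -> (forall k y, 0 <= Q k y)%R -> (0 <= a)%R ->
  (forall k, (0 < k <= r)%N -> \int[leb]_y (Q k y)%:E = (cst_ k)%:E) ->
  forall x, chain Q r (fun=> a%:E) x = (a * \prod_(1 <= k < r.+1) cst_ k)%R%:E.
Proof.
move=> mQ Q0; elim: r a => [|r IH] a a0 HQ x /=; first by rewrite big_geq// mulr1.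
have c0 : (0 <= cst_ r.+1)%R.
  by rewrite -lee_fin -HQ ?leqnn//; apply: integral_ge0 => y _; rewrite lee_fin.
have -> : convol (Q r.+1) (fun=> a%:E) = (fun=> (a * cst_ r.+1)%R%:E).
  apply/funext => y; rewrite /convol ge0_integralZl//.
  - by rewrite HQ ?leqnn// EFinM.
  - by apply/measurable_EFinP; exact: mQ.
  - by move=> z _; rewrite lee_fin.
rewrite IH ?mulr_ge0//.
  by rewrite (big_nat_recr r.+1)//= [(\prod_(1 <= k < r.+1) _ * _)%R]mulrC mulrA.
by move=> k /andP[k0 kr]; apply: HQ; rewrite k0 ltnW.
Qed.

End chain_constants.

(** * The law of the edges for a fixed visiting order *)

Section rows.
Local Open Scope ereal_scope.
Context (d : measure_display) (T : measurableType d) (R : realType)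
  (P : probability T R) (m : nat) (alpha : R) (alpha_ge1 : (1 <= alpha)%R).
Notation pairT := ('I_m.+1 * 'I_m.+1)%type.
Notation A := [set p : pairT | (p.1 < p.2)%N]%SET.
Context (X : pairT -> {RV P >-> R}) (indep : mutually_independent A X)
  (densX : forall p, p \in A -> has_density (X p) (weibull_pdf alpha)).
Notation leb := (@lebesgue_measure R).
Notation sigma K := (g_sigma_algebraType (cylinders X K)).
Notation pair i j := ((inord i, inord j) : pairT).
Notation S := (survival alpha).
Notation f := (min_pdf alpha 1).

Let densXf p : p \in A -> has_density (X p) f.
Proof. by move=> pA; rewrite -weibull_pdfE//; exact: densX. Qed.

Let mf : measurable_fun setT f. Proof. exact: measurable_min_pdf. Qed.
Let f0 x : (0 <= f x)%R. Proof. exact: min_pdf_ge0. Qed.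
Let S0 x : (0 <= S x)%R. Proof. exact: survival_ge0. Qed.
Let mS : measurable_fun setT S. Proof. exact: measurable_survival. Qed.

(* Row [i] of the table lists the distances from the city visited at time [i] to the cities visited later;
   [b i] bounds the columns that are compared with the entry chosen by the tour. *)
Definition row_comparisons (b : nat -> nat) (w : T) : R :=
  \prod_(0 <= i < m) \prod_(i.+2 <= j < b i) (X (pair i i.+1) w < X (pair i j) w)%R%:R.

Let pair_inj i j i' j' : (i <= m)%N -> (j <= m)%N -> (i' <= m)%N -> (j' <= m)%N ->
  pair i j = pair i' j' -> i = i' /\ j = j'.
Proof.
move=> im jm i'm j'm [/(congr1 val) + /(congr1 val)].
by rewrite /= !inordK.
Qed.

Let pairA i j : (i < j <= m)%N -> pair i j \in A.
Proof. by move=> /andP[ij jm]; rewrite inE/= !inordK// ltnS// ltnW// (leq_trans ij). Qed.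

(** The winner of row [i] is the entry [(i, i+1)] and its losers are the columns
    [i + 2, ..., b i - 1]. All entries are distinct, and each loser contributes one factor [S] at
    the winner of its row. *)
Lemma integrate_rows (b : nat -> nat) (K : {set pairT}) (h : T -> \bar R) :
  (forall i, (b i <= m.+1)%N) -> K \subset A ->
  (forall i, (i < m)%N -> pair i i.+1 \in K) ->
  (forall i j, (i < m)%N -> (i.+2 <= j < b i)%N -> pair i j \notin K) ->
  measurable_fun setT (h : sigma K -> \bar R) -> (forall w, 0 <= h w) ->
  \int[P]_w (h w * (row_comparisons b w)%:E) =
  \int[P]_w (h w * (\prod_(0 <= i < m) S (X (pair i i.+1) w) ^+ (b i - i.+2))%:E).
Proof.
move=> bm KA minK bK mh h0.
pose s := [seq pair i j | i <- index_iota 0 m, j <- index_iota i.+2 (b i)].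
pose e (p : pairT) : pairT := pair p.1 p.1.+1.
have sP p : p \in s -> exists i j, [/\ (i < m)%N, (i.+2 <= j < b i)%N & p = pair i j].
  move=> /allpairsPdep[i [j [+ + ->]]]; rewrite !mem_index_iota => /andP[_ im] jb.
  by exists i, j.
have us : uniq s.
  apply: allpairs_uniq_dep => [|i _|[i j] [i' j']]; [exact: iota_uniq|exact: iota_uniq|].
  move=> /allpairsPdep[i1 [j1 [+ + [-> ->]]]] /allpairsPdep[i2 [j2 [+ + [-> ->]]]].
  rewrite !mem_index_iota => /andP[_ i1m] /andP[i1j1 j1b] /andP[_ i2m] /andP[i2j2 j2b] /=.
  have jm a c : (c < b a)%N -> (c <= m)%N by move=> cb; rewrite -ltnS (leq_trans cb).
  by move=> /pair_inj[]; rewrite ?(ltnW i1m) ?(ltnW i2m) ?(jm _ _ j1b) ?(jm _ _ j2b)// => -> ->.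
have prodE (g : pairT -> R) : (\prod_(p <- s) g p = \prod_(0 <= i < m) \prod_(i.+2 <= j < b i) g (pair i j))%R.
  by rewrite big_allpairs_dep.
have eE i j : (i < m)%N -> e (pair i j) = pair i i.+1.
  by move=> im; rewrite /e/= inordK// ltnS ltnW.
have := @integrate_out_comparisons _ _ _ _ _ A X indep f mf f0 densXf K s e h S mS S0.
have tail t : \int[leb]_(x in `]t, +oo[) (f x)%:E = (S t)%:E.
  by rewrite min_pdf_tail// expr1.
move=> /(_ tail KA us) H.
transitivity (\int[P]_w (h w * (\prod_(p <- s) (X (e p) w < X p w)%R%:R)%:E)).
  apply: eq_integral => w _; congr (_ * _%:E); rewrite prodE /row_comparisons.
  apply: eq_big_nat => i /andP[_ im]; apply: eq_bigr => j _.
  by rewrite eE.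
rewrite H//.
- apply: eq_integral => w _; congr (_ * _%:E); rewrite prodE.
  apply: eq_big_nat => i /andP[_ im]; under eq_bigr do rewrite eE//.
  by rewrite prodr_const_nat.
- move=> p /sP[i [j [im /andP[ij jb] ->]]]; apply: pairA.
  by rewrite (ltn_trans _ ij)//= -ltnS (leq_trans jb).
- by move=> p /sP[i [j [im jb ->]]]; exact: bK.
- by move=> p /sP[i [j [im jb ->]]]; rewrite eE//; exact: minK.
Qed.

(** Edges are numbered backwards: [edge k] is taken when [k] cities are still unvisited, so it is a
    minimum of [k] distances. *)
Notation edge k := (pair (m - k) (m - k).+1).

Let edgeA k : (0 < k <= m)%N -> edge k \in A.
Proof. by move=> /andP[k0 km]; apply: pairA; rewrite ltnSn/= ltn_subrL k0 (leq_trans k0). Qed.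

Let edge_inj k l : (0 < k <= m)%N -> (0 < l <= m)%N -> edge k = edge l -> k = l.
Proof.
move=> /andP[k0 km] /andP[l0 lm] /pair_inj[]; rewrite ?leq_subr//.
- by rewrite ltn_subrL k0 (leq_trans k0).
- by rewrite ltn_subrL l0 (leq_trans l0).
by lia.
Qed.

Let edges : {set pairT} := [set edge (val k).+1 | k in 'I_m]%SET.

Let edgesP p : reflect (exists2 k, (0 < k <= m)%N & p = edge k) (p \in edges).
Proof.
apply: (iffP (finset.imsetP)) => [[k _ ->]|[[//|k] /andP[_ km] ->]].
  by exists (val k).+1 => //=; exact: ltn_ord.
by exists (Ordinal km).
Qed.

Let prod_edges (G : nat -> R -> R) w :
  (\prod_(0 <= i < m) G i (X (pair i i.+1) w) = \prod_(1 <= k < m.+1) G (m - k)%N (X (edge k) w))%R.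
Proof.
rewrite big_add1/= [RHS]big_nat_rev/=; apply: eq_big_nat => i /andP[_ im].
by rewrite add0n (_ : (m - (m - i.+1).+1)%N = i)//; lia.
Qed.

Definition edge_sum (w : T) : R := \sum_(1 <= k < m.+1) X (edge k) w.

Let full : nat -> nat := fun=> m.+1.

(** Row [m - k] leaves the weight [S ^+ k.-1] on [edge k]. To become the density of a minimum it
    lacks the factor [k], and these factors multiply to [m!]. *)
Lemma integral_edge_sum (F : R -> \bar R) : measurable_fun setT F -> (forall x, 0 <= F x) ->
  (m`!%:R)%:E * \int[P]_w (F (edge_sum w) * (row_comparisons full w)%:E) =
  chain (min_pdf alpha) m F 0%R.
Proof.
move=> mF F0.
have mX k : (0 < k <= m)%N -> measurable_fun setT (X (edge k) : sigma edges -> R).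
  by move=> km; apply: measurable_RV_sigma; apply/edgesP; exists k.
rewrite (@integrate_rows full edges (fun w => F (edge_sum w)))//; first last.
- apply: (measurableT_comp mF); rewrite /edge_sum.
  under eq_fun do rewrite big_add1/= big_mkord.
  by apply: measurable_sum => i; apply: mX; rewrite /= ltn_ord.
- move=> i j im /andP[ij jb]; apply/negP => /edgesP[k /andP[k0 km]] /pair_inj[]; rewrite ?leq_subr ?(ltnW im)//.
  by rewrite ltn_subrL k0 (leq_trans k0).
  by lia.
- move=> i im; apply/edgesP; exists (m - i)%N; first by rewrite subn_gt0 im leq_subr.
  by rewrite subKn// ltnW.
- by apply/fintype.subsetP => p /edgesP[k km ->]; exact: edgeA.
pose g (k : nat) (y : R) : R := (k%:R * S y ^+ k.-1)%R.
have g0 k y : (0 <= g k y)%R by rewrite mulr_ge0 ?exprn_ge0.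
have mg k : measurable_fun setT (g k) by apply: measurable_funM => //; exact: measurable_funX.
rewrite (_ : min_pdf alpha = (fun k y => g k y * f y)%R); last first.
  by apply/funext => k; apply/funext => y; rewrite min_pdfE.
rewrite -(integrate_out_sum indep mf f0 densXf edgeA edge_inj mg g0 mF F0).
rewrite -ge0_integralZl//; last 2 first.
- apply: emeasurable_funM.
    apply: (measurableT_comp mF); rewrite /edge_sum.
    by under eq_fun do rewrite big_add1/= big_mkord; exact: measurable_sum.
  apply/measurable_EFinP; under eq_fun do rewrite big_mkord.
  by apply: measurable_prod => i _; apply: measurable_funX; exact: measurableT_comp.
- by move=> w _; rewrite mule_ge0// lee_fin prodr_ge0// => i _; rewrite exprn_ge0.
apply: eq_integral => w _; rewrite muleCA; congr (_ * _); rewrite -EFinM; congr EFin.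
rewrite (prod_edges (fun i y => S y ^+ (full i - i.+2))%R) /g big_split/=; congr (_ * _)%R.
  by rewrite -natr_prod fact_prod.
apply: eq_big_nat => k /andP[k0 km]; congr (_ ^+ _)%R; rewrite /full; lia.
Qed.

(* Omitting the comparison of the first edge with [X (pair 0 m)] makes the latter independent of what remains,
   at the cost of a factor m / (m - 1) <= 2. *)
Lemma integral_last_edge : (1 < m)%N ->
  (m`!%:R)%:E * \int[P]_w (`|X (pair 0 m) w|%:E * (row_comparisons full w)%:E) <=
  (2 * Gamma (1 + 1%:R / (1 + alpha)))%R%:E.
Proof.
move=> m1; have m0 : (0 < m)%N by exact: ltnW.
pose b i := if i == 0%N then m else m.+1.
have row_ge0 c w : (0 <= row_comparisons c w)%R.
  by rewrite prodr_ge0// => i _; rewrite prodr_ge0.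
have le_rows w : (row_comparisons full w <= row_comparisons b w)%R.
  apply: ler_prod => i _; rewrite prodr_ge0//= /full /b; case: eqP => [->|//].
  by rewrite (big_nat_recr m)//= ler_piMr ?prodr_ge0//; case: (_ < _)%R.
pose p0 := pair 0 m.
have p0A : p0 \in A by apply: pairA; rewrite m0/=.
have p0edges k : (0 < k <= m)%N -> p0 <> edge k.
  move=> /andP[k0 km] /pair_inj[]; rewrite ?leq_subr//; last by lia.
  by rewrite ltn_subrL k0.
pose K := p0 |: edges.
have mp0 : measurable_fun setT (X p0 : sigma K -> R).
  by apply: measurable_RV_sigma; rewrite !inE eqxx.
have mrows c : measurable_fun setT (row_comparisons c).
  rewrite /row_comparisons; under eq_fun do rewrite big_mkord.
  apply: measurable_prod => i _; under eq_fun do rewrite -big_filter.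
  apply: measurable_prod => j _.
  have mlt : measurable_fun setT (fun w => (X (pair i i.+1) w < X (pair i j) w)%R).
    exact: measurable_fun_ltr.
  by apply: (measurableT_comp (f := fun b : bool => b%:R : R)).
apply: (@le_trans _ _ ((m`!%:R)%:E * \int[P]_w (`|X p0 w|%:E * (row_comparisons b w)%:E))).
  rewrite lee_wpmul2l ?lee_fin//; apply: ge0_le_integral => //.
  - by move=> w _; rewrite mule_ge0// lee_fin.
  - by apply: emeasurable_funM; apply/measurable_EFinP => //; exact: measurableT_comp.
  - by apply: emeasurable_funM; apply/measurable_EFinP => //; exact: measurableT_comp.
  - by move=> w _; rewrite lee_wpmul2l ?lee_fin.
rewrite (@integrate_rows b K (fun w => `|X p0 w|%:E))//; first last.
- by apply/measurable_EFinP; exact: measurableT_comp.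
- move=> i j im /andP[ij jb]; have jm : (j <= m)%N.
    by move: jb; rewrite /b; case: ifP => _; rewrite ?ltnS// => /ltnW.
  rewrite in_setU1 negb_or; apply/andP; split.
    apply/eqP => /pair_inj[]; rewrite ?(ltnW im)// => i0 jm'.
    by move: jb; rewrite /b i0 jm' eqxx ltnn.
  apply/negP => /edgesP[k /andP[k0 km]] /pair_inj[]; rewrite ?leq_subr ?(ltnW im)//.
    by rewrite ltn_subrL k0 (leq_trans k0).
  by lia.
- move=> i im; rewrite in_setU1; apply/orP; right; apply/edgesP; exists (m - i)%N.
    by rewrite subn_gt0 im leq_subr.
  by rewrite subKn// ltnW.
- rewrite finset.subUset finset.sub1set p0A; apply/fintype.subsetP => p /edgesP[k km ->].
  exact: edgeA.
- by move=> i; rewrite /b; case: ifP.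
(* The closing edge joins the others as index [m + 1] with weight [|y|], so that [integrate_out_sum]
   applies with [F = 1]. In [ex], [edge m] belongs to row 0, which has one comparison fewer. *)
pose x k := if k == m.+1 then p0 else edge k.
pose ex k := if k == m then (m - 2)%N else k.-1.
pose g (k : nat) (y : R) : R := if k == m.+1 then `|y|%R else (S y ^+ ex k)%R.
have g0 k y : (0 <= g k y)%R by rewrite /g; case: ifP => // _; rewrite exprn_ge0.
have mg k : measurable_fun setT (g k).
  by rewrite /g; case: (k == m.+1); [exact: normr_measurable|exact: measurable_funX].
have xA k : (0 < k <= m.+1)%N -> x k \in A.
  rewrite /x; case: eqP => // /eqP km /andP[k0 kM]; apply: edgeA.
  by rewrite k0 -ltnS ltn_neqAle km.
have xinj k l : (0 < k <= m.+1)%N -> (0 < l <= m.+1)%N -> x k = x l -> k = l.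
  move=> /andP[k0 kM] /andP[l0 lM]; rewrite /x.
  have lem i : (0 < i)%N -> (i <= m.+1)%N -> i != m.+1 -> (0 < i <= m)%N.
    by move=> i0 iM im; rewrite i0 -ltnS ltn_neqAle im.
  case: (eqVneq k m.+1) => [->|km]; case: (eqVneq l m.+1) => [->|lm] //.
  - by move/(p0edges _ (lem _ l0 lM lm)).
  - by move/esym/(p0edges _ (lem _ k0 kM km)).
  - by apply: edge_inj; apply: lem.
have mone : measurable_fun setT (fun _ : R => 1 : \bar R) by exact: measurable_cst.
have H := integrate_out_sum indep mf f0 densXf xA xinj mg g0 mone (fun=> lee01).
have -> : \int[P]_w (`|X p0 w|%:E * (\prod_(0 <= i < m) S (X (pair i i.+1) w) ^+ (b i - i.+2))%:E)
    = \int[P]_w (1 * (\prod_(1 <= k < m.+2) g k (X (x k) w))%:E).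
  apply: eq_integral => w _; rewrite mul1e (big_nat_recr m.+1)//= {2}/g {2}/x eqxx mulrC EFinM.
  congr (_ * _%:E); rewrite (prod_edges (fun i y => S y ^+ (b i - i.+2))%R).
  apply: eq_big_nat => k /andP[k0 km]; rewrite /g /x ltn_eqF//; congr (_ ^+ _)%R.
  rewrite /ex /b; case: eqP => [km'|/eqP km'].
    have -> : k = m by lia.
    by rewrite eqxx; lia.
  by rewrite ifF//; [lia|apply/eqP => kk; move: km'; rewrite kk subnn].
rewrite H.
pose c k : R := if k == m.+1 then Gamma (1 + 1%:R / (1 + alpha)) else ((ex k).+1%:R)^-1%R.
(* This is the mass 1 of [min_pdf j.+1] divided by [j + 1]. The edges thus contribute [1/k] for
   [k < m] and [1/(m-1)] for [k = m], whence the factor [m/(m-1)] after multiplication by [m!]. *)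
have powS j : \int[leb]_y (S y ^+ j * f y)%:E = ((j.+1%:R)^-1)%R%:E.
  have := @integral_min_pdf R alpha alpha_ge1 j.+1 isT.
  under eq_integral do rewrite min_pdfE -mulrA EFinM.
  rewrite ge0_integralZl//; last 2 first.
  - by apply/measurable_EFinP; apply: measurable_funM => //; exact: measurable_funX.
  - by move=> y _; rewrite lee_fin mulr_ge0// exprn_ge0.
  have : 0 <= \int[leb]_y (S y ^+ j.+1.-1 * f y)%:E.
    by apply: integral_ge0 => y _; rewrite lee_fin mulr_ge0// exprn_ge0.
  case: (\int[leb]_y _) => [r r0|_|//].
    rewrite -EFinM => -[/= jr]; congr EFin.
    by apply: (mulfI (_ : j.+1%:R != 0 :> R)%R) => //; rewrite jr divff.
  by rewrite gt0_muley// lte_fin.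
rewrite (@chain_cst R _ c m.+1 1%R)//; last 3 first.
- by move=> k; exact: measurable_funM.
- by move=> k y; rewrite mulr_ge0.
- move=> k /andP[k0 kM]; rewrite /g /c; case: ifP => _; last exact: powS.
  have := @min_pdf_momentE R alpha alpha_ge1 1 1 isT isT.
  rewrite expr1 powR1 divr1 => <-; apply: eq_integral => y _; rewrite expr1.
  have [y0|/ltW y0] := leP y 0%R; first by rewrite (min_pdf_le0 alpha_ge1 _ y0) !mulr0.
  by rewrite ger0_norm.
have mu0 : (0 <= Gamma (1 + 1%:R / (1 + alpha)) :> R)%R by exact: mu_ge0.
rewrite -EFinM lee_fin mul1r (big_nat_recr m.+1)//= {2}/c eqxx (big_nat_recr m)//=.
have -> : (\prod_(1 <= k < m) c k = ((m.-1)`!%:R)^-1)%R.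
  rewrite -[in RHS](prednK m0)/= fact_prod natr_prod -prodfV.
  rewrite prednK//; apply: eq_big_nat => k /andP[k0 km].
  by rewrite /c /ex !ltn_eqF ?ltnS// ?(ltnW km)// prednK.
rewrite /c /ex eqxx ltn_eqF// !mulrA ler_wpM2r//.
have -> : m`!%:R = (m%:R * (m.-1)`!%:R)%R :> R.
  by rewrite -natrM; congr (_%:R); case: (m) m0 => // k _; rewrite factS.
have fn : ((m.-1)`!%:R != 0 :> R)%R by rewrite pnatr_eq0 -lt0n fact_gt0.
rewrite mulfK// ler_pdivrMr ?ltr0n// -natrM ler_nat; lia.
Qed.

End rows.

(** * Tours for fixed distances *)

Section deterministic_tour.
Context (R : realType) (m : nat) (l : 'I_m.+1 -> 'I_m.+1 -> R).
Hypothesis l_sym : forall i j, l i j = l j i.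

Definition follows (s : {perm 'I_m.+1}) : Prop := forall i j, (i < m)%N -> (i.+2 <= j < m.+1)%N ->
  l (s (inord i)) (s (inord i.+1)) < l (s (inord i)) (s (inord j)).

(** Strict inequalities leave no choice: the next city of [v] is [s x] for some [x]; a position up
    to the current one is already visited, and one beyond the next is strictly farther than the
    unvisited [s (inord i.+1)]. Positions start at 0 in [s] and at 1 in [v]. *)
Lemma follows_nn_tour (s : {perm 'I_m.+1}) v : s ord0 = ord0 -> nn_tour l v -> follows s ->
  forall i, (i <= m)%N -> v i.+1 = s (inord i).
Proof.
move=> s0 [v1 vmin _] fs i; elim/ltn_ind: i => -[_ _|i IH im].
  have i0 : inord 0 = ord0 :> 'I_m.+1 by apply: val_inj; rewrite /= inordK.
  by rewrite i0 s0; exact: val_inj.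
have [vnew vle] := vmin i.+1 (im : (0 < i.+1 < m.+1)%N).
have vi : v i.+1 = s (inord i) by apply: IH => //; exact: ltnW.
pose x := (s^-1)%g (v i.+2).
have sx : s x = v i.+2 by rewrite /x permKV.
have xE : inord (val x) = x by apply: val_inj; rewrite /= inordK.
have visitedP u : u \in [seq v j | j <- iota 1 i.+1] -> exists2 j, (j <= i)%N & u = s (inord j).
  move=> /mapP[j]; rewrite mem_iota add1n => /andP[j1 ji] ->.
  exists j.-1; first by rewrite -ltnS prednK.
  by rewrite -IH ?prednK// (leq_trans _ (ltnW im))// -ltnS prednK.
have [xi|ix] := leqP (val x) i.
  have : v i.+2 \in [seq v j | j <- iota 1 i.+1].
    apply/mapP; exists (val x).+1; first by rewrite mem_iota /= add1n ltnS.
    by rewrite (IH (val x) xi (leq_trans xi (ltnW im))) xE sx.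
  by rewrite (negbTE vnew).
move: ix; rewrite leq_eqVlt => /predU1P[ix|ix].
  by rewrite -sx ix xE.
have unew : s (inord i.+1) \notin [seq v j | j <- iota 1 i.+1].
  apply/negP => /visitedP[j ji /perm_inj/(congr1 val)]; rewrite /= !inordK ?ltnS//.
    by move=> ij; rewrite -ij ltnn in ji.
  by rewrite (leq_trans ji)// ltnW.
have := vle _ unew; rewrite vi -sx -xE leNgt => /negP[].
by apply: fs => //; rewrite ix ltn_ord.
Qed.

Lemma tour_lengthE (s : {perm 'I_m.+1}) v : (0 < m)%N -> s ord0 = ord0 -> nn_tour l v -> follows s ->
  tour_length l v = \sum_(1 <= k < m.+1) l (s (inord (m - k))) (s (inord (m - k).+1)) +
    l (s (inord 0)) (s (inord m)).
Proof.
move=> m0 s0 vnn fs; have vE := follows_nn_tour s0 vnn fs.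
case: (vnn) => _ _ vlast.
rewrite /tour_length (big_nat_recr m.+1)//= vlast vE// vE// l_sym; congr (_ + _).
rewrite big_nat_rev/=; apply: eq_big_nat => k /andP[k1 km].
rewrite (_ : (1 + m.+1 - k.+1)%N = (m - k).+1); last by lia.
rewrite !vE//; last by lia.
by lia.
Qed.

End deterministic_tour.

Lemma card_perm_fix0 m : #|[set s : {perm 'I_m.+1} | s ord0 == ord0]%SET| = m`!.
Proof.
have := @card_perm 'I_m.+1 (~: [set ord0])%SET.
rewrite cardsC1 card_ord => <-; apply: eq_card => s; rewrite inE; apply/eqP/idP => [s0|].
  apply/fintype.subsetP => x; rewrite !inE; apply: contraNneq => ->.
  by rewrite s0.
by move=> /out_perm; apply; rewrite !inE eqxx.
Qed.

(** * Averaging over the visiting orders *)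

Section random_tour.
Local Open Scope ereal_scope.
Context (d : measure_display) (T : measurableType d) (R : realType)
  (P : probability T R) (m : nat) (alpha : R) (alpha_ge1 : (1 <= alpha)%R).
Context (L : 'I_m.+1 -> 'I_m.+1 -> {RV P >-> R}) (TNN : {RV P >-> R}).
Hypothesis m1 : (1 < m)%N.
Hypothesis L_sym : forall i j w, L i j w = L j i w.
Hypothesis L_indep : mutually_independent
  [set p : 'I_m.+1 * 'I_m.+1 | (p.1 < p.2)%N]%SET (fun p => L p.1 p.2).
Hypothesis L_weibull : forall i j : 'I_m.+1, (i < j)%N -> has_density (L i j) (weibull_pdf alpha).
Hypothesis TNN_nn : forall w, exists2 v : nat -> 'I_m.+1,
  nn_tour (fun i j => L i j w) v & TNN w = tour_length (fun i j => L i j w) v.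
Notation pairT := ('I_m.+1 * 'I_m.+1)%type.
Notation A := [set p : pairT | (p.1 < p.2)%N]%SET.
Notation mu1 := (Gamma (1 + 1%:R / (1 + alpha))).

Definition relabel (s : {perm 'I_m.+1}) (p : pairT) : {RV P >-> R} := L (s p.1) (s p.2).

(** Independence and densities are given for increasing pairs only, and a permutation may reverse a
    pair. Sorting it leaves the distance unchanged by symmetry. *)
Definition sorted_image (s : {perm 'I_m.+1}) (p : pairT) : pairT :=
  if (s p.1 < s p.2)%N then (s p.1, s p.2) else (s p.2, s p.1).

Lemma relabel_sorted s p : relabel s p = L (sorted_image s p).1 (sorted_image s p).2 :> (T -> R).
Proof. by rewrite /relabel /sorted_image; case: ifP => //= _; apply/funext => w; rewrite L_sym. Qed.

Lemma sorted_image_lt s p : p \in A -> sorted_image s p \in A.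
Proof.
rewrite !inE /sorted_image => p12; case: ifPn => //=; rewrite -leqNgt leq_eqVlt => /predU1P[/val_inj/perm_inj e|//].
by move: p12; rewrite e ltnn.
Qed.

Lemma relabel_indep s : mutually_independent A (relabel s).
Proof.
apply: (mutually_independent_reindex (tau := sorted_image s)) L_indep.
- by move=> p; exact: sorted_image_lt.
- move=> [a b] [a' b']; rewrite !inE /sorted_image/= => ab ab'.
  case: ifP => _; case: ifP => _ [/perm_inj e1 /perm_inj e2]; subst => //.
  - by move: ab'; rewrite ltnNge ltnW.
  - by move: ab'; rewrite ltnNge ltnW.
- by move=> p _; exact: relabel_sorted.
Qed.

Lemma relabel_density s p : p \in A -> has_density (relabel s p) (weibull_pdf alpha).
Proof.
move=> pA B mB; have /= := sorted_image_lt s pA; rewrite inE => /L_weibull <-//.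
by rewrite /distribution /pushforward relabel_sorted.
Qed.

(* The indicator that, when the cities are visited in the order [s], every step is strictly the shortest one,
   in which case [s] is the nearest neighbor tour. *)
Definition chosen s : T -> R := row_comparisons (relabel s) (fun=> m.+1).
Notation fix0 := [set s : {perm 'I_m.+1} | s ord0 == ord0]%SET.

Lemma chosen_follows s w : (chosen s w = 0 \/ chosen s w = 1 /\ follows (fun i j => L i j w) s)%R.
Proof.
have [/eqP c0|c0] := boolP (chosen s w == 0)%R; [by left|right].
have cmp i j : (i < m)%N -> (i.+2 <= j < m.+1)%N ->
    (L (s (inord i)) (s (inord i.+1)) w < L (s (inord i)) (s (inord j)) w)%R.
  move=> im ij; apply: contraT => n; move: c0; rewrite /chosen /row_comparisons.
  rewrite (bigD1_seq i) ?mem_index_iota ?iota_uniq//= (bigD1_seq j) ?mem_index_iota ?iota_uniq//=.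
  by rewrite (negbTE n) !mul0r eqxx.
split; last exact: cmp.
rewrite /chosen /row_comparisons big_nat big1// => i /andP[_ im].
by rewrite big_nat big1// => j ij; rewrite cmp.
Qed.

Lemma chosen_ge0 s w : (0 <= chosen s w)%R.
Proof. by case: (chosen_follows s w) => [->|[-> _]]. Qed.

Lemma measurable_chosen s : measurable_fun setT (chosen s).
Proof.
rewrite /chosen /row_comparisons; under eq_fun do rewrite big_mkord.
apply: measurable_prod => i _; under eq_fun do rewrite -big_filter.
apply: measurable_prod => j _.
have mlt : measurable_fun setT (fun w => (relabel s (inord i, inord i.+1) w < relabel s (inord i, inord j) w)%R).
  exact: measurable_fun_ltr.
by apply: (measurableT_comp (f := fun b : bool => b%:R : R)).
Qed.

(** Both orders coincide with the tour [v] supplied by [TNN_nn]. *)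
Lemma chosen_unique s s' w : s \in fix0 -> s' \in fix0 -> chosen s w != 0%R -> chosen s' w != 0%R -> s = s'.
Proof.
rewrite !inE => /eqP s0 /eqP s'0; have [v vnn _] := TNN_nn w.
case: (chosen_follows s w) => [->|[_ f1]]; first by rewrite eqxx.
case: (chosen_follows s' w) => [->|[_ f2]]; first by rewrite eqxx.
move=> _ _; apply/permP => x; have xE : x = inord x by apply: val_inj; rewrite /= inordK.
rewrite xE -(follows_nn_tour s0 vnn f1) -?(follows_nn_tour s'0 vnn f2)//; by rewrite -ltnS.
Qed.

(* The length of the tour without its closing edge; it is [0] when ties prevent every order from being chosen. *)
Definition tour_edges w : R := (\sum_(s in fix0) chosen s w * edge_sum (relabel s) w)%R.

Lemma chosen_tour_edges s w : s \in fix0 -> chosen s w != 0%R -> tour_edges w = edge_sum (relabel s) w.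
Proof.
move=> s0 cs; rewrite /tour_edges (bigD1 s)//= big1 ?addr0 => [|s' /andP[s'0 ss']].
  by case: (chosen_follows s w) cs => [->|[-> _] _]; rewrite ?eqxx ?mul1r.
have [->|cs'] := eqVneq (chosen s' w) 0%R; first by rewrite mul0r.
by rewrite (chosen_unique s'0 s0 cs' cs) eqxx in ss'.
Qed.

Lemma measurable_edge_sum s : measurable_fun setT (edge_sum (relabel s)).
Proof. by rewrite /edge_sum; under eq_fun do rewrite big_add1/= big_mkord; exact: measurable_sum. Qed.

Lemma measurable_tour_edges : measurable_fun setT tour_edges.
Proof.
rewrite /tour_edges; under eq_fun do rewrite -big_filter.
apply: measurable_sum => s; apply: measurable_funM; first exact: measurable_chosen.
exact: measurable_edge_sum.
Qed.

Let fact0 : (m`!%:R != 0 :> R)%R. Proof. by rewrite pnatr_eq0 -lt0n fact_gt0. Qed.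

(** The relabelled table satisfies the same hypotheses for every [s], so all orders contribute
    equally and their sum over the [m!] orders is the chain itself. *)
Lemma integral_chosen (s : {perm 'I_m.+1}) (F : R -> \bar R) : measurable_fun setT F -> (forall x, 0 <= F x) ->
  \int[P]_w (F (edge_sum (relabel s) w) * (chosen s w)%:E) =
  (m`!%:R^-1)%R%:E * chain (min_pdf alpha) m F 0%R.
Proof.
move=> mF F0.
rewrite -(integral_edge_sum alpha_ge1 (@relabel_indep s) (@relabel_density s) mF F0).
by rewrite muleA -EFinM mulVf// mul1e.
Qed.

Let sum_fix0 (a : R) (c : \bar R) : (0 <= a)%R -> \sum_(s in fix0) (a%:E * c) = (m`!%:R * a)%R%:E * c.
Proof.
by move=> a0; rewrite -ge0_sume_distrl// sumEFin sumr_const card_perm_fix0 mulr_natl.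
Qed.

Lemma sum_chosen_le1 w : (\sum_(s in fix0) chosen s w <= 1)%R.
Proof.
have [/existsP[s /andP[s0 cs]]|/existsPn none] := boolP [exists s, (s \in fix0) && (chosen s w != 0%R)].
  rewrite (bigD1 s)//= big1 ?addr0 => [|s' /andP[s'0 ss']].
    by case: (chosen_follows s w) => [->|[-> _]].
  have [//|cs'] := eqVneq (chosen s' w) 0%R.
  by rewrite (chosen_unique s'0 s0 cs' cs) eqxx in ss'.
rewrite big1// => s s0; have := none s; rewrite s0 /= negbK => /eqP; exact.
Qed.

Let measurable_sum_chosen : measurable_fun setT (fun w => \sum_(s in fix0) chosen s w)%R.
Proof.
under eq_fun do rewrite -big_filter.
by apply: measurable_sum => s; exact: measurable_chosen.
Qed.

(* Ties need no separate treatment: each of the m! orders is chosen with probability 1/m! and at most one is,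
   so that almost surely exactly one is. *)
Lemma sum_chosen_ae : ae_eq P setT (fun w => \sum_(s in fix0) (chosen s w)%:E) (cst 1).
Proof.
pose Z w := (\sum_(s in fix0) chosen s w)%R.
have Z0 w : (0 <= Z w)%R by apply: sumr_ge0 => s _; exact: chosen_ge0.
have intZ : \int[P]_w (Z w)%:E = 1.
  under eq_integral do rewrite /Z -sumEFin -big_filter.
  rewrite ge0_integral_sum//; last 2 first.
  - by move=> s; apply/measurable_EFinP; exact: measurable_chosen.
  - by move=> s w _; rewrite lee_fin chosen_ge0.
  rewrite big_filter.
  have chain1 : chain (min_pdf alpha) m (fun=> 1) 0%R = 1.
    rewrite (@chain_cst R _ (fun=> 1%R) m 1%R)//.
    - by rewrite big1_eq mulr1.
    - by move=> k; exact: measurable_min_pdf.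
    - by move=> k y; exact: min_pdf_ge0.
    - by move=> k /andP[k0 _]; exact: integral_min_pdf.
  transitivity (\sum_(s in fix0) ((m`!%:R^-1)%R%:E * (1 : \bar R))).
    apply: eq_bigr => s _; rewrite -[X in _ * X]chain1 -(@integral_chosen s (fun=> 1))//.
    by apply: eq_integral => w _; rewrite mul1e.
  by rewrite sum_fix0 ?invr_ge0// mulfV// mul1e.
pose g w := (1 - Z w)%R%:E.
have g0 w : 0 <= g w by rewrite lee_fin subr_ge0 sum_chosen_le1.
have mZ : measurable_fun setT (fun w => (Z w)%:E) by apply/measurable_EFinP.
have mg : measurable_fun setT g by apply/measurable_EFinP; exact: measurable_funB.
have intg : \int[P]_w `|g w| = 0.
  have : \int[P]_w (g w + (Z w)%:E) = 1.
    under eq_integral do rewrite /g -EFinD subrK.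
    by rewrite (integral_cst P measurableT 1) [X in _ * X](@probability_setT _ _ _ P) mule1.
  rewrite ge0_integralD//; last by move=> w _; rewrite lee_fin.
  rewrite intZ => intg1; under eq_integral do rewrite gee0_abs//.
  by rewrite -[LHS](addeK _ (isT : (1 : \bar R) \is a fin_num)) intg1 subee.
have := (ae_eq_integral_abs P measurableT mg).1 intg.
apply: filterS => w /= + _ => /(_ I) -[/eqP]; rewrite subr_eq0 => /eqP e.
by rewrite sumEFin -/(Z w) -e.
Qed.

Lemma integral_by_tour (G : T -> \bar R) : measurable_fun setT G -> (forall w, 0 <= G w) ->
  \int[P]_w G w = \sum_(s in fix0) \int[P]_w (G w * (chosen s w)%:E).
Proof.
move=> mG G0.
have mGc s : measurable_fun setT (fun w => G w * (chosen s w)%:E).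
  by apply: emeasurable_funM => //; apply/measurable_EFinP; exact: measurable_chosen.
rewrite -[RHS]big_filter -ge0_integral_sum//; last first.
  by move=> s w _; rewrite mule_ge0// lee_fin chosen_ge0.
apply: ae_eq_integral => //.
  by apply: emeasurable_sum.
apply: filterS sum_chosen_ae => w /= /(_ I) e _.
rewrite big_filter -ge0_sume_distrr ?e ?mule1// => s _.
by rewrite lee_fin chosen_ge0.
Qed.

Lemma integral_tour_edges (F : R -> \bar R) : measurable_fun setT F -> (forall x, 0 <= F x) ->
  \int[P]_w F (tour_edges w) = chain (min_pdf alpha) m F 0%R.
Proof.
move=> mF F0; rewrite integral_by_tour//; last first.
  by apply: (measurableT_comp mF); exact: measurable_tour_edges.
transitivity (\sum_(s in fix0) ((m`!%:R^-1)%R%:E * chain (min_pdf alpha) m F 0%R)).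
  apply: eq_bigr => s s0; rewrite -(integral_chosen s mF F0).
  apply: eq_integral => w _; have [->|cs] := eqVneq (chosen s w) 0%R; first by rewrite !mule0.
  by rewrite (chosen_tour_edges s0 cs).
by rewrite sum_fix0 ?invr_ge0// mulfV// mul1e.
Qed.

(** Where [s] is chosen, the difference is exactly the edge between the first and the last city of
    [s]. The bound of [integral_last_edge], divided by [m!], is then summed over [m!] orders. *)
Lemma integral_closing_edge : \int[P]_w `|TNN w - tour_edges w|%:E <= (2 * mu1)%R%:E.
Proof.
rewrite integral_by_tour//; last first.
  apply/measurable_EFinP; apply: measurableT_comp => //; apply: measurable_funB => //.
  exact: measurable_tour_edges.
apply: (@le_trans _ _ (\sum_(s in fix0) ((m`!%:R^-1)%R%:E * (2 * mu1)%R%:E))); last first.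
  by rewrite sum_fix0 ?invr_ge0// mulfV// mul1e.
apply: lee_sum => s s0.
have -> : \int[P]_w (`|TNN w - tour_edges w|%:E * (chosen s w)%:E) =
    \int[P]_w (`|relabel s (inord 0, inord m) w|%:E * (chosen s w)%:E).
  apply: eq_integral => w _; have [->|cs] := eqVneq (chosen s w) 0%R; first by rewrite !mule0.
  case: (chosen_follows s w) => [c0|[_ fs]]; first by rewrite c0 eqxx in cs.
  have [v vnn ->] := TNN_nn w.
  rewrite (chosen_tour_edges s0 cs) (tour_lengthE _ (ltnW m1) _ vnn fs).
  - by rewrite /edge_sum /relabel/= addrC addKr.
  - by move=> i j; exact: L_sym.
  - by move: s0; rewrite inE => /eqP.
have := integral_last_edge alpha_ge1 (@relabel_indep s) (@relabel_density s) m1.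
move=> /(lee_wpmul2l (_ : 0 <= (m`!%:R^-1)%R%:E)); rewrite muleA -EFinM mulVf// mul1e; apply.
by rewrite lee_fin invr_ge0.
Qed.

End random_tour.

(** * Normalizing constants *)

Section edge_scales.
Context (R : realType).

Lemma weighted_amgm (a y z : R) : 0 < a < 1 -> 0 <= y -> 0 <= z ->
  y `^ a * z `^ (1 - a) <= a * y + (1 - a) * z.
Proof.
move=> /andP[a0 a1] y0 z0; have b0 : 0 < 1 - a by rewrite subr_gt0.
have := @conjugate_powR R (y `^ a) (z `^ (1 - a)) a^-1 (1 - a)^-1.
rewrite !powR_ge0 !invr_gt0 !invrK a0 b0 => /(_ isT isT isT isT).
rewrite -!powRrM !mulfV ?gt_eqF// !powRr1// => H.
by rewrite (mulrC a) (mulrC (1 - a)); apply: H; rewrite addrC subrK.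
Qed.

(** By concavity [y^a] lies below its tangent at [k]; take [y = k + 1] and [y = k - 1]. The tangent
    inequality is the weighted mean inequality for [y] and [k], multiplied by [k^(a-1)]. *)
Lemma powR_increment (a : R) (k : nat) : 0 < a < 1 -> (0 < k)%N ->
  k.+1%:R `^ a - k%:R `^ a <= a * k%:R `^ (a - 1) <= k%:R `^ a - k.-1%:R `^ a.
Proof.
move=> a01 k0; have [a0 a1] := andP a01; have kR : 0 < k%:R :> R by rewrite ltr0n.
set u := k%:R `^ (a - 1); have u0 : 0 < u by rewrite powR_gt0.
have powD x y : k%:R `^ (x + y) = k%:R `^ x * k%:R `^ y :> R.
  by rewrite powRD// (gt_eqF kR) implybT.
have uk : u * k%:R `^ (1 - a) = 1.
  by rewrite -powD (_ : a - 1 + (1 - a) = 0) ?powRr0//; ring.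
have uk1 : u * k%:R = k%:R `^ a.
  by rewrite -{1}[k%:R]powRr1 ?ltW// -powD subrK.
have main y : 0 <= y -> y `^ a <= u * (a * y + (1 - a) * k%:R).
  move=> y0; have := weighted_amgm a01 y0 (ltW kR).
  by rewrite -(ler_pM2l u0) mulrCA uk mulr1.
have predk : (k.-1)%:R = k%:R - 1 :> R by rewrite -{2}(prednK k0) -natr1 addrK.
have := main _ (ler0n _ k.+1); have := main _ (ler0n _ k.-1).
rewrite predk -natr1.
have -> : u * (a * (k%:R - 1) + (1 - a) * k%:R) = u * k%:R - a * u by ring.
have -> : u * (a * (k%:R + 1) + (1 - a) * k%:R) = u * k%:R + a * u by ring.
by rewrite uk1 => h1 h2; apply/andP; split; lra.
Qed.

Lemma telescope_powR_sum (a : R) (n : nat) : 0 < a < 1 ->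
  n.+1%:R `^ a - 1 <= a * \sum_(1 <= k < n.+1) k%:R `^ (a - 1) <= n%:R `^ a.
Proof.
move=> a01; rewrite mulr_sumr; elim: n => [|n /andP[i1 i2]].
  by rewrite big_geq// powR1 subrr lexx powR_ge0.
rewrite (big_nat_recr n.+1)//=; have /andP[h1 h2] := powR_increment a01 (ltn0Sn n).
by move: h1 h2 i1 i2; rewrite /= => h1 h2 i1 i2; apply/andP; split; lra.
Qed.

Lemma invr_cvg0 (c : nat -> R) : (forall M, \forall n \near \oo, M <= c n) ->
  (c n)^-1 @[n --> \oo] --> 0.
Proof.
move=> H; apply/cvgr0Pnorm_le => e e0; near=> n.
have ce : e^-1 <= c n by near: n; exact: H.
have c0 : 0 < c n by apply: lt_le_trans ce; rewrite invr_gt0.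
rewrite ger0_norm; last by rewrite invr_ge0 ltW.
by rewrite -(invrK e) lef_pV2// posrE invr_gt0.
Unshelve. all: by end_near.
Qed.

Lemma near_powR_nat_ge (b M : R) : 0 < b -> \forall n \near \oo, M <= n%:R `^ b.
Proof.
move=> b0; near=> n; have [M0|/ltW M0] := leP 0 M; last by rewrite (le_trans M0)// powR_ge0.
have -> : M = (M `^ b^-1) `^ b by rewrite -powRrM mulVf ?gt_eqF// powRr1.
have Mn : M `^ b^-1 <= n%:R by near: n; exact: nbhs_infty_ger.
by apply: ge0_ler_powR; rewrite ?nnegrE ?powR_ge0 ?(ltW b0).
Unshelve. all: by end_near.
Qed.

Lemma near_ln_nat_ge (M : R) : \forall n \near \oo, M <= ln n%:R.
Proof.
near=> n; have h : expR M <= n%:R by near: n; exact: nbhs_infty_ger.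
by rewrite -[M]expRK ler_ln ?posrE ?expR_gt0// (lt_le_trans _ h)// expR_gt0.
Unshelve. all: by end_near.
Qed.

Lemma near_sqrt_ln_nat_ge (M : R) : \forall n \near \oo, M <= Num.sqrt (ln n%:R).
Proof.
near=> n; have [M0|/ltW M0] := leP 0 M; last by rewrite (le_trans M0)// sqrtr_ge0.
rewrite -(ger0_norm M0) -sqrtr_sqr ler_wsqrtr//; near: n; exact: near_ln_nat_ge.
Unshelve. all: by end_near.
Qed.

Lemma root_sqr_sum_cvg (alpha : R) : 1 < alpha ->
  (\sum_(1 <= k < n) (k%:R `^ (1 / (1 + alpha))) ^- 2) / (n%:R `^ (1 / 2 - 1 / (1 + alpha))) ^+ 2
  @[n --> \oo] --> (alpha + 1) / (alpha - 1).
Proof.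
(* With this [a] the summand is [k^(a-1)], the squared normalization is [n^a], and the limit is
   [1/a]. Positivity of [a] is the condition [alpha > 1]. *)
move=> a1; pose a := 1 - 2 / (1 + alpha).
have a0 : 0 < a by rewrite subr_gt0 ltr_pdivrMr; lra.
have a01 : 0 < a < 1 by rewrite a0 /= ltrBlDr ltrDl divr_gt0//; lra.
have -> : (alpha + 1) / (alpha - 1) = a^-1.
  by rewrite /a; field; rewrite !gt_eqF//; lra.
have sqE (x b : R) : (x `^ b) ^+ 2 = x `^ (b * 2).
  by rewrite powRrM -powR_mulrn// ?powR_ge0.
pose S n := \sum_(1 <= k < n) k%:R `^ (a - 1) : R.
apply: (@squeeze_cvgr _ _ _ _ (fun n => a^-1 * (1 - (n%:R `^ a)^-1)) (cst a^-1)); last 2 first.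
- rewrite [X in _ --> X](_ : a^-1 = a^-1 * (1 - 0)); last by rewrite subr0 mulr1.
  apply: cvgMr; apply: cvgB; first exact: cvg_cst.
  by apply: invr_cvg0 => M; exact: near_powR_nat_ge.
- exact: cvg_cst.
near=> n; have n0 : (0 < n)%N by near: n; exact: nbhs_infty_gt.
have na0 : 0 < n%:R `^ a :> R by apply: powR_gt0; rewrite ltr0n.
have -> : (n%:R `^ (1 / 2 - 1 / (1 + alpha))) ^+ 2 = n%:R `^ a :> R.
  by rewrite sqE; congr (_ `^ _); rewrite /a; field; rewrite gt_eqF//; lra.
have -> : \sum_(1 <= k < n) (k%:R `^ (1 / (1 + alpha)) : R) ^- 2 = S n.
  apply: eq_bigr => k _; rewrite sqE -powRN; congr (_ `^ _).
  by rewrite /a; field; rewrite gt_eqF//; lra.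
have := telescope_powR_sum n.-1 a01; rewrite (prednK n0) -/(S n) => /andP[h1 h2'].
have h2 : a * S n <= n%:R `^ a.
  by apply: le_trans h2' _; apply: ge0_ler_powR; rewrite ?nnegrE ?(ltW a0)// ler_nat leq_pred.
apply/andP; split.
  by rewrite ler_pdivlMr// -(ler_pM2l a0) !mulrA mulfV ?gt_eqF// mul1r mulrBl mul1r mulVf ?gt_eqF//.
by rewrite ler_pdivrMr// -(ler_pM2l a0) mulrA mulfV ?gt_eqF// mul1r.
Unshelve. all: by end_near.
Qed.

Lemma ln_harmonic (n : nat) :
  ln (n.+1%:R : R) <= \sum_(1 <= k < n.+1) (k%:R^-1 : R) <= 1 + ln (n%:R : R).
Proof.
have up k : (0 < k)%N -> ln k.+1%:R - ln k%:R <= k%:R^-1 :> R.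
  move=> k0; have kR : 0 < k%:R :> R by rewrite ltr0n.
  rewrite -ln_div ?posrE ?ltr0n// -natr1 mulrDl mulfV ?gt_eqF// mul1r.
  by apply: le_ln1Dx; rewrite (lt_trans (ltrN10 _))// invr_gt0.
have lo k : (0 < k)%N -> k.+1%:R^-1 <= ln k.+1%:R - ln k%:R :> R.
  move=> k0; have kR : 0 < k%:R :> R by rewrite ltr0n.
  rewrite -opprB lerNr -ln_div ?posrE ?ltr0n//.
  have -> : k%:R / k.+1%:R = 1 + - k.+1%:R^-1 :> R.
    by rewrite -[in LHS](addrK 1 k%:R) natr1 mulrBl mul1r mulfV// pnatr_eq0.
  by apply: le_ln1Dx; rewrite ltrN2 invf_lt1 ?ltr0n// ltr1n.
(* At [n = 0] the upper bound relies on the convention that [ln 0] is 0. *)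
elim: n => [|n /andP[i1 i2]]; first by rewrite big_geq// ln1 lexx ln0// addr0 ler01.
rewrite (big_nat_recr n.+1)//=; apply/andP; split; first by rewrite -lerBlDl (le_trans _ (up _ _))// lerB.
have [->|n0] := posnP n; first by rewrite big_geq// add0r invr1 ln1 addr0.
by rewrite -lerBrDr (le_trans i2)// -addrA lerD2l lerBrDr addrC -lerBrDr lo.
Qed.

Lemma harmonic_sum_cvg :
  (\sum_(1 <= k < n) (k%:R `^ (1 / (1 + 1)) : R) ^- 2) / (Num.sqrt (ln n%:R)) ^+ 2 @[n --> \oo] --> (1 : R).
Proof.
apply: (@squeeze_cvgr _ _ _ _ (cst 1) (fun n => 1 + (ln n%:R)^-1)); last 2 first.
- exact: cvg_cst.
- rewrite -[X in _ --> X]addr0; apply: cvgD; first exact: cvg_cst.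
  by apply: invr_cvg0 => M; exact: near_ln_nat_ge.
near=> n; have n1 : (0 < n)%N by near: n; exact: nbhs_infty_gt.
have ln1 : 1 <= ln n%:R :> R by near: n; exact: near_ln_nat_ge.
have lnn0 : 0 < ln n%:R :> R by apply: lt_le_trans ln1.
rewrite sqr_sqrtr; last exact: ltW.
have -> : \sum_(1 <= k < n) (k%:R `^ (1 / (1 + 1)) : R) ^- 2 = \sum_(1 <= k < n) k%:R^-1.
  apply: eq_bigr => k _; congr (_^-1).
  by rewrite (_ : 1 + 1 = 2)// div1r -powR_mulrn ?powR_ge0// -powRrM mulVf// powRr1.
have := ln_harmonic n.-1; rewrite (prednK n1) => /andP[h1 h2'].
have h2 : \sum_(1 <= k < n) k%:R^-1 <= 1 + ln n%:R :> R.
  apply: le_trans h2' _; rewrite lerD2l; have [->|n0] := posnP n.-1; first by rewrite ln0// ltW.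
  by rewrite ler_ln ?posrE ?ltr0n// ler_nat leq_pred.
rewrite ler_pdivlMr// ler_pdivrMr// mul1r mulrDl mul1r mulVf ?gt_eqF// h1/=.
by rewrite addrC.
Unshelve. all: by end_near.
Qed.

End edge_scales.

(** * Convergence in distribution *)

Section tour_estimates.
Local Open Scope ereal_scope.
Context (d : measure_display) (T : measurableType d) (R : realType)
  (P : probability T R) (alpha : R) (alpha_ge1 : (1 <= alpha)%R) (m : nat)
  (X : {RV P >-> R}) (S : T -> R).
Notation mu1 := (Gamma (1 + 1%:R / (1 + alpha)) : R).
Notation M := (mean_edges alpha m).
Hypothesis mS : measurable_fun setT S.
Hypothesis integral_S : forall F : R -> \bar R, measurable_fun setT F -> (forall x, 0 <= F x) ->
  \int[P]_w F (S w) = chain (min_pdf alpha) m F 0%R.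
Hypothesis integral_XS : \int[P]_w `|X w - S w|%:E <= (2 * mu1)%R%:E.

Lemma integrable_tour_edges : P.-integrable setT (EFin \o S).
Proof.
apply/integrableP; split; first exact/measurable_EFinP.
rewrite (@integral_S (fun x => `|x%:E|))//; last exact: measurableT_comp.
by rewrite (@chain_translation _ _ alpha_ge1 m 0%R _ (lexx _))// ?ltry// => x x0; rewrite addr0 gee0_abs.
Qed.

(** [integral_S] concerns nonnegative functions, hence the two parts: on the nonnegative half-line
    the positive part is the identity, handled by [chain_translation], and the negative part is
    zero. *)
Lemma expectation_tour_edges : \int[P]_w (S w)%:E = M%:E.
Proof.
rewrite integralE.
have -> : \int[P]_w (fun w => (S w)%:E)^\+ w = M%:E.
  transitivity (\int[P]_w (Num.max (S w) 0)%R%:E).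
    by apply: eq_integral => w _; rewrite funeposE EFin_max.
  rewrite (@integral_S (fun x => (Num.max x 0)%R%:E))//.
  - rewrite (@chain_translation _ _ alpha_ge1 m 0%R _ (lexx _))// ?add0r// => x x0.
    by rewrite addr0 max_l.
  - by apply/measurable_EFinP; exact: measurable_maxr.
  - by move=> x; rewrite lee_fin le_max lexx orbT.
have -> : \int[P]_w (fun w => (S w)%:E)^\- w = 0.
  transitivity (\int[P]_w (Num.max (- S w) 0)%R%:E).
    by apply: eq_integral => w _; rewrite funenegE EFin_max EFinN.
  rewrite (@integral_S (fun x => (Num.max (- x) 0)%R%:E))//.
  - by rewrite (@chain_zero _ _ alpha_ge1 m)// => x x0; rewrite max_r ?oppr_le0.
  - by apply/measurable_EFinP; apply: measurable_maxr.
  - by move=> x; rewrite lee_fin le_max lexx orbT.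
by rewrite sube0.
Qed.

Let integrable_XS : P.-integrable setT (fun w => (X w - S w)%R%:E).
Proof.
apply/integrableP; split; first by apply/measurable_EFinP; exact: measurable_funB.
by apply: le_lt_trans integral_XS _; exact: ltry.
Qed.

Lemma expectation_near_mean : (`|fine 'E_P[X] - M| <= 2 * mu1)%R.
Proof.
have fXS : \int[P]_w (X w - S w)%R%:E \is a fin_num by exact: integrable_fin_num.
have EX : 'E_P[X] = M%:E + \int[P]_w (X w - S w)%R%:E.
  rewrite unlock -expectation_tour_edges -integralD//; last exact: integrable_tour_edges.
  by apply: eq_integral => w _; rewrite -EFinD addrC subrK.
rewrite EX fineD// addrC addKr -lee_fin; apply: le_trans integral_XS.
rewrite -[leLHS]/(`|(fine _)%:E|) fineK//.
apply: le_trans (le_abse_integral _ _ (measurable_int _ integrable_XS)) _ => //.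
Qed.

(** Passing from the tour to its sum without the closing edge costs the Lipschitz constant [3 K + 3]
    over [c], times [4 mu1]: half for the closing edge, half for the difference of the two means. *)
Lemma smooth_expectation (K c : R) (f : R -> R) : (0 <= K)%R -> (0 < c)%R -> smooth_test K f ->
  (`|fine (\int[P]_w (f ((X w - fine 'E_P[X]) / c))%:E) - gsmooth (edge_variance alpha c m) f 0| <=
   (3 * K + 3) * (4 * mu1) / c + chain_error alpha K c m)%R.
Proof.
move=> K0 c0 sf; have [f01 _] := sf.
have cf := smooth_test_continuous K0 sf.
have mf : measurable_fun setT f by exact: continuous_measurable_fun.
set E := fine 'E_P[X]; set C := (3 * K + 3)%R; have C0 : (0 <= C)%R by rewrite /C; lra.
have lip := smooth_test_lipschitz K0 sf.
pose a w : R := ((X w - E) / c)%R; pose b w : R := ((S w - M) / c)%R.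
have ma : measurable_fun setT a by apply: measurable_funM => //; exact: measurable_funB.
have mb : measurable_fun setT b by apply: measurable_funM => //; exact: measurable_funB.
have mfa : measurable_fun setT (fun w => (f (a w))%:E) by apply/measurable_EFinP; exact: measurableT_comp.
have mfb : measurable_fun setT (fun w => (f (b w))%:E) by apply/measurable_EFinP; exact: measurableT_comp.
pose g w : R := (C / c * (`|X w - S w| + 2 * mu1))%R.
have mg : measurable_fun setT g.
  apply: measurable_funM => //; apply: measurable_funD => //.
  by apply: measurableT_comp => //; exact: measurable_funB.
have mu0 : (0 <= mu1)%R := mu_ge0 alpha 1.
have g0 w : (0 <= g w)%R.
  by rewrite mulr_ge0 ?divr_ge0 ?(ltW c0)// addr_ge0// mulr_ge0.
have fab w : (`|f (a w) - f (b w)| <= g w)%R.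
  apply: le_trans (lip _ _) _; rewrite -/C /g -mulrA ler_wpM2l// mulrC ler_pdivlMr//.
  rewrite -[X in (_ * X)%R](gtr0_norm c0) -normrM mulrBl /a /b !divfK ?gt_eqF//.
  have -> : (X w - E - (S w - M) = (X w - S w) - (E - M))%R by ring.
  by apply: le_trans (ler_normB _ _) _; rewrite lerD2l expectation_near_mean.
have intg : \int[P]_w (g w)%:E <= (C * (4 * mu1) / c)%R%:E.
  rewrite /g; under eq_integral do rewrite EFinM.
  rewrite ge0_integralZl_EFin//; last 3 first.
  - by move=> w _; rewrite lee_fin addr_ge0// mulr_ge0.
  - apply/measurable_EFinP; apply: measurable_funD => //.
    by apply: measurableT_comp => //; exact: measurable_funB.
  - by rewrite divr_ge0 ?(ltW c0).
  under eq_integral do rewrite EFinD.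
  rewrite ge0_integralD//; last 2 first.
  - apply/measurable_EFinP; apply: measurableT_comp => //; exact: measurable_funB.
  - by move=> w _; rewrite lee_fin mulr_ge0.
  rewrite [X in _ * (_ + X)](integral_cst P measurableT (2 * mu1)%R%:E).
  rewrite [X in _ * (_ + _ * X)](@probability_setT _ _ _ P) mule1.
  have -> : (C * (4 * mu1) / c = C / c * (2 * mu1 + 2 * mu1))%R by ring.
  rewrite [leRHS]EFinM lee_wpmul2l ?lee_fin ?divr_ge0 ?(ltW c0)// EFinD.
  by rewrite leeD2r.
have f0 y : (0 <= f y)%R by case/andP: (f01 y).
have mgE : measurable_fun setT (fun w => (g w)%:E) by exact/measurable_EFinP.
have le_f u v : measurable_fun setT (fun w => (f (u w))%:E) -> measurable_fun setT (fun w => (f (v w))%:E) ->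
    (forall w, f (u w) <= f (v w) + g w)%R ->
    \int[P]_w (f (u w))%:E <= \int[P]_w (f (v w))%:E + \int[P]_w (g w)%:E.
  move=> mu mv le; rewrite -ge0_integralD//; last 2 first.
  - by move=> w _; rewrite lee_fin.
  - by move=> w _; rewrite lee_fin.
  apply: ge0_le_integral => //.
  - by move=> w _; rewrite lee_fin.
  - exact: emeasurable_funD.
  - by move=> w _; rewrite -EFinD lee_fin.
have leab : \int[P]_w (f (a w))%:E <= \int[P]_w (f (b w))%:E + \int[P]_w (g w)%:E.
  by apply: le_f => // w; have := fab w; rewrite ler_norml; lra.
have leba : \int[P]_w (f (b w))%:E <= \int[P]_w (f (a w))%:E + \int[P]_w (g w)%:E.
  by apply: le_f => // w; have := fab w; rewrite ler_norml; lra.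
have fin u : measurable_fun setT (fun w => (f (u w))%:E) -> \int[P]_w (f (u w))%:E \is a fin_num.
  move=> mu; rewrite ge0_fin_numE; last by apply: integral_ge0 => w _; rewrite lee_fin.
  apply: (@le_lt_trans _ _ (\int[P]_w (cst 1 w))).
    apply: ge0_le_integral => //; first by move=> w _; rewrite lee_fin.
    by move=> w _; rewrite lee_fin; case/andP: (f01 (u w)).
  rewrite (integral_cst P measurableT 1) [X in _ * X](@probability_setT _ _ _ P) mule1.
  exact: ltry.
have fa := fin a mfa; have fb := fin b mfb.
have [h1 h2] := @chain_trotter _ _ alpha_ge1 K c f K0 c0 sf m 0%R M 0%R (lexx _).
rewrite add0r sub0r addNr mul0r in h1 h2.
have Eb : chain (min_pdf alpha) m (fun x => (gsmooth 0 f ((x - M) / c))%:E) 0 = \int[P]_w (f (b w))%:E.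
  rewrite -integral_S//.
  - by apply: eq_integral => w _; rewrite gsmooth0.
  - under eq_fun do rewrite gsmooth0.
    apply/measurable_EFinP; apply: measurableT_comp => //.
    by apply: measurable_funM => //; exact: measurable_funB.
  - by move=> x; rewrite gsmooth0 lee_fin.
rewrite Eb in h1 h2.
have := le_trans leab (leeD2l _ intg); have := le_trans leba (leeD2l _ intg).
move: h1 h2; rewrite -(fineK fa) -(fineK fb) -!EFinD !lee_fin => h1 h2 h3 h4.
rewrite ler_norml; apply/andP; split; rewrite -/C; lra.
Qed.

End tour_estimates.

Section convergence_in_distribution.
Context (R : realType).

(** [soft_step] descends from 1 at 0 to 0 at 3, so after scaling the transition takes place on
    [[a, a + 3 e]]. *)
Lemma soft_step_sandwich (d : measure_display) (T : measurableType d) (P : probability T R)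
    (X : T -> R) (a e : R) : measurable_fun setT X -> 0 < e ->
  fine (P (X @^-1` `]-oo, a])) <= fine (\int[P]_w (soft_step ((X w - a) / e))%:E) <=
  fine (P (X @^-1` `]-oo, a + 3 * e])).
Proof.
move=> mX e0; set f := fun w => soft_step ((X w - a) / e).
have K0 : 0 <= 2 / e ^+ 3 by rewrite divr_ge0// exprn_ge0// ltW.
have mf : measurable_fun setT (fun w => (f w)%:E).
  apply/measurable_EFinP; apply: (measurableT_comp (f := fun x : R => soft_step ((x - a) / e)))%classic => //.
  by apply: continuous_measurable_fun; exact: smooth_test_continuous (smooth_test_soft_step a e0).
have f01 w : 0 <= f w <= 1 := soft_step_unit_valued _.
have mI b : measurable (X @^-1` `]-oo, b]) by rewrite -[X in measurable X]setTI; exact: mX.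
have finP (A : set T) : measurable A -> P A \is a fin_num by move=> mA; exact: fin_num_measure.
have ind b : (\int[P]_w (\1_(X @^-1` `]-oo, b]) w)%:E = P (X @^-1` `]-oo, b]))%E.
  by rewrite integral_indic// setIT.
have lo w : \1_(X @^-1` `]-oo, a]) w <= f w.
  rewrite indicE; have [|_] := boolP (w \in _); last by case/andP: (f01 w).
  rewrite inE/= in_itv/= => Xa; rewrite /f soft_step_le0// pmulr_lle0 ?invr_gt0// subr_le0//.
have up w : f w <= \1_(X @^-1` `]-oo, a + 3 * e]) w.
  rewrite indicE; have [_|] := boolP (w \in _); first by case/andP: (f01 w).
  rewrite notin_setE/= in_itv/= => /negP; rewrite -ltNge => Xa.
  by rewrite /f soft_step_ge3// ler_pdivlMr// lerBrDl ltW.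
have le1 : (P (X @^-1` `]-oo, a]) <= \int[P]_w (f w)%:E)%E.
  rewrite -ind; apply: ge0_le_integral => //.
  - by apply/measurable_EFinP; exact: measurable_indic.
  - by move=> w _; rewrite lee_fin; case/andP: (f01 w).
have le2 : (\int[P]_w (f w)%:E <= P (X @^-1` `]-oo, (a + 3 * e)%R]))%E.
  rewrite -ind; apply: ge0_le_integral => //.
  - by move=> w _; rewrite lee_fin; case/andP: (f01 w).
  - by apply/measurable_EFinP; exact: measurable_indic.
  - by move=> w _; rewrite lee_fin.
have ff : (\int[P]_w (f w)%:E)%E \is a fin_num.
  rewrite ge0_fin_numE; first by apply: le_lt_trans le2 _; have := finP _ (mI (a + 3 * e)); rewrite fin_numElt => /andP[].
  by apply: integral_ge0 => w _; rewrite lee_fin; case/andP: (f01 w).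
by rewrite !fine_le// finP.
Qed.

Lemma cvg_in_distribution_soft_step (d : nat -> measure_display) (T : forall n, measurableType (d n))
    (P : forall n, probability (T n) R) (X : forall n, {RV (P n) >-> R})
    (mu : probability (measurableTypeR R) R) :
  (forall a e : R, 0 < e -> fine (\int[P n]_w (soft_step ((X n w - a) / e))%:E) @[n --> \oo] -->
     fine (\int[mu]_y (soft_step ((y - a) / e))%:E)) ->
  cvg_in_distribution X mu.
Proof.
move=> H x cx.
have mufin r : mu `]-oo, r]%classic \is a fin_num by exact: fin_num_measure.
pose G r := fine (mu `]-oo, r]%classic).
have cG : G r @[r --> x] --> G x.
  by apply: fine_cvg; rewrite fineK//; exact: cx.
rewrite -(fineK (mufin x)); apply: cvg_EFin.
  by near=> n; apply: fin_num_measure.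
have cdfE n : cdf (X n) x = P n (X n @^-1` `]-oo, x]) by [].
apply/cvgrPdist_le => dl dl0; have dl2 : 0 < dl / 2 by rewrite divr_gt0.
move/cvgrPdist_le: cG => /(_ _ dl2)/nbhs_ballP[eta /= eta0 Geta].
(* The transition width [3 e] must stay below [eta]. The soft step placed at [x] bounds the
   distribution function from above, the one placed at [x - 3 e] from below. *)
pose e := eta / 4; have e0 : 0 < e by rewrite divr_gt0.
have mid : measurable_fun setT (fun y : measurableTypeR R => y : R) by [].
have Gr : `|G x - G (x + 3 * e)| <= dl / 2.
  by apply: Geta; rewrite /ball/= opprD addrA subrr add0r normrN ger0_norm /e; lra.
have Gl : `|G x - G (x - 3 * e)| <= dl / 2.
  by apply: Geta; rewrite /ball/= opprB addrC subrK ger0_norm /e; lra.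
near=> n.
have hr : `|fine (\int[mu]_y (soft_step ((y - x) / e))%:E) - fine (\int[P n]_w (soft_step ((X n w - x) / e))%:E)| <= dl / 2.
  by near: n; move/cvgrPdist_le: (H x e e0) => /(_ _ dl2).
have hl : `|fine (\int[mu]_y (soft_step ((y - (x - 3 * e)) / e))%:E) - fine (\int[P n]_w (soft_step ((X n w - (x - 3 * e)) / e))%:E)| <= dl / 2.
  by near: n; move/cvgrPdist_le: (H (x - 3 * e) e e0) => /(_ _ dl2).
have mXn : measurable_fun setT (X n : T n -> R) by [].
have := soft_step_sandwich (P n) x mXn e0.
have := soft_step_sandwich (P n) (x - 3 * e) mXn e0.
have := soft_step_sandwich mu x mid e0.
have := soft_step_sandwich mu (x - 3 * e) mid e0.
rewrite !subrK !preimage_id -!/(G _).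
rewrite /= cdfE -/(G x).
move: hr hl Gr Gl.
move: (fine _) (fine (\int[mu]_y _)) (fine (\int[P n]_w _)) (fine (\int[mu]_y _)) (fine (\int[P n]_w _)) (G x) (G _) (G _).
move=> p i1 i2 i3 i4 g0 g1 g2; rewrite !ler_norml.
move=> /andP[? ?] /andP[? ?] /andP[? ?] /andP[? ?] /andP[? ?] /andP[? ?] /andP[? ?] /andP[? ?].
by apply/andP; split; lra.
Unshelve. all: by end_near.
Qed.

End convergence_in_distribution.

(** * The limit theorem for a general normalization *)

Section tour_limit.
Context (R : realType) (alpha : R).
Hypothesis alpha_ge1 : 1 <= alpha.
Notation root k := (k%:R `^ (1 / (1 + alpha)) : R).
Notation mu1 := (Gamma (1 + 1%:R / (1 + alpha)) : R).

Lemma tour_smooth_expectation (n : nat) (d : measure_display) (T : measurableType d)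
    (P : probability T R) (L : 'I_n -> 'I_n -> {RV P >-> R}) (X : {RV P >-> R}) (K c : R) (f : R -> R) :
  (2 < n)%N ->
  (forall i j w, L i j w = L j i w) ->
  mutually_independent [set p : 'I_n * 'I_n | (p.1 < p.2)%N]%SET (fun p => L p.1 p.2) ->
  (forall i j : 'I_n, (i < j)%N -> has_density (L i j) (weibull_pdf alpha)) ->
  (forall w, exists2 v : nat -> 'I_n, nn_tour (fun i j => L i j w) v
     & X w = tour_length (fun i j => L i j w) v) ->
  0 <= K -> 0 < c -> smooth_test K f ->
  `|fine (\int[P]_w (f ((X w - fine 'E_P[X]) / c))%:E) - gsmooth (edge_variance alpha c n.-1) f 0| <=
  (3 * K + 3) * (4 * mu1) / c + chain_error alpha K c n.-1.
Proof.
case: n L => // m L m1 L_sym L_indep L_weibull X_nn.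
have mS := measurable_tour_edges L.
apply: (smooth_expectation alpha_ge1 mS).
- exact: integral_tour_edges L_sym L_indep L_weibull X_nn.
- exact: integral_closing_edge L_sym L_indep L_weibull X_nn.
Qed.

Lemma edge_varianceE (c : R) (n : nat) : (0 < n)%N ->
  edge_variance alpha c n.-1 = sigma2 alpha * ((\sum_(1 <= k < n) root k ^- 2) / c ^+ 2).
Proof.
move=> n0; rewrite /edge_variance prednK// mulr_suml mulr_sumr.
by apply: eq_bigr => k _; congr (_ * _); rewrite exprMn invfM mulrC.
Qed.

(** As [root k >= 1], the cube of [c * root k] is at least [c] times its square. The third moments
    are thus bounded by the normalized variance over [c]. *)
Lemma le_chain_error (K c : R) (n : nat) : (0 < n)%N -> 0 <= K -> 0 < c ->
  chain_error alpha K c n.-1 <=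
  trotter_error alpha K * ((\sum_(1 <= k < n) root k ^- 2) / c ^+ 2) * c^-1.
Proof.
move=> n0 K0 c0; rewrite /chain_error prednK// -mulrA !mulr_suml mulr_sumr.
rewrite !big_nat; apply: ler_sum => k /andP[k1 _].
rewrite ler_wpM2l ?trotter_error_ge0//.
have rk : 1 <= root k.
  rewrite -[leLHS](powRr0 k%:R) ler_powR ?ler1n//.
  by rewrite divr_ge0// addr_ge0// (le_trans ler01).
have rk0 : 0 < root k by apply: lt_le_trans rk.
rewrite -mulrA -invfM -exprSr -invfM lef_pV2 ?posrE ?mulr_gt0 ?exprn_gt0 ?mulr_gt0//.
rewrite exprMn mulrC ler_pM2l ?exprn_gt0//.
by rewrite [leRHS]exprS ler_peMl// exprn_ge0// ltW.
Qed.

Lemma gsmooth_normal_prob (s K : R) (f : R -> R) : 0 < s -> 0 <= K -> smooth_test K f ->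
  fine (\int[normal_prob 0 s]_y (f y)%:E) = gsmooth (s ^+ 2) f 0.
Proof.
move=> s0 K0 sf; have [f01 _] := sf; have cf := smooth_test_continuous K0 sf.
have f0 y : 0 <= f y by case/andP: (f01 y).
have mf : measurable_fun setT f by exact: continuous_measurable_fun.
rewrite (@ge0_integral_density R (normal_prob 0 s) (normal_pdf 0 s) (fun y => (f y)%:E)).
- under eq_integral do rewrite -EFinM.
  rewrite ge0_integral_normal_scale//.
  rewrite -[RHS]/(fine (gsmooth _ f 0)%:E) EFin_gsmooth// sqrtr_sqr gtr0_norm//.
  by congr fine; apply: eq_integral => z _; rewrite add0r.
- exact: measurable_normal_pdf.
- by move=> x; exact: normal_pdf_ge0.
- by [].
- exact/measurable_EFinP.
- by move=> y; rewrite lee_fin.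
Qed.

Context (d : nat -> measure_display) (Omega : forall n, measurableType (d n))
    (P : forall n, probability (Omega n) R)
    (L : forall n, 'I_n -> 'I_n -> {RV (P n) >-> R})
    (TNN : forall n, {RV (P n) >-> R}).
Hypothesis L_sym : forall n (i j : 'I_n) w, L i j w = L j i w.
Hypothesis L_indep : forall n, mutually_independent
       [set p : 'I_n * 'I_n | (p.1 < p.2)%N]%SET (fun p => @L n p.1 p.2).
Hypothesis L_weibull : forall n (i j : 'I_n), (i < j)%N -> has_density (L i j) (weibull_pdf alpha).
Hypothesis TNN_nn : forall n w, (1 < n)%N ->
       exists2 v : nat -> 'I_n, nn_tour (fun i j => L i j w) v
         & TNN n w = tour_length (fun i j => L i j w) v.

(** Both regimes are instances: all that is asked of the normalization is that it tends to infinity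
    and that the normalized sum of [k^(-2/(1+alpha))] has a positive limit. *)
Lemma tour_cvg_in_distribution (c : nat -> R) (w : R) :
  (forall M, \forall n \near \oo, M <= c n) -> 0 < w ->
  (\sum_(1 <= k < n) root k ^- 2) / c n ^+ 2 @[n --> \oo] --> w ->
  cvg_in_distribution (fun n => centered_scaled (TNN n) (c n)) (normal_prob 0 (Num.sqrt (w * sigma2 alpha))).
Proof.
move=> cinf w0 cvgw; apply: cvg_in_distribution_soft_step => a e e0.
set f := fun y : R => soft_step ((y - a) / e).
set K := 2 / e ^+ 3; have K0 : 0 <= K by rewrite divr_ge0// exprn_ge0// ltW.
have sf : smooth_test K f := smooth_test_soft_step a e0.
have [f01 _] := sf; have cf := smooth_test_continuous K0 sf.
have mf : measurable_fun setT f by exact: continuous_measurable_fun.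
have s2 : 0 < w * sigma2 alpha by rewrite mulr_gt0// sigma2_gt0.
have -> : fine (\int[normal_prob 0 (Num.sqrt (w * sigma2 alpha))]_y (f y)%:E) = gsmooth (w * sigma2 alpha) f 0.
  by rewrite (gsmooth_normal_prob _ K0 sf) ?sqrtr_gt0// sqr_sqrtr; last exact: ltW.
pose V n := (\sum_(1 <= k < n) root k ^- 2) / c n ^+ 2.
pose C := 3 * K + 3.
(* The three errors are the closing edge with the recentering, the Lindeberg replacement, and the
   passage from the variance at [n] to its limit. *)
pose D n := C * (4 * mu1) * (c n)^-1 + trotter_error alpha K * V n * (c n)^-1 +
  C * `|Num.sqrt (sigma2 alpha * V n) - Num.sqrt (w * sigma2 alpha)| * normal_abs1 R.
have cV : (c n)^-1 @[n --> \oo] --> 0 by exact: invr_cvg0.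
have cD : D n @[n --> \oo] --> 0.
  have -> : 0 = C * (4 * mu1) * 0 + trotter_error alpha K * w * 0 +
     C * `|Num.sqrt (sigma2 alpha * w) - Num.sqrt (w * sigma2 alpha)| * normal_abs1 R.
    by rewrite (mulrC w) subrr normr0 !mulr0 mul0r !addr0.
  apply: cvgD.
    apply: cvgD; first by apply: cvgMr.
    by apply: cvgM => //; apply: cvgMr.
  apply: cvgMl; apply: cvgMr; apply: cvg_norm; apply: cvgB; last exact: cvg_cst.
  by apply: continuous_cvg; [exact: sqrt_continuous|exact: cvgMr].
apply/cvgrPdist_le => dl dl0; near=> n.
(* With at least three cities the closing edge differs from the first edge, as [integral_last_edge]
   requires. *)
have n2 : (2 < n)%N by near: n; exact: nbhs_infty_gt.
have c0 : 0 < c n by apply: (@lt_le_trans _ _ 1) => //; near: n; exact: cinf.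
have Dn : `|D n| <= dl.
  by rewrite -normrN -sub0r; near: n; move/cvgrPdist_le: cD; exact.
rewrite distrC.
have -> : fine (\int[P n]_w0 (soft_step ((centered_scaled (TNN n) (c n) w0 - a) / e))%:E) =
    fine (\int[P n]_w0 (f ((TNN n w0 - fine 'E_(P n)[TNN n]) / c n))%:E).
  congr fine; apply: eq_integral => x _; rewrite (_ : centered_scaled _ _ x =
    (TNN n x - fine 'E_(P n)[TNN n]) / c n)//.
have h1 := tour_smooth_expectation n2 (@L_sym n) (@L_indep n) (@L_weibull n)
  (fun w => TNN_nn w (ltnW n2)) K0 c0 sf.
have n0 : (0 < n)%N by apply: ltn_trans n2.
have h2 := le_chain_error n0 K0 c0.
have h3 := gsmooth_lipschitz_time (edge_variance alpha (c n) n.-1) (w * sigma2 alpha) 0 mf f01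
  (smooth_test_lipschitz K0 sf).
rewrite -(subrKA (gsmooth (edge_variance alpha (c n) n.-1) f 0)).
apply: le_trans (ler_normD _ _) _; apply: le_trans (le_trans (ler_norm _) Dn).
rewrite /D; apply: lerD; first exact: le_trans h1 (lerD (lexx _) h2).
by rewrite -edge_varianceE.
Unshelve. all: by end_near.
Qed.

End tour_limit.

Theorem theorem2p5 (R : realType) (alpha : R)
    (d : nat -> measure_display) (Omega : forall n, measurableType (d n))
    (P : forall n, probability (Omega n) R)
    (L : forall n, 'I_n -> 'I_n -> {RV (P n) >-> R})
    (TNN : forall n, {RV (P n) >-> R})
    (alpha_ge1 : 1 <= alpha)
    (L_sym : forall n (i j : 'I_n) w, L n i j w = L n j i w)
    (L_indep : forall n, mutually_independent
       [set p : 'I_n * 'I_n | (p.1 < p.2)%N]%SET (fun p => L n p.1 p.2))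
    (L_weibull : forall n (i j : 'I_n), (i < j)%N ->
       has_density (L n i j) (weibull_pdf alpha))
    (TNN_nn : forall n w, (1 < n)%N ->
       exists2 v : nat -> 'I_n, nn_tour (fun i j => L n i j w) v
         & TNN n w = tour_length (fun i j => L n i j w) v) :
  (1 < alpha ->
     cvg_in_distribution
       (fun n => centered_scaled (TNN n) (n%:R `^ (1 / 2 - 1 / (1 + alpha))))
       (normal_prob 0 (Num.sqrt ((alpha + 1) / (alpha - 1) * sigma2 alpha))))
  /\
  (alpha = 1 ->
     cvg_in_distribution
       (fun n => centered_scaled (TNN n) (Num.sqrt (ln n%:R)))
       (normal_prob 0 (Num.sqrt (sigma2 alpha)))).
Proof.
split=> alphaE.
- apply: (@tour_cvg_in_distribution R alpha alpha_ge1 d Omega P L TNN L_sym L_indep L_weibull TNN_nn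
    (fun n => n%:R `^ (1 / 2 - 1 / (1 + alpha))) ((alpha + 1) / (alpha - 1))).
  + move=> M; apply: near_powR_nat_ge; clear -alphaE.
    by rewrite subr_gt0 ltr_pdivrMr; lra.
  + by clear -alphaE; rewrite divr_gt0//; lra.
  + exact: root_sqr_sum_cvg.
- have one_ge1 : 1 <= 1 :> R by [].
  have L1 : forall n (i j : 'I_n), (i < j)%N -> has_density (L n i j) (weibull_pdf 1).
    by rewrite -alphaE.
  rewrite alphaE -[sigma2 1](mul1r (sigma2 1)).
  apply: (@tour_cvg_in_distribution R 1 one_ge1 d Omega P L TNN L_sym L_indep L1 TNN_nn
    (fun n => Num.sqrt (ln n%:R)) 1).
  + by move=> M; exact: near_sqrt_ln_nat_ge.
  + exact: ltr01.
  + exact: harmonic_sum_cvg.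
Qed.
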